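(* Let $G$ be a non-trivial finite subgroup of isometries of $\mathbb{R}^2$ fixing the origin (so $G$ is one of the groups $C_n$ with $n\ge 2$ or $D_n$ with $n\ge 1$), and let $w>0$. Then the minimizers of area among the $G$-invariant convex bodies of constant width $w$ are given as follows: (1) If $G=D_1$, then the minimizers are precisely the regular Reuleaux triangles of width $w$ that are invariant under the prescribed reflection. (2) If $G$ contains the rotation $\mathcal{R}_\pi$ by angle $\pi$ (equivalently, if $G=C_n$ or $G=D_n$ with $n$ even), then the unique minimizer is the disk $B_w$ of diameter $w$. (3) If $G=C_n$ with $n\ge 3$ odd, then the minimizers are precisely the centered regular Reuleaux $n$-gons of width $w$; equivalently, the minimizer is unique up to rotation. (4) If $G=D_n$ with $n\ge 3$ odd, then the minimizers are exactly the two centered regular Reuleaux $n$-gons of width $w$ that are invariant under the prescribed action of $D_n$. Equivalently, they are the two orientations for which the prescribed reflection axis is a symmetry axis of the Reuleaux polygon.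
   Context: A convex body $K\subset\mathbb{R}^2$ is a compact convex set with non-empty interior. Its support function is $h(K,u)=\max_{x\in K}\langle x,u\rangle$ for $u\in\mathbb{S}^1$, and its width in direction $u$ is $h(K,u)+h(K,-u)$. $K$ has constant width $w>0$ if $h(K,u)+h(K,-u)=w$ for all $u\in\mathbb{S}^1$. For a group $G$ of isometries, $K$ is $G$-invariant if $g(K)=K$ for all $g\in G$. $\mathcal{R}_\alpha$ is the rotation by angle $\alpha$ about the origin. $C_n$ ($n\ge 2$) is the cyclic group generated by $\mathcal{R}_{2\pi/n}$. $D_n$ ($n\ge 1$) is generated by $\mathcal{R}_{2\pi/n}$ together with the reflection $S$ across a prescribed line through the origin, called the prescribed reflection axis (it may be taken to be $\{y=0\}$); in particular $D_1=\{I,S\}$. Every non-trivial finite group of isometries of $\mathbb{R}^2$ fixing the origin is one of these. For odd $n\ge 3$, a regular Reuleaux $n$-gon of width $w$ is constructed from a regular $n$-gon with consecutive vertices $V_0,\dots,V_{n-1}$ (indices mod $n$) lying on a circle of radius $\frac{w}{2\cos(\pi/(2n))}$, by replacing each side $[V_j,V_{j+1}]$ with the (short) circular arc of radius $w$ from $V_j$ to $V_{j+1}$ centered at the opposite vertex $V_{j+(n+1)/2}$; the Reuleaux polygon is the closed region bounded by these arcs. It is called centered if the circle through the $V_j$ is centered at the origin. A regular Reuleaux triangle is the case $n=3$ (not necessarily centered). $B_w$ is the closed disk of diameter $w$ centered at the origin. *)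

(* Defs.v *)
From HB Require Import structures.
From mathcomp Require Import all_boot all_order all_algebra.
From mathcomp Require Import all_classical all_reals all_analysis.

Set Implicit Arguments.
Unset Strict Implicit.
Unset Printing Implicit Defensive.

Import Order.TTheory GRing.Theory Num.Theory.
Import numFieldNormedType.Exports.

Local Open Scope classical_set_scope.
Local Open Scope ring_scope.

(* The Euclidean plane is R * R, with its product topology, product            *)
(* sigma-algebra and componentwise linear structure. The library norm on       *)
(* R * R is the sup norm, so the Euclidean one is defined here.                *)

Definition dotp {R : realType} (x y : R * R) : R := x.1 * y.1 + x.2 * y.2.

Definition enorm {R : realType} (x : R * R) : R := Num.sqrt (dotp x x).

Definition unit_vector {R : realType} (u : R * R) : Prop := enorm u = 1.

Definition polar {R : realType} (t : R) : R * R := (cos t, sin t).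

Definition area {R : realType} (K : set (R * R)) : \bar R :=
  (@lebesgue_measure R \x @lebesgue_measure R)%E K.

Definition isometry {R : realType} (f : R * R -> R * R) : Prop :=
  forall x y, enorm (f x - f y) = enorm (x - y).

Definition isometry_group {R : realType} (G : set (R * R -> R * R)) : Prop :=
  [/\ forall f, G f -> isometry f,
      G id,
      forall f g, G f -> G g -> G (f \o g) &
      forall f, G f -> exists2 g, G g & f \o g = id /\ g \o f = id].

Definition fixes_origin {R : realType} (G : set (R * R -> R * R)) : Prop :=
  forall f, G f -> f 0 = 0.

Definition rotation {R : realType} (a : R) (x : R * R) : R * R :=
  (cos a * x.1 - sin a * x.2, sin a * x.1 + cos a * x.2).

(* Reflection across the line through the origin spanned by the unit vector u. *)
Definition reflection {R : realType} (u x : R * R) : R * R :=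
  (2 * dotp x u) *: u - x.

Definition generated_group {R : realType} (A : set (R * R -> R * R)) :
  set (R * R -> R * R) := smallest isometry_group A.

Definition cyclic_group {R : realType} (n : nat) : set (R * R -> R * R) :=
  generated_group [set rotation (2 * pi / n%:R)].

Definition dihedral_group {R : realType} (n : nat) (u : R * R) :
  set (R * R -> R * R) :=
  generated_group [set rotation (2 * pi / n%:R); reflection u].

Definition convex_body {R : realType} (K : set (R * R)) : Prop :=
  [/\ compact K, convex_set K & K° !=set0].

Definition support_function {R : realType} (K : set (R * R)) (u : R * R) : R :=
  sup [set dotp x u | x in K].

Definition constant_width {R : realType} (w : R) (K : set (R * R)) : Prop :=
  forall u, unit_vector u ->
    support_function K u + support_function K (- u) = w.

Definition invariant_under {R : realType} (G : set (R * R -> R * R))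
    (K : set (R * R)) : Prop :=
  forall g, G g -> g @` K = K.

Definition admissible {R : realType} (G : set (R * R -> R * R)) (w : R)
    (K : set (R * R)) : Prop :=
  [/\ convex_body K, constant_width w K & invariant_under G K].

Definition minimizer {R : realType} (G : set (R * R -> R * R)) (w : R)
    (K : set (R * R)) : Prop :=
  admissible G w K /\ forall L, admissible G w L -> (area K <= area L)%E.

Definition disk {R : realType} (w : R) : set (R * R) :=
  [set x | enorm x <= w / 2].

(* V_j, for the circle centered at c and V_0 in direction t; by periodicity of  *)
(* cos and sin the index is automatically read modulo n.                        *)
Definition vertex {R : realType} (n : nat) (w : R) (c : R * R) (t : R)
    (j : nat) : R * R :=
  c + (w / (2 * cos (pi / (2 * n%:R)))) *: polar (t + 2 * pi * j%:R / n%:R).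

(* The short arc of radius r centered at o from p to q, both at distance r from *)
(* o and not antipodal: the part of the circle in the angular sector at o       *)
(* spanned by the two rays through p and q.                                     *)
Definition short_arc {R : realType} (r : R) (o p q : R * R) : set (R * R) :=
  [set x | enorm (x - o) = r /\
     exists a b : R, [/\ 0 <= a, 0 <= b & x - o = a *: (p - o) + b *: (q - o)]].

Definition reuleaux_boundary {R : realType} (n : nat) (w : R) (c : R * R)
    (t : R) : set (R * R) :=
  \bigcup_(j in `I_n)
    short_arc w (vertex n w c t (j + n.+1./2)%N)
                (vertex n w c t j) (vertex n w c t j.+1).

(* A curve together with the bounded components of its complement. *)
Definition enclosed_region {R : realType} (C : set (R * R)) : set (R * R) :=
  C `|` [set x | ~ C x /\ bounded_set (connected_component (~` C) x)].

Definition regular_reuleaux {R : realType} (n : nat) (w : R)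
    (K : set (R * R)) : Prop :=
  exists (c : R * R) (t : R), K = enclosed_region (reuleaux_boundary n w c t).

Definition centered_regular_reuleaux {R : realType} (n : nat) (w : R)
    (K : set (R * R)) : Prop :=
  exists t : R, K = enclosed_region (reuleaux_boundary n w 0 t).

(* Main.v *)
Require Import Defs.
From HB Require Import structures.
From mathcomp Require Import all_boot all_order all_algebra.
From mathcomp Require Import all_classical all_reals all_analysis.
From mathcomp Require Import measurable_realfun ring lra.
Import Order.TTheory GRing.Theory Num.Theory.
Import numFieldNormedType.Exports.

Set Implicit Arguments.
Unset Strict Implicit.
Unset Printing Implicit Defensive.

Local Open Scope classical_set_scope.
Local Open Scope ring_scope.

(** Let [h] be the support function of a body of constant width [w] and
    [g = h - w/2], so that [g (t + pi) = - g t].  When [g] vanishes at all the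
    points [t0 + m pi / n], the inequality
      [h b sin (c - a) <= h a sin (c - b) + h c sin (b - a)]
    bounds [|g|] pointwise by the corresponding function of a centered regular
    Reuleaux [n]-gon.  The body is the intersection of its circumscribed
    polygons with [2 n 2^k] equally spaced normals, whose areas are quadratic in
    [h]: each normal contributes half its support value times its side length.
    Since the side lengths are nonnegative and those of opposite sides have a
    fixed sum, the pointwise bound makes every such polygon at least as large as
    the one of the Reuleaux polygon; in the limit this compares the areas, with
    equality only when [|g|] is the extremal function, which forces the vertices
    of a Reuleaux [n]-gon into the body.  Under [n]-fold rotational symmetry
    with [n] odd, [g] is antiperiodic with antiperiod [pi / n] and therefore has
    such zeros.  For [n = 3] every body has them after a translation (it has a
    circumscribed regular hexagon), which handles the reflection group [D_1]. *)

(** * The Euclidean plane *)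

Section Plane.
Variable R : realType.
Implicit Types (x y z u : R * R) (r s t a b c : R).

(** The bound is sharp for the following reason. Up to a constant, each pair of opposite sides
    contributes [g * (l - w * c)], where [c = step_tan p] and the side length [l] lies between [0]
    and [2 * w * c]. For given [|g|] this is least when the side vanishes where [g > 0] and is as
    long as possible where [g < 0]. A Reuleaux polygon does exactly this: its normals belong
    alternately to a vertex, where the sides vanish, and to an arc of radius [w], where they are
    full. Placing the first normal at a zero of [g] and doubling the number of normals keeps all the
    zeros among the normals and makes the polygons nested. A limit loses strict inequalities, so the
    equality case rests on a deficit that is uniform in the level. One set of zeros fits two
    Reuleaux polygons, [pi / n] apart; the sign of [g] at one midpoint decides between them. If the
    group contains the half turn, [g] is both invariant and changed in sign under it, so the disk is
    the only candidate. *)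

Lemma fstZ r x : (r *: x).1 = r * x.1. Proof. by []. Qed.
Lemma sndZ r x : (r *: x).2 = r * x.2. Proof. by []. Qed.
Lemma fstD x y : (x + y).1 = x.1 + y.1. Proof. by []. Qed.
Lemma sndD x y : (x + y).2 = x.2 + y.2. Proof. by []. Qed.
Lemma fstN x : (- x).1 = - x.1. Proof. by []. Qed.
Lemma sndN x : (- x).2 = - x.2. Proof. by []. Qed.
Definition coordE := (fstZ, sndZ, fstD, sndD, fstN, sndN).

Lemma coord_eq x y : x.1 = y.1 -> x.2 = y.2 -> x = y.
Proof. by case: x y => ? ? [? ?] /= -> ->. Qed.

Lemma dotpC x y : dotp x y = dotp y x.
Proof. by rewrite /dotp mulrC [X in _ + X]mulrC. Qed.

Lemma dotpDl x y z : dotp (x + y) z = dotp x z + dotp y z.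
Proof. by rewrite /dotp /=; ring. Qed.

Lemma dotpNl x y : dotp (- x) y = - dotp x y.
Proof. by rewrite /dotp /=; ring. Qed.

Lemma dotpBl x y z : dotp (x - y) z = dotp x z - dotp y z.
Proof. by rewrite dotpDl dotpNl. Qed.

Lemma dotpZl r x y : dotp (r *: x) y = r * dotp x y.
Proof. by rewrite /dotp !coordE; ring. Qed.

Lemma dotpDr x y z : dotp z (x + y) = dotp z x + dotp z y.
Proof. by rewrite dotpC dotpDl 2!(dotpC z). Qed.

Lemma dotpNr x y : dotp x (- y) = - dotp x y.
Proof. by rewrite dotpC dotpNl dotpC. Qed.

Lemma dotpBr x y z : dotp z (x - y) = dotp z x - dotp z y.
Proof. by rewrite dotpDr dotpNr. Qed.

Lemma dotpZr r x y : dotp x (r *: y) = r * dotp x y.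
Proof. by rewrite dotpC dotpZl dotpC. Qed.

Lemma dotp0l x : dotp 0 x = 0.
Proof. by rewrite /dotp /=; ring. Qed.

Lemma dotp_ge0 x : 0 <= dotp x x.
Proof. by rewrite /dotp -!expr2 addr_ge0 ?sqr_ge0. Qed.

Lemma dotp_eq0 x : dotp x x = 0 -> x = 0.
Proof.
case: x => x1 x2; rewrite /dotp /= -!expr2 => /eqP.
by rewrite paddr_eq0 ?sqr_ge0// !sqrf_eq0 => /andP[/eqP-> /eqP->].
Qed.

Lemma enorm_ge0 x : 0 <= enorm x.
Proof. exact: sqrtr_ge0. Qed.

Lemma enorm_sqr x : enorm x ^+ 2 = dotp x x.
Proof. by rewrite sqr_sqrtr ?dotp_ge0. Qed.

Lemma enorm_eq0 x : enorm x = 0 -> x = 0.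
Proof. by move=> h; apply: dotp_eq0; rewrite -enorm_sqr h expr0n. Qed.

Lemma enorm0 : enorm (0 : R * R) = 0.
Proof. by rewrite /enorm dotp0l sqrtr0. Qed.

Lemma enormN x : enorm (- x) = enorm x.
Proof. by rewrite /enorm dotpNl dotpNr opprK. Qed.

Lemma enorm_le x r : 0 <= r -> (enorm x <= r) = (dotp x x <= r ^+ 2).
Proof.
by move=> r0; rewrite -enorm_sqr ler_pXn2r ?nnegrE ?enorm_ge0.
Qed.

Lemma enorm_eq x r : 0 <= r -> (enorm x == r) = (dotp x x == r ^+ 2).
Proof. by move=> r0; rewrite -enorm_sqr eqrXn2 ?enorm_ge0. Qed.

Lemma polar_sqr t : dotp (polar t) (polar t) = 1.
Proof. by rewrite /dotp /= -!expr2 cos2Dsin2. Qed.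

Lemma enorm_polar t : enorm (polar t) = 1.
Proof. by rewrite /enorm polar_sqr sqrtr1. Qed.

Lemma enormZ_polar r t : 0 <= r -> enorm (r *: polar t) = r.
Proof.
move=> r0; apply/eqP; rewrite enorm_eq// dotpZl dotpZr polar_sqr mulr1.
by rewrite expr2.
Qed.

Lemma dotp_polar a b : dotp (polar a) (polar b) = cos (a - b).
Proof. by rewrite cosB. Qed.

Lemma unit_polar u : unit_vector u -> exists t, u = polar t.
Proof.
rewrite /unit_vector => u1.
have e : u.1 ^+ 2 + u.2 ^+ 2 = 1.
  by move: (enorm_sqr u); rewrite u1 expr1n /dotp -!expr2.
have u1b : -1 <= u.1 <= 1.
  rewrite -ler_norml -(@ler_pXn2r _ 2)// ?nnegrE// real_normK ?num_real//.
  by rewrite expr1n -e lerDl sqr_ge0.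
have sE : sin (acos u.1) = `|u.2|.
  by rewrite sin_acos// -sqrtr_sqr; congr Num.sqrt; rewrite -e; ring.
have [u20|u20] := leP 0 u.2.
  exists (acos u.1); rewrite /polar sE ger0_norm// acosK ?in_itv//=.
  exact: surjective_pairing.
exists (- acos u.1); rewrite /polar cosN sinN sE ltr0_norm// opprK.
by rewrite acosK ?in_itv//=; exact: surjective_pairing.
Qed.

Lemma unit_vector_polar t : unit_vector (polar t : R * R).
Proof. exact: enorm_polar. Qed.

Lemma polar_dir x : exists t, x = enorm x *: polar t.
Proof.
have [x0|x0] := eqVneq (enorm x) 0.
  by exists 0; rewrite (enorm_eq0 x0) enorm0 scale0r.
have [t e] : exists t, (enorm x)^-1 *: x = polar t.
  apply: unit_polar; apply/eqP; rewrite enorm_eq//.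
  by rewrite dotpZl dotpZr -enorm_sqr mulrA -expr2 -exprMn mulVf.
by exists t; rewrite -e scalerA mulfV// scale1r.
Qed.

Lemma dotp_le_enorm x t : dotp x (polar t) <= enorm x.
Proof.
have [s ->] := polar_dir x.
rewrite dotpZl dotp_polar enormZ_polar ?enorm_ge0//.
by rewrite ler_piMr ?enorm_ge0// cos_le1.
Qed.

Lemma enorm_leP x r : 0 <= r ->
  (forall t, dotp x (polar t) <= r) -> enorm x <= r.
Proof.
move=> r0; have [s e] := polar_dir x => /(_ s).
by rewrite {1}e dotpZl polar_sqr mulr1.
Qed.

Lemma polarD2pi t : polar (t + 2 * pi) = polar t :> R * R.
Proof. by rewrite /polar mulr_natl cosD2pi sinD2pi. Qed.

Lemma polarDpi t : polar (t + pi) = - polar t :> R * R.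
Proof. by rewrite /polar cosDpi sinDpi. Qed.

Lemma polarpiD a s : polar (a + pi + s) = - polar (a + s) :> R * R.
Proof. by rewrite addrAC polarDpi. Qed.

Lemma polarD a s : polar (a + s) =
  cos s *: polar a + sin s *: polar (a + pi / 2) :> R * R.
Proof.
apply: coord_eq; rewrite !coordE /= ?cosDpihalf ?sinDpihalf.
  by rewrite cosD; ring.
by rewrite sinD; ring.
Qed.

Lemma polar_sum (x y : R) : polar (x - y) + polar (x + y) = (2 * cos y) *: polar x :> R * R.
Proof. by apply: coord_eq; rewrite !coordE /= ?(cosB, cosD, sinB, sinD); ring. Qed.

Lemma polar_basis x a :
  x = dotp x (polar a) *: polar a + dotp x (polar (a + pi / 2)) *: polar (a + pi / 2).
Proof.
have e : 1 = cos a * cos a + sin a * sin a by rewrite -!expr2 cos2Dsin2.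
by apply: coord_eq; rewrite !coordE /dotp /= ?cosDpihalf ?sinDpihalf;
  rewrite -[LHS]mulr1 e; ring.
Qed.

(** Three vectors in the plane are linearly dependent; by Cramer's rule the coefficients are the
    determinants of pairs, here sines of differences. This is the source of the sine convexity of
    support functions. *)
Lemma dotp_polar3 x a b c :
  dotp x (polar b) * sin (c - a) =
  dotp x (polar a) * sin (c - b) + dotp x (polar c) * sin (b - a).
Proof.
rewrite /dotp /polar /= !sinB.
have := cos2Dsin2 a; have := cos2Dsin2 b; have := cos2Dsin2 c.
move: x.1 x.2 (cos a) (sin a) (cos b) (sin b) (cos c) (sin c).
move=> p q ca sa cb sb cc sc hc hb ha.
by ring.
Qed.

End Plane.

(** * Support functions *)

Section Support.
Variable R : realType.
Implicit Types (x y z u v : R * R) (K L : set (R * R)).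

Lemma convex_setP K : convex_set (K : set (convex_lmodType (R * R)%type)) <->
  forall x y (l : R), 0 <= l -> l <= 1 -> K x -> K y -> K (l *: x + (1 - l) *: y).
Proof.
split=> [cK x y l l0 l1 Kx Ky|cK x y l].
  have := cK x y (Itv01 l0 l1); rewrite !inE; exact.
rewrite !inE => Kx Ky; exact: (cK x y l%:num).
Qed.

Lemma continuous_dotp u : continuous (fun x => dotp x u).
Proof.
move=> x; apply: cvgD; apply: cvgM; try exact: cvg_cst.
- exact: cvg_fst.
- exact: cvg_snd.
Qed.

Lemma supp_attained K u : compact K -> K !=set0 ->
  exists2 x, K x & dotp x u = support_function K u /\
    forall y, K y -> dotp y u <= dotp x u.
Proof.
move=> cK K0.
have cd : {within K, continuous (fun x => dotp x u)}.
  by apply: continuous_subspaceT; exact: continuous_dotp.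
have [x] := compact_EVT_max K0 cK cd.
rewrite inE => Kx xmax; exists x => //; split; last by move=> y Ky; apply: xmax; rewrite inE.
apply/esym/eqP; rewrite eq_le; apply/andP; split.
  apply: ge_sup; first by exists (dotp x u); exists x.
  by move=> _ [y Ky <-]; apply: xmax; rewrite inE.
apply: ub_le_sup; last by exists x.
by exists (dotp x u) => _ [y Ky <-]; apply: xmax; rewrite inE.
Qed.

Lemma supp_le K u x : compact K -> K x -> dotp x u <= support_function K u.
Proof.
move=> cK Kx; have [y Ky [<-]] := supp_attained u cK (ex_intro _ x Kx).
exact.
Qed.

Lemma supp_eq K u x : compact K -> K x ->
  (forall y, K y -> dotp y u <= dotp x u) -> support_function K u = dotp x u.
Proof.
move=> cK Kx xmax; apply/eqP; rewrite eq_le supp_le// andbT.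
have [y Ky [<- _]] := supp_attained u cK (ex_intro _ x Kx).
exact: xmax.
Qed.

Lemma supp_mono K L u : compact K -> compact L -> K !=set0 -> K `<=` L ->
  support_function K u <= support_function L u.
Proof.
move=> cK cL K0 KL; have [y Ky [<- _]] := supp_attained u cK K0.
by apply: supp_le => //; exact: KL.
Qed.

(** If [x] is not in [K], the direction from its nearest point [y] in [K] towards [x] separates: a
    point [z] of [K] beyond [y] in that direction would let a small move from [y] towards [z]
    decrease the distance. *)
Lemma supp_separation K x : compact K -> convex_set (K : set (convex_lmodType (R * R)%type)) ->
  K !=set0 -> (forall t, dotp x (polar t) <= support_function K (polar t)) -> K x.
Proof.
move=> cK /convex_setP cvK K0 xK.
pose f y := dotp (y - x) (y - x).
have cf : {within K, continuous f}.
  apply: continuous_subspaceT => y; apply: cvgD; apply: cvgM;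
    (apply: cvgB; [first [exact: cvg_fst | exact: cvg_snd] | exact: cvg_cst]).
have [y] := compact_EVT_min K0 cK cf; rewrite inE => Ky ymin.
have [->//|xy] := pselect (x = y).
have [t vE] := polar_dir (x - y).
have v0 : 0 < enorm (x - y).
  rewrite lt_neqAle enorm_ge0 andbT eq_sym; apply/eqP => /enorm_eq0 /eqP.
  by rewrite subr_eq0 => /eqP.
have [z Kz [hz _]] := supp_attained (polar t) cK K0.
have := xK t; rewrite -hz -(ler_pM2l v0) -!dotpZr -vE.
set v := x - y; set p := dotp (z - y) v; set q := dotp (z - y) (z - y).
have vv : 0 < dotp v v by rewrite -enorm_sqr exprn_gt0.
have q0 : 0 <= q by exact: dotp_ge0.
have p0 : p <= 0.
  rewrite leNgt; apply/negP => p0.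
  have pq : 0 < p + q by lra.
  (* The minimum over the line is at [p / q]; enlarging the denominator keeps [l] in the unit
     interval and still gives [l * q < 2 * p], a strict decrease. *)
  set l := p / (p + q).
  have l0 : 0 <= l by rewrite divr_ge0// ltW.
  have l1 : l <= 1 by rewrite ler_pdivrMr// mul1r; lra.
  have := ymin (l *: z + (1 - l) *: y); rewrite inE => /(_ (cvK _ _ _ l0 l1 Kz Ky)).
  have -> : f (l *: z + (1 - l) *: y) = f y - 2 * l * p + l ^+ 2 * q.
    by rewrite /f /p /q /v /dotp !coordE; ring.
  have lp : 0 < l by rewrite divr_gt0.
  have -> : f y - 2 * l * p + l ^+ 2 * q = f y + l * (l * q - 2 * p) by ring.
  rewrite lerDl pmulr_rge0// => h.
  have : l * (p + q) = p by rewrite divfK// gt_eqF.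
  have : 0 < l * p by rewrite mulr_gt0.
  lra.
have -> : dotp z v = dotp x v - dotp v v + p.
  by rewrite /p /v /dotp !coordE; ring.
lra.
Qed.

Lemma supp_inj K L : compact K -> convex_set (K : set (convex_lmodType (R * R)%type)) ->
  K !=set0 -> compact L -> convex_set (L : set (convex_lmodType (R * R)%type)) ->
  L !=set0 ->
  (forall t, support_function K (polar t) = support_function L (polar t)) -> K = L.
Proof.
move=> cK vK K0 cL vL L0 h; apply/seteqP; split => x Hx.
  by apply: supp_separation => // t; rewrite -h; exact: supp_le.
by apply: supp_separation => // t; rewrite h; exact: supp_le.
Qed.

Lemma supp_sine_convex K a b c : compact K -> K !=set0 ->
  0 <= sin (c - b) -> 0 <= sin (b - a) -> 0 <= sin (c - a) ->
  support_function K (polar b) * sin (c - a) <=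
  support_function K (polar a) * sin (c - b) + support_function K (polar c) * sin (b - a).
Proof.
move=> cK K0 h1 h2 h3.
have [x Kx [<- _]] := supp_attained (polar b) cK K0.
rewrite dotp_polar3; apply: lerD; apply: ler_wpM2r => //; exact: supp_le.
Qed.

Lemma enorm_le_abs x : enorm x <= `|x.1| + `|x.2|.
Proof.
rewrite enorm_le ?addr_ge0// /dotp sqrrD -!expr2 !real_normK ?num_real//.
rewrite lerD2r lerDl mulrn_wge0// mulr_ge0//.
Qed.

Lemma compact_enorm_bounded K : compact K ->
  exists2 M, 0 < M & forall x, K x -> enorm x <= M.
Proof.
move=> cK; have /ex_strict_bound_gt0[k k0 /= hk] := compact_bounded cK.
exists (k + k); first by rewrite addr_gt0.
move=> x Kx; apply: (le_trans (enorm_le_abs x)).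
have /ltW := hk _ Kx; rewrite prod_normE /= ge_max => /andP[h1 h2].
exact: lerD.
Qed.

Lemma dotp_le_mul x u : dotp x u <= enorm x * enorm u.
Proof.
have [t ut] := polar_dir u.
by rewrite {1}ut dotpZr mulrC ler_wpM2r ?enorm_ge0// dotp_le_enorm.
Qed.

(** A point attaining the value at [s] competes at [t], so the two values differ by at most a bound
    [M] of [K] times the distance of the directions. *)
Lemma supp_continuous K : compact K -> K !=set0 ->
  continuous (fun t => support_function K (polar t)).
Proof.
move=> cK K0.
have [M M0 hM] := compact_enorm_bounded cK.
pose e s t : R := M * (`|cos s - cos t| + `|sin s - sin t|).
have lip s t : support_function K (polar s) - support_function K (polar t) <= e s t.
  have [x Kx [<- _]] := supp_attained (polar s) cK K0.
  have h := supp_le (polar t) cK Kx.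
  apply: (@le_trans _ _ (dotp x (polar s - polar t))); first by rewrite dotpBr; lra.
 apply: (le_trans (dotp_le_mul _ _)).
  by apply: ler_pM; rewrite ?enorm_ge0//; [exact: hM|exact: enorm_le_abs].
move=> t; apply/cvgrPdist_le => eps eps0 /=.
have ce : e s t @[s --> t] --> 0.
  rewrite [X in _ --> X](_ : _ = M * (`|cos t - cos t| + `|sin t - sin t|)); last first.
    by rewrite !subrr normr0 addr0 mulr0.
  apply: cvgM; first exact: cvg_cst.
  by apply: cvgD; apply: cvg_norm; apply: cvgB; try exact: cvg_cst;
    [exact: continuous_cos|exact: continuous_sin].
move/cvgrPdist_le : ce => /(_ _ eps0); apply: filterS => s.
rewrite sub0r normrN ger0_norm; last first.
  by rewrite mulr_ge0// ?ltW// addr_ge0.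
move=> h; rewrite ler_norml; apply/andP; split.
  by rewrite lerNl opprB (le_trans (lip s t)).
apply: (le_trans (lip t s)).
by rewrite /e (distrC (cos t)) (distrC (sin t)).
Qed.

End Support.

(** * Area under shears and rotations, area of triangles *)

Section Area.
Variable R : realType.
Local Notation leb := (@lebesgue_measure R).
Local Notation plane := (measurableTypeR R * measurableTypeR R)%type.
Implicit Types (A B : set plane).

(** The pushforward under the shift agrees with Lebesgue measure on half-open intervals, which
    determine it. *)
Lemma lebesgue_measure_shift (A : set (measurableTypeR R)) (c : R) : measurable A ->
  leb [set y | A (y + c)] = leb A.
Proof.
move=> mA.
have mf : measurable_fun [set: measurableTypeR R]
    ((fun y : R => y + c) : measurableTypeR R -> measurableTypeR R).
  by apply: measurable_funD.
pose mu : {measure set (measurableTypeR R) -> \bar R} :=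
  [the measure _ _ of pushforward leb
    ((fun y : R => y + c) : measurableTypeR R -> measurableTypeR R)].
suff /(_ A mA) -> : forall X, measurable X -> leb X = mu mf X by [].
apply: lebesgue_measure_unique => X [[a b] _ <-] /=.
rewrite /mu /= /pushforward.
have -> : (fun y : R => y + c) @^-1` `]a, b]%classic = `]a - c, b - c]%classic.
  by apply/seteqP; split => y /=; rewrite !in_itv /= ltrBlDr lerBrDr.
rewrite !lebesgue_measure_itv /= !lte_fin ltrD2r.
by case: ifP => // _; rewrite -!EFinB; congr EFin; ring.
Qed.

Lemma measurable_affine (a b c : R) :
  measurable_fun [set: plane] (fun x : plane => a * x.1 + b * x.2 + c : R).
Proof.
by apply: measurable_funD => //; apply: measurable_funD; apply: measurable_funM.
Qed.

Lemma measurable_halfplane (v : R * R) (r : R) :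
  measurable ([set x : R * R | dotp x v <= r] : set plane).
Proof.
rewrite -[X in measurable X]setTI.
rewrite (_ : [set _ | _] = (fun x : plane => v.1 * x.1 + v.2 * x.2 + 0) @^-1` `]-oo, r]%classic).
  by apply: measurable_affine.
by apply/seteqP; split => x /=; rewrite in_itv /= addr0 /dotp mulrC [x.2 * _]mulrC.
Qed.

Lemma measurable_open_halfplane (v : R * R) (r : R) :
  measurable ([set x : R * R | dotp x v < r] : set plane).
Proof.
rewrite -[X in measurable X]setTI.
rewrite (_ : [set _ | _] = (fun x : plane => v.1 * x.1 + v.2 * x.2 + 0) @^-1` `]-oo, r[%classic).
  by apply: measurable_affine.
by apply/seteqP; split => x /=; rewrite in_itv /= addr0 /dotp mulrC [x.2 * _]mulrC.
Qed.

Lemma measurable_affine_preimage A (a b e c d f : R) : measurable A ->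
  measurable [set x : plane | A (a * x.1 + b * x.2 + e, c * x.1 + d * x.2 + f)].
Proof.
move=> mA; rewrite -[X in measurable X]setTI.
have mf : measurable_fun [set: plane] (fun x : plane =>
    (a * x.1 + b * x.2 + e, c * x.1 + d * x.2 + f) : plane).
  by apply: measurable_fun_pair; exact: measurable_affine.
exact: mf.
Qed.

(** By Fubini: the shear translates every vertical section. *)
Lemma area_shear2 A (a b : R) : measurable A ->
  area [set x : R * R | A (x.1, x.2 + (a * x.1 + b))] = area A.
Proof.
move=> mA; rewrite /area /product_measure1.
apply: eq_integral => x _ /=.
rewrite -(lebesgue_measure_shift (a * x + b) (measurable_xsection x mA)).
by congr (lebesgue_measure _); apply/seteqP; split => y; rewrite /xsection /= !inE.
Qed.

Lemma area_swap A : measurable A -> area [set x : R * R | A (x.2, x.1)] = area A.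
Proof.
move=> mA.
have -> : area A = (leb \x^ leb)%E A.
  by apply: product_measure_unique => // B C mB mC /=; rewrite product_measure2E.
rewrite /area /product_measure1 /product_measure2.
apply: eq_integral => x _ /=.
by congr (lebesgue_measure _); apply/seteqP; split => y; rewrite /xsection /ysection /= !inE.
Qed.

Lemma area_shear1 A (a b : R) : measurable A ->
  area [set x : R * R | A (x.1 + (a * x.2 + b), x.2)] = area A.
Proof.
move=> mA; rewrite -[RHS](area_swap mA).
have mA' : measurable ([set x | A (x.2, x.1)] : set plane).
  have := measurable_affine_preimage 0 1 0 1 0 0 mA.
  by congr measurable; apply/seteqP; split => x /=; rewrite !mul0r !mul1r !addr0 !add0r.
rewrite -[RHS](area_shear2 a b mA').
have mA2 : measurable ([set x : R * R | A (x.2 + (a * x.1 + b), x.1)] : set plane).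
  have := measurable_affine_preimage a 1 b 1 0 0 mA.
  by congr measurable; apply/seteqP; split => x /=;
    rewrite mul0r !mul1r !addr0 [_ + x.2]addrC addrA.
by rewrite -[RHS](area_swap mA2).
Qed.

Lemma area_translate A (c : R * R) : measurable A ->
  area [set x : R * R | A (x + c)] = area A.
Proof.
move=> mA; rewrite -(area_shear2 0 c.2 mA).
have mA2 : measurable ([set x : R * R | A (x.1, x.2 + (0 * x.1 + c.2))] : set plane).
  have := measurable_affine_preimage 1 0 0 0 1 c.2 mA.
  by congr measurable; apply/seteqP; split => x /=;
    rewrite !mul0r !mul1r !addr0 !add0r.
rewrite -[RHS](area_shear1 0 c.1 mA2); congr area.
by apply/seteqP; split => x /=; rewrite !mul0r !add0r.
Qed.

Lemma area_rotation A (t : R) : measurable A ->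
  area [set x : R * R | A (rotation t x)] = area A.
Proof.
(* A rotation by [s] is a product of three shears, with shear factors
   [- tan (s / 2)], [sin s], [- tan (s / 2)], unless [cos s = -1]. *)
have key s : 1 + cos s != 0 -> forall A, measurable A ->
    area [set x : R * R | A (rotation s x)] = area A /\
    measurable ([set x : R * R | A (rotation s x)] : set plane).
  move=> c1 {}A mA; set k := - (sin s / (1 + cos s)).
  have e1 : 1 + sin s * k = cos s.
    have := cos2Dsin2 s; rewrite /k => h.
    suff : sin s ^+ 2 / (1 + cos s) = 1 - cos s by rewrite expr2; lra.
    by apply: (mulIf c1); rewrite divfK//; lra.
  have e2 : k * (1 + cos s) = - sin s by rewrite /k mulNr divfK.
  have m1 : measurable ([set x : R * R | A (x.1 + (k * x.2 + 0), x.2)] : set plane).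
    have := measurable_affine_preimage 1 k 0 0 1 0 mA.
    by congr measurable; apply/seteqP; split => x /=;
      rewrite !mul0r !mul1r !addr0 !add0r.
  have m2 : measurable ([set x : R * R | A (x.1 + (k * (x.2 + (sin s * x.1 + 0)) + 0), x.2 + (sin s * x.1 + 0))] : set plane).
    have := measurable_affine_preimage 1 0 0 (sin s) 1 0 m1.
    by congr measurable; apply/seteqP; split => x /=;
      rewrite !mul0r !mul1r !addr0 [_ + x.2]addrC.
  split; last first.
    have := measurable_affine_preimage (cos s) (- sin s) 0 (sin s) (cos s) 0 mA.
    by congr measurable; apply/seteqP; split => x /=; rewrite /rotation /= !addr0 mulNr.
  rewrite -(area_shear1 k 0 mA) -(area_shear2 (sin s) 0 m1) -(area_shear1 k 0 m2) /=.
  congr area; apply/seteqP; split => x /=; rewrite /rotation /= !addr0;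
  congr (A (_, _)).
  - rewrite (_ : x.1 + k * x.2 + k * (x.2 + sin s * (x.1 + k * x.2)) = (1 + sin s * k) * x.1 + (k * (1 + (1 + sin s * k))) * x.2).
      by rewrite e1 e2; ring.
    by ring.
  - rewrite (_ : x.2 + sin s * (x.1 + k * x.2) = sin s * x.1 + (1 + sin s * k) * x.2).
      by rewrite e1.
    by ring.
  - rewrite (_ : x.1 + k * x.2 + k * (x.2 + sin s * (x.1 + k * x.2)) = (1 + sin s * k) * x.1 + (k * (1 + (1 + sin s * k))) * x.2).
      by rewrite e1 e2; ring.
    by ring.
  - rewrite (_ : x.2 + sin s * (x.1 + k * x.2) = sin s * x.1 + (1 + sin s * k) * x.2).
      by rewrite e1.
    by ring.
move=> mA.
have [c1|c1] := eqVneq (1 + cos t) 0; last by case: (key t c1 A mA).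
(* The excluded half turn is done in two steps of [t / 2], whose cosine is zero. *)
have c2 : 1 + cos (t / 2) != 0.
  have := cos_mulr2n (t / 2); rewrite (_ : t / 2 *+ 2 = t); last by rewrite -mulr_natr divfK.
  move=> h.
  apply/eqP => h2; have h3 : cos (t / 2) = - 1 by lra.
  by move: h; rewrite h3 sqrrN expr1n; lra.
have [h1 m1] := key _ c2 A mA.
have [h2 _] := key _ c2 _ m1.
have rotE x : rotation t x = rotation (t / 2) (rotation (t / 2) x) :> R * R.
  have tE : t = t / 2 + t / 2 by lra.
  by rewrite {1}tE /rotation cosD sinD /=; congr pair; ring.
rewrite -h1 -h2; congr area.
by apply/seteqP; split => x /=; rewrite rotE.
Qed.

(** The cells below contain only part of their boundary, so the set is only sandwiched between two
    versions of the triangle. Either way the section at [x] has length [(M - m) * x]. *)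
Lemma area_triangle A (h m M : R) : 0 < h -> m <= M -> measurable A ->
  [set x : R * R | [/\ 0 < x.1, x.1 <= h, m * x.1 < x.2 & x.2 < M * x.1]] `<=` A ->
  A `<=` [set x : R * R | [/\ 0 <= x.1, x.1 <= h, m * x.1 <= x.2 & x.2 <= M * x.1]] ->
  area A = (h ^+ 2 * (M - m) / 2)%:E.
Proof.
move=> h0 mM mA OA AC; rewrite /area /product_measure1.
have sE (x : measurableTypeR R) : leb (xsection A x) =
    ((fun x => ((M - m) * x)%:E) \_ `[0, h]) x.
  rewrite patchE; case: ifPn; last first.
    move=> /negP hx; rewrite (_ : xsection A x = set0) ?measure0//.
    apply/seteqP; split => y //=; rewrite /xsection /= inE => /AC /= [? ? _ _].
    by apply: hx; rewrite inE /= in_itv /=; apply/andP.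
  rewrite inE /= in_itv /= => /andP[x0 xh].
  have mm : m * x <= M * x by exact: ler_wpM2r.
  have mx : measurable (xsection A x) by exact: measurable_xsection.
  have up : (leb (xsection A x) <= ((M - m) * x)%:E)%E.
    apply: (@le_trans _ _ (leb `[m * x, M * x]%classic)).
      apply: le_measure; rewrite ?inE//.
      by move=> y; rewrite /xsection /= inE => /AC /= [_ _ ? ?]; rewrite in_itv /=; apply/andP.
    rewrite lebesgue_measure_itv /=; case: ifP => _.
      by rewrite -EFinB lee_fin mulrBl.
    by rewrite lee_fin mulr_ge0// subr_ge0.
  apply/eqP; rewrite eq_le up andTb.
  have [x00|x1] := eqVneq x 0; first by rewrite x00 mulr0.
  apply: (@le_trans _ _ (leb `]m * x, M * x[%classic)).
    rewrite lebesgue_measure_itv /= lte_fin; case: ltP => [_|h1].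
      by rewrite -EFinB lee_fin mulrBl.
    by rewrite lee_fin mulrBl subr_le0.
  apply: le_measure; rewrite ?inE//.
  move=> y; rewrite /xsection /= inE in_itv /= => /andP[? ?].
  by apply: OA => /=; rewrite lt_neqAle eq_sym x1 x0.
under eq_integral do rewrite /= sE.
rewrite -integral_mkcond.
rewrite (@continuous_FTC2 _ _ (fun x => (M - m) / 2 * x ^+ 2))//.
- by rewrite -EFinB; congr EFin; lra.
- apply: continuous_subspaceT => x; apply: cvgM; [exact: cvg_cst|exact: cvg_id].
- split.
  + by move=> x _; apply: derivableM => //; exact: derivableX.
  + by apply: cvg_at_right_filter; apply: cvgM; [exact: cvg_cst|exact: exprn_continuous].
  + by apply: cvg_at_left_filter; apply: cvgM; [exact: cvg_cst|exact: exprn_continuous].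
- move=> x _; rewrite derive1E deriveM// derive_cst exp_derive /= !scaler0 addr0 expr1.
  by rewrite /GRing.scale /=; lra.
Qed.

End Area.

(** * Area of circumscribed polygons *)

Section PolygonArea.
Variable R : realType.
Local Notation leb := (@lebesgue_measure R).
Local Notation plane := (measurableTypeR R * measurableTypeR R)%type.

(** The derivative-free form of [h + h'' >= 0], which characterizes support functions in the plane.
    The sign conditions say that [a], [b], [c] follow each other within a half turn, up to full
    turns. *)
Definition sine_convex (h : R -> R) := forall a b c,
  0 <= sin (c - b) -> 0 <= sin (b - a) -> 0 <= sin (c - a) ->
  h b * sin (c - a) <= h a * sin (c - b) + h c * sin (b - a).

Lemma sine_convex_shift (h : R -> R) t :
  sine_convex h -> sine_convex (fun s => h (t + s)).
Proof.
move=> hc a b c; have E u v : u - v = (t + u) - (t + v) by ring.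
by rewrite (E c b) (E b a) (E c a); exact: hc.
Qed.

Lemma sine_convex_opp (h : R -> R) : sine_convex h -> sine_convex (fun s => h (- s)).
Proof.
move=> hc a b c h1 h2 h3; rewrite [leRHS]addrC.
have := hc (- c) (- b) (- a); rewrite !opprK.
by rewrite [- a + b]addrC [- b + c]addrC [- a + c]addrC; apply.
Qed.

(** The function [F s = x.1 * h s - h 0 * dotp x (polar s)] is sine convex, because its second term
    satisfies the inequality with equality. From [F 0 = 0] follows [F d * sin s <= F s * sin d], so
    positivity passes from [d] to [s]. At [s = pi] the sine vanishes and the claim is read off
    directly. *)
Lemma sector_strict (h : R -> R) (d s : R) (x : R * R) :
  sine_convex h -> (forall t, 0 < h t) -> 0 < d < pi -> d <= s <= pi -> 0 < x.1 ->
  dotp x (polar d) * h 0 < x.1 * h d -> dotp x (polar s) * h 0 < x.1 * h s.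
Proof.
move=> hc h0 /andP[d0 dpi] /andP[ds]; rewrite le_eqVlt => /orP[/eqP->|spi] x0 xd.
  rewrite /dotp /polar /= cospi sinpi mulr0 addr0 mulrN1 mulNr.
  have := mulr_gt0 x0 (h0 0); have := mulr_gt0 x0 (h0 pi); lra.
have sd : 0 < sin d by rewrite sin_gt0_pi// d0.
have ss : 0 < sin s by rewrite sin_gt0_pi//; lra.
have ssd : 0 <= sin (s - d) by rewrite sin_ge0_pi//; lra.
have := hc 0 d s; rewrite !subr0 => /(_ ssd (ltW sd) (ltW ss)) hds.
have := dotp_polar3 x 0 d s; rewrite !subr0.
rewrite [X in _ = X * _ + _](_ : _ = x.1); last by rewrite /dotp /polar /= cos0 sin0; lra.
move=> xds.
rewrite -(ltr_pM2r sd).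
have e1 : dotp x (polar s) * h 0 * sin d =
    dotp x (polar d) * h 0 * sin s - x.1 * h 0 * sin (s - d).
  have -> : dotp x (polar s) * h 0 * sin d = h 0 * (dotp x (polar s) * sin d) by ring.
  have -> : dotp x (polar s) * sin d = dotp x (polar d) * sin s - x.1 * sin (s - d) by rewrite xds; ring.
  by ring.
rewrite e1.
have e2 : x.1 * (h d * sin s) <= x.1 * (h 0 * sin (s - d) + h s * sin d).
  by rewrite ler_pM2l.
have e3 : dotp x (polar d) * h 0 * sin s < x.1 * h d * sin s by rewrite ltr_pM2r.
move: e2 e3; rewrite mulrDr !mulrA; lra.
Qed.

Variables (p : nat) (h : R -> R) (th0 : R).
Hypotheses (p_ge2 : (2 <= p)%N) (h_gt0 : forall t, 0 < h t)
  (h_per : forall t, h (t + 2 * pi) = h t) (h_conv : sine_convex h).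

(** The polygons have [2 p] normals, so that every normal occurs together with its opposite. *)
Definition regular_step (p : nat) : R := pi / p%:R.
Local Notation d := (regular_step p).
Definition polygon_node (p : nat) (t : R) (j : nat) : R := t + j%:R * regular_step p.
Local Notation th := (polygon_node p th0).
Local Notation N := (p.*2).

Definition circumscribed_polygon (p : nat) (h : R -> R) (t : R) : set (R * R) :=
  [set x | forall j : nat,
    dotp x (polar (polygon_node p t j)) <= h (polygon_node p t j)].

(** Obtained by intersecting the supporting line with normal [t] with its two neighbors; the
    discrete counterpart of [h + h'']. *)
Definition side_length (p : nat) (h : R -> R) (t : R) : R :=
  (h (t + regular_step p) + h (t - regular_step p)
   - 2 * cos (regular_step p) * h t) / sin (regular_step p).

Let p0 : 0 < p%:R :> R. Proof. by rewrite ltr0n (leq_trans _ p_ge2). Qed.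

Lemma regular_stepM : p%:R * d = pi.
Proof. by rewrite /regular_step mulrC divfK// gt_eqF. Qed.

Lemma regular_step_gt0 : 0 < d.
Proof. by rewrite divr_gt0// pi_gt0. Qed.

Lemma regular_step_le : d <= pi / 2.
Proof. by rewrite ler_pM2l ?pi_gt0// lef_pV2 ?posrE// (ler_nat _ 2). Qed.

Lemma sin_regular_step : 0 < sin d.
Proof.
rewrite sin_gt0_pi// regular_step_gt0/=.
by apply: (le_lt_trans regular_step_le); have := pi_gt0 R; lra.
Qed.

Lemma side_length_ge0 t : 0 <= side_length p h t.
Proof.
rewrite /side_length divr_ge0 ?(ltW sin_regular_step)//.
have sd := sin_regular_step; have d0 := regular_step_gt0; have d1 := regular_step_le.
have := @h_conv (t - d) t (t + d).
rewrite (_ : t + d - t = d); last by ring.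
rewrite (_ : t - (t - d) = d); last by ring.
rewrite (_ : t + d - (t - d) = d + d); last by ring.
have -> : sin (d + d) = 2 * cos d * sin d by rewrite sinD; ring.
have cd : 0 <= cos d by rewrite cos_ge0_pihalf//; apply/andP; split=> //; lra.
move=> /(_ (ltW sd) (ltW sd)) /(_ (mulr_ge0 (mulr_ge0 _ cd) (ltW sd))).
rewrite ler0n => /(_ isT).
by rewrite mulrA -mulrDl ler_pM2r// => h1; lra.
Qed.

(** The polygon is where all these ratios are at most one, and the ray from the origin through [x]
    leaves it through the side with the largest ratio. *)
Let phi j (x : R * R) := dotp x (polar (th j)) / h (th j).

Let h_perM t (k : nat) : h (t + k%:R * (2 * pi)) = h t.
Proof.
elim: k => [|k IH]; first by rewrite mul0r addr0.
by rewrite -[RHS]IH -[RHS]h_per; congr h; rewrite -natr1; ring.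
Qed.

Let polar_perM t (k : nat) : polar (t + k%:R * (2 * pi)) = polar t :> R * R.
Proof.
elim: k => [|k IH]; first by rewrite mul0r addr0.
by rewrite -[RHS]IH -[RHS]polarD2pi; congr polar; rewrite -natr1; ring.
Qed.

Let th_mod m : th m = th (m %% N) + (m %/ N)%:R * (2 * pi).
Proof.
rewrite /polygon_node {1}(divn_eq m N) natrD natrM -mul2n natrM -[in RHS]regular_stepM.
by ring.
Qed.

Let phi_mod m x : phi m x = phi (m %% N) x.
Proof. by rewrite /phi th_mod h_perM polar_perM. Qed.

(* The cell of [j] is, up to a null set, the triangle spanned by the origin and
   the [j]-th side; taking the first index maximizing [phi] makes the cells an
   exact partition of the polygon. *)
Let cell j := [set x : R * R | phi j x <= 1 /\ forall i, (i < N)%N ->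
  ((i < j)%N -> phi i x < phi j x) /\ phi i x <= phi j x].

Let N0 : (0 < N)%N. Proof. by rewrite double_gt0 (leq_trans _ p_ge2). Qed.

Let cell_le j m x : cell j x -> phi m x <= phi j x.
Proof. by move=> [_ hc]; rewrite phi_mod; apply: (hc _ _).2; rewrite ltn_mod. Qed.

Let poly_cells : circumscribed_polygon p h th0 = \bigcup_(j in `I_N) cell j.
Proof.
apply/seteqP; split => x; last first.
  move=> [j /= jN cj] m.
  have := le_trans (cell_le m cj) cj.1.
  by rewrite /phi ler_pdivrMr ?mul1r.
move=> xP.
pose P (j : nat) := (j < N)%N && [forall i : 'I_N, phi i x <= phi j x].
have exP : exists j, P j.
  have [i _ imax] := @Order.TotalTheory.arg_maxP _ _ _ (Ordinal N0) xpredT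
    (fun i : 'I_N => phi i x) isT.
  by exists i; rewrite /P ltn_ord /=; apply/forallP => k; exact: imax.
case: (ex_minnP exP) => j /andP[jN /forallP jmax] jmin.
exists j => //; split.
  by rewrite /phi ler_pdivrMr// mul1r.
move=> i iN; split; last exact: (jmax (Ordinal iN)).
move=> ij; rewrite ltNge; apply/negP => ji.
suff /jmin : P i by rewrite leqNgt ij.
rewrite /P iN /=; apply/forallP => k; exact: (le_trans (jmax k)).
Qed.

Let mphi_le i j : measurable ([set x : R * R | phi i x <= phi j x] : set plane).
Proof.
have := @measurable_halfplane R ((h (th i))^-1 *: polar (th i) - (h (th j))^-1 *: polar (th j)) 0.
congr measurable; apply/seteqP; split => x /=; rewrite dotpBr !dotpZr /phi;
  by rewrite subr_le0 [_^-1 * _]mulrC [X in _ <= X]mulrC.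
Qed.

Let mphi_lt i j : measurable ([set x : R * R | phi i x < phi j x] : set plane).
Proof.
have := @measurable_open_halfplane R ((h (th i))^-1 *: polar (th i) - (h (th j))^-1 *: polar (th j)) 0.
congr measurable; apply/seteqP; split => x /=; rewrite dotpBr !dotpZr /phi;
  by rewrite subr_lt0 [_^-1 * _]mulrC [X in _ < X]mulrC.
Qed.

Lemma measurable_circumscribed_polygon :
  measurable (circumscribed_polygon p h th0 : set plane).
Proof.
rewrite (_ : circumscribed_polygon _ _ _ = \bigcap_j [set x : R * R | dotp x (polar (th j)) <= h (th j)]).
  by apply: bigcapT_measurable => j; exact: measurable_halfplane.
by apply/seteqP; split => x xP j; [move=> _; exact: xP|exact: (xP j I)].
Qed.

Let mcell j : measurable (cell j : set plane).
Proof.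
rewrite (_ : cell j = [set x : R * R | dotp x (polar (th j)) <= h (th j)] `&`
  \bigcap_i [set x : R * R | (i < N)%N ->
    ((i < j)%N -> phi i x < phi j x) /\ phi i x <= phi j x]); last first.
  apply/seteqP; split => x /= [hx hc]; split.
  - by move: hx; rewrite /phi ler_pdivrMr// mul1r.
  - by move=> i _; exact: hc.
  - by rewrite /phi ler_pdivrMr// mul1r.
  - by move=> i; exact: hc.
apply: measurableI; first exact: measurable_halfplane.
apply: bigcapT_measurable => i.
have [iN|iN] := boolP (i < N)%N; last first.
  by rewrite (_ : [set _ | _] = setT)//; apply/seteqP; split.
have [ij|ij] := boolP (i < j)%N.
  rewrite (_ : [set _ | _] = [set x : R * R | phi i x < phi j x] `&`
    [set x : R * R | phi i x <= phi j x]); first exact: measurableI (mphi_lt i j) (mphi_le i j).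
  by apply/seteqP; split => x /= H; [case: (H isT) => H1 H2; split=> //; exact: H1|by move: H => [? ?] _; split].
rewrite (_ : [set _ | _] = [set x : R * R | phi i x <= phi j x]); first exact: mphi_le.
by apply/seteqP; split => x /= H; [exact: (H isT).2|split].
Qed.

Let tcell : trivIset `I_N cell.
Proof.
apply/trivIsetP => i j /= iN jN ij; apply/seteqP; split => x //= [ci cj].
wlog lij : i j iN jN ij ci cj / (i < j)%N.
  move=> H; have [|ji|ijE] := ltngtP i j; first exact: H.
    by apply: (H j i) => //; rewrite eq_sym.
  by rewrite ijE eqxx in ij.
have := (cj.2 _ iN).1 lij; have := cell_le j ci.
by move=> h1 h2; have := le_lt_trans h1 h2; rewrite ltxx.
Qed.

Lemma dotp_rotation (x : R * R) (t s : R) : dotp (rotation t x) (polar (t + s)) = dotp x (polar s).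
Proof.
rewrite /dotp /rotation /polar /= cosD sinD.
have e : cos t ^+ 2 + sin t ^+ 2 = 1 by exact: cos2Dsin2.
transitivity ((cos t ^+ 2 + sin t ^+ 2) * (x.1 * cos s + x.2 * sin s)); first by ring.
by rewrite e mul1r.
Qed.

(** A side whose ratio beats those of its two neighbors beats all others: [sector_strict] carries
    the comparison from each neighbor to the opposite direction. *)
Let sector_all t s (x : R * R) : d <= `|s| <= 2 * pi - d -> 0 < x.1 ->
  dotp x (polar d) * h t < x.1 * h (t + d) ->
  dotp x (polar (- d)) * h t < x.1 * h (t - d) ->
  dotp x (polar s) * h t < x.1 * h (t + s).
Proof.
move=> sB x0 xd1 xd2.
have dB : 0 < d < pi.
  rewrite regular_step_gt0 (le_lt_trans regular_step_le)//.
  by have := pi_gt0 R; lra.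
have pos u : d <= u <= pi -> dotp x (polar u) * h t < x.1 * h (t + u).
  move=> uB; have := @sector_strict (fun v => h (t + v)) d u x.
  by rewrite addr0; apply => //; exact: sine_convex_shift.
have neg u : d <= u <= pi -> dotp x (polar (- u)) * h t < x.1 * h (t - u).
  (* Negative angles follow by reflecting both [h] and [x] in the first axis. *)
  move=> uB; have := @sector_strict (fun v => h (t - v)) d u (x.1, - x.2).
  have E v : dotp (x.1, - x.2) (polar v) = dotp x (polar (- v)).
    by rewrite /dotp /polar /= cosN sinN; ring.
  rewrite !E subr0; apply => //.
  exact: (sine_convex_opp (sine_convex_shift t h_conv)).
have [s0|s0] := leP 0 s.
  rewrite ger0_norm// in sB.
  have [sp|sp] := leP s pi; first by apply: pos; move/andP: sB => [-> _].
  have := neg (2 * pi - s); rewrite opprB -(polarD2pi (s - _)) subrK.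
  rewrite -(h_per (t + (s - _))) -addrA subrK; apply; lra.
rewrite ltr0_norm// in sB.
have [sp|sp] := leP (- s) pi; first by have := neg (- s); rewrite !opprK; apply; lra.
have := pos (s + 2 * pi); rewrite polarD2pi addrA h_per; apply; lra.
Qed.

(** After a rotation the normal of the side is the first axis, and the cell is a triangle with apex
    at the origin and height [H]. *)
Let cell_area j : (j < N)%N ->
  area (cell j) = (h (th j) * side_length p h (th j) / 2)%:E.
Proof.
move=> jN; set t := th j; set H := h t.
have H0 : 0 < H := h_gt0 t.
have Hn : H != 0 by rewrite gt_eqF.
have sd := sin_regular_step; have sn : sin d != 0 by rewrite gt_eqF.
have dd := regular_step_gt0.
rewrite -(area_rotation t (mcell j)).
(* The slopes [m] and [M] of the two lateral edges, where the ratio of the side equals that of a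
   neighbor. *)
pose m := (cos d - h (t - d) / H) / sin d.
pose M := (h (t + d) / H - cos d) / sin d.
have Mm : M - m = side_length p h t / H.
  by rewrite /M /m /side_length -/H; field; rewrite Hn sn.
have mM : m <= M.
  by rewrite -subr_ge0 Mm divr_ge0// ?side_length_ge0// ltW.
have thS (k : nat) : th (j + k) = t + k%:R * d.
  by rewrite /t /polygon_node natrD; ring.
have phiE k x : phi (j + k) (rotation t x) = dotp x (polar (k%:R * d)) / h (t + k%:R * d).
  by rewrite /phi thS dotp_rotation.
have phi0 x : phi j (rotation t x) = x.1 / H.
  have := phiE 0 x; rewrite addn0 mul0r addr0 => ->.
  by rewrite /dotp /polar /= cos0 sin0 mulr1 mulr0 addr0.
have sH : 0 < sin d * H by rewrite mulr_gt0.
have ME y : M * y * (sin d * H) = (h (t + d) - cos d * H) * y.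
  by rewrite /M; field; rewrite Hn sn.
have mE y : m * y * (sin d * H) = (cos d * H - h (t - d)) * y.
  by rewrite /m; field; rewrite Hn sn.
have dM x : dotp x (polar d) * H - x.1 * h (t + d) = x.2 * (sin d * H) - M * x.1 * (sin d * H).
  by rewrite ME /dotp /polar /=; ring.
have dm x : dotp x (polar (- d)) * H - x.1 * h (t - d) = m * x.1 * (sin d * H) - x.2 * (sin d * H).
  by rewrite mE /dotp /polar /= cosN sinN; ring.
have -> : h t * side_length p h t / 2 = H ^+ 2 * (M - m) / 2.
  by rewrite Mm -/H; field.
have mcell' : measurable ([set x : R * R | cell j (rotation t x)] : set plane).
  have := measurable_affine_preimage (cos t) (- sin t) 0 (sin t) (cos t) 0 (mcell j).
  by congr measurable; apply/seteqP; split => x /=; rewrite /rotation /= !addr0 mulNr.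
apply: area_triangle => // x /=.
- move=> [x0 xH xm xM]; split; first by rewrite phi0 ler_pdivrMr// mul1r.
  have d1 : dotp x (polar d) * H < x.1 * h (t + d).
    by rewrite -subr_lt0 dM subr_lt0 ltr_pM2r.
  have d2 : dotp x (polar (- d)) * H < x.1 * h (t - d).
    by rewrite -subr_lt0 dm subr_lt0 ltr_pM2r.
  have main i : (i < N)%N -> i != j -> phi i (rotation t x) < phi j (rotation t x).
    move=> iN ij; rewrite phi0 /phi.
    have thi : th i = t + (th i - t) by ring.
    rewrite thi dotp_rotation -thi ltr_pdivrMr// mulrAC ltr_pdivlMr//.
    rewrite [in ltRHS]thi; apply: sector_all => //.
    (* Distinct indices below [2 p] are between [1] and [2 p - 1] steps apart, the range covered by
       [sector_all]. *)
    have -> : th i - t = (i%:R - j%:R) * d by rewrite /t /polygon_node; ring.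
    rewrite normrM (gtr0_norm dd).
    have dN : 2 * pi - d = (N%:R - 1) * d.
      by rewrite -regular_stepM -mul2n natrM; ring.
    rewrite dN ler_pM2r// -{1}[d]mul1r ler_pM2r//.
    have [lij|lji|e] := ltngtP i j; last by rewrite e eqxx in ij.
      rewrite distrC -natrB ?(ltnW lij)// normr_nat (ler_nat _ 1) subn_gt0 lij /=.
      rewrite lerBrDr natr1 ler_nat.
      by apply: leq_ltn_trans jN; rewrite leq_subr.
    rewrite -natrB ?(ltnW lji)// normr_nat (ler_nat _ 1) subn_gt0 lji /=.
    rewrite lerBrDr natr1 ler_nat.
    by apply: leq_ltn_trans iN; rewrite leq_subr.
  move=> i iN; have [->|ij] := eqVneq i j; first by rewrite ltnn.
  by have := main i iN ij => h1; split=> //; exact: ltW.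
- move=> cx; have le k := cell_le (j + k) cx.
  have xH : x.1 <= H.
    by have := cx.1; rewrite phi0 ler_pdivrMr// mul1r.
  (* For [x.1 < 0] the opposite side, [p] steps further, would have the larger ratio. *)
  have x0 : 0 <= x.1.
    have := le p; rewrite phiE phi0 regular_stepM.
    rewrite /dotp /polar /= cospi sinpi mulr0 addr0 mulrN1 => hx.
    rewrite leNgt; apply/negP => x1.
    have : 0 < - x.1 / h (t + pi) by rewrite divr_gt0// oppr_gt0.
    have : x.1 / H < 0 by rewrite pmulr_llt0// invr_gt0.
    lra.
  split=> //.
  + have := le (N.-1); rewrite phiE phi0.
    have -> : N.-1%:R * d = - d + 2 * pi.
      have e : N.-1%:R + 1 = 2 * p%:R :> R by rewrite natr1 prednK// -mul2n natrM.
      by rewrite -regular_stepM mulrA -e; ring.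
    rewrite addrA polarD2pi h_per ler_pdivrMr// mulrAC ler_pdivlMr//.
    by rewrite -subr_le0 dm subr_le0 ler_pM2r.
  + have := le 1; rewrite phiE phi0 mul1r ler_pdivrMr// mulrAC ler_pdivlMr//.
    by rewrite -subr_le0 dM subr_le0 ler_pM2r.
Qed.

Theorem area_circumscribed_polygon :
  area (circumscribed_polygon p h th0) =
  (\sum_(j < N) h (th j) * side_length p h (th j) / 2)%:E.
Proof.
rewrite poly_cells /area.
pose mu : {measure set plane -> \bar R} := [the measure plane R of (leb \x leb)%E].
have := @measure_fin_bigcup _ _ _ mu _ `I_N cell (finite_II N) tcell (fun i _ => mcell i).
rewrite -fsbig_ord /mu /= => ->; rewrite -sumEFin.
by apply: eq_bigr => j _; exact: cell_area.
Qed.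

End PolygonArea.

(** * Comparison of polygon areas *)

Section Comparison.
Variable R : realType.
Implicit Types (h : R -> R).

Definition polygon_sum (p : nat) h (t : R) : R :=
  \sum_(j < p.*2) h (polygon_node p t j) * side_length p h (polygon_node p t j) / 2.

(** The tangent of half a step: [w * step_tan p] is the side of the regular [2 p]-gon circumscribed
    about the disk of diameter [w]. *)
Definition step_tan (p : nat) : R := (1 - cos (regular_step R p)) / sin (regular_step R p).

Lemma constant_width_per w h : (forall t, h (t + pi) = w - h t) ->
  forall t, h (t + 2 * pi) = h t.
Proof.
move=> hw t; have -> : t + 2 * pi = t + pi + pi by ring.
by rewrite !hw; ring.
Qed.

Lemma side_lengthDpi w h p t : (2 <= p)%N -> (forall t, h (t + pi) = w - h t) ->
  side_length p h (t + pi) = 2 * w * step_tan p - side_length p h t.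
Proof.
move=> p2 hw; rewrite /side_length /step_tan.
have -> : t + pi + regular_step R p = t + regular_step R p + pi by ring.
have -> : t + pi - regular_step R p = t - regular_step R p + pi by ring.
rewrite !hw; field.
by rewrite gt_eqF// sin_regular_step.
Qed.

(* Each direction is paired with its opposite, where the support value is [w - h t]. *)
Lemma polygon_sum_half w h p t : (2 <= p)%N -> (forall t, h (t + pi) = w - h t) ->
  polygon_sum p h t = \sum_(j < p)
    ((h (polygon_node p t j) - w / 2) *
       (side_length p h (polygon_node p t j) - w * step_tan p) + w ^+ 2 * step_tan p / 2).
Proof.
move=> p2 hw; rewrite /polygon_sum -addnn big_split_ord /= -big_split /=.
apply: eq_bigr => j _.
have -> : polygon_node p t (p + j) = polygon_node p t j + pi.
  by rewrite /polygon_node natrD -(regular_stepM R p2); ring.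
by rewrite hw (side_lengthDpi _ p2 hw); field.
Qed.

Lemma step_tan_ge (p : nat) : (2 <= p)%N -> sin (regular_step R p / 2) <= step_tan p.
Proof.
move=> p2; have d0 := regular_step_gt0 R p2; have d1 := regular_step_le R p2.
rewrite /step_tan; set d := regular_step R p in d0 d1 *.
have dE : d = d / 2 + d / 2 by lra.
have p0 := pi_gt0 R.
have s0 : 0 < sin (d / 2) by rewrite sin_gt0_pi//; lra.
have c0 : 0 < cos (d / 2) by rewrite cos_gt0_pihalf//; lra.
have -> : cos d = 1 - 2 * sin (d / 2) ^+ 2.
  by rewrite {1}dE cosD -!expr2 cos2sin2; ring.
have -> : sin d = 2 * (sin (d / 2) * cos (d / 2)).
  by rewrite {1}dE sinD; ring.
have -> : (1 - (1 - 2 * sin (d / 2) ^+ 2)) / (2 * (sin (d / 2) * cos (d / 2))) =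
  sin (d / 2) / cos (d / 2) by field; rewrite !gt_eqF.
by rewrite ler_pdivlMr// ler_piMr// ?ltW// cos_le1.
Qed.

(* With [step_tan_ge], bounds [2 ^ i * step_tan (2 ^ i * p)] below uniformly in [i]. *)
Lemma sin_expn2 (x : R) i : 0 <= x -> 2 ^+ i * x <= pi ->
  sin (2 ^+ i * x) <= 2 ^+ i * sin x.
Proof.
elim: i => [|i IH] x0; first by rewrite !expr0 !mul1r.
rewrite exprS -mulrA => xpi.
have y0 : 0 <= 2 ^+ i * x by rewrite mulr_ge0// exprn_ge0.
have := IH x0; move: y0 xpi; set y := 2 ^+ i * x => y0 xpi /(_ _).
have -> : 2 * y = y + y by ring.
rewrite sinD => h.
have {}h : sin y <= 2 ^+ i * sin x by apply: h; lra.
have sy : 0 <= sin y by rewrite sin_ge0_pi//; lra.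
have : sin y * cos y <= sin y by rewrite ler_piMr// cos_le1.
rewrite -mulrA; lra.
Qed.

(** The triple angle formula at [pi / 3] factors as [(c + 1) * (2 c - 1) ^ 2 = 0], and [c] is
    positive. *)
Lemma cos_pi3 : cos (pi / 3) = 1 / 2 :> R.
Proof.
have p0 := pi_gt0 R.
have c0 : 0 < cos (pi / 3) :> R by rewrite cos_gt0_pihalf//; lra.
have := cosD (pi / 3 + pi / 3) (pi / 3 : R).
rewrite (_ : pi / 3 + pi / 3 + pi / 3 = pi); last by field.
rewrite cospi cosD sinD; set c := cos _ in c0 *; set s := sin _ => h.
have sE : s ^+ 2 = 1 - c ^+ 2 by exact: sin2cos2.
have : (c + 1) * (2 * c - 1) ^+ 2 = 0.
  transitivity (4 * c ^+ 3 - 3 * c + 1); first by ring.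
  have : -1 = c ^+ 3 - 3 * c * s ^+ 2 by rewrite h; ring.
  by rewrite sE => e; lra.
move/eqP; rewrite mulf_eq0 sqrf_eq0 => /orP[/eqP|/eqP]; lra.
Qed.

Variables (n : nat) (w t : R).
Hypotheses (n_ge3 : (3 <= n)%N) (w_gt0 : 0 < w).

(** Each vertex and each arc of a Reuleaux [n]-gon has a sector of normals of length [pi / n]; this
    is half of it. *)
Definition half_angle (n : nat) : R := pi / (2 * n%:R).
Local Notation b := (half_angle n).
Definition circumradius (n : nat) (w : R) : R := w / (2 * cos (half_angle n)).
Local Notation rho := (circumradius n w).

(** The support function of the centered Reuleaux polygon with a vertex in direction [t]: even
    sectors belong to vertices at distance [rho], odd ones to the arcs opposite to them. *)
Definition reuleaux_support (n : nat) (w t : R) h := forall (m : nat) s, `|s| <= half_angle n ->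
  h (t + m%:R * (pi / n%:R) + s) =
    if odd m then w - circumradius n w * cos s else circumradius n w * cos s.

Let n0 : 0 < n%:R :> R. Proof. by rewrite ltr0n (leq_trans _ n_ge3). Qed.

Lemma half_angleE : pi / n%:R = 2 * b.
Proof. by rewrite /half_angle; field; rewrite gt_eqF. Qed.

Lemma half_angle_gt0 : 0 < b.
Proof. by rewrite divr_gt0 ?pi_gt0// mulr_gt0. Qed.

Lemma half_angle_le : b <= pi / 6.
Proof.
rewrite ler_pM2l ?pi_gt0// lef_pV2 ?posrE ?mulr_gt0//.
by rewrite -natrM ler_nat (leq_mul2l 2 3 n).
Qed.

Lemma cos_half_angle : 0 < cos b.
Proof.
have := half_angle_gt0; have := half_angle_le; have := pi_gt0 R => *.
by rewrite cos_gt0_pihalf//; lra.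
Qed.

Lemma circumradius_gt0 : 0 < rho.
Proof. by rewrite divr_gt0// mulr_gt0// cos_half_angle. Qed.

Lemma circumradius_cos : rho * cos b = w / 2.
Proof. by rewrite /circumradius; field; rewrite gt_eqF ?cos_half_angle. Qed.

Lemma circumradius_cos_ge s : `|s| <= b -> w / 2 <= rho * cos s.
Proof.
move=> sb; rewrite -circumradius_cos ler_pM2l ?circumradius_gt0//.
have := half_angle_gt0; have := half_angle_le; have := pi_gt0 R => *.
by rewrite -(cos_norm s) leNgt ltr_cos ?in_itv/= -?leNgt//; apply/andP; split => //; lra.
Qed.

Lemma circumradius_lt : rho < w.
Proof.
rewrite /circumradius ltr_pdivrMr ?mulr_gt0 ?cos_half_angle//.
rewrite -[ltLHS]mulr1 ltr_pM2l//.
have b0 := half_angle_gt0; have b1 := half_angle_le; have p0 := pi_gt0 R.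
have : cos (pi / 3) < cos b :> R by rewrite ltr_cos ?in_itv/=; first lra; apply/andP; split; lra.
by have := cos_pi3; lra.
Qed.

(** The supporting lines at two consecutive nodes, both at distance [w / 2], meet at distance [rho]
    from the origin on the bisector, and this point dominates [h] between them. The same bound half
    a turn later is the lower one. *)
Lemma support_le_circumradius h : sine_convex h -> (forall u, h (u + pi) = w - h u) ->
  (forall m : nat, h (t - b + m%:R * (pi / n%:R)) = w / 2) ->
  forall (m : nat) s, `|s| <= b ->
  `|h (t + m%:R * (pi / n%:R) + s) - w / 2| <= rho * cos s - w / 2.
Proof.
move=> hc hw hnode m s; rewrite ler_norml => /andP[s1 s2].
have b0 := half_angle_gt0; have b1 := half_angle_le; have p0 := pi_gt0 R.
have cb := cos_half_angle.
have sb : 0 < sin b by rewrite sin_gt0_pi//; lra.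
have h1 : 0 <= sin (b - s) by rewrite sin_ge0_pi//; lra.
have h2 : 0 <= sin (b + s) by rewrite sin_ge0_pi//; lra.
have h3 : 0 <= sin (b + b) by rewrite sin_ge0_pi//; lra.
set x := t + m%:R * (pi / n%:R) + s.
set y0 := t - b + m%:R * (pi / n%:R).
have yE : t - b + m.+1%:R * (pi / n%:R) = y0 + (b + b).
  by rewrite /y0 -natr1 half_angleE; ring.
have e1 : y0 + (b + b) - x = b - s by rewrite /y0 /x; ring.
have e2 : x - y0 = b + s by rewrite /y0 /x; ring.
have ub z : h (y0 + z) = w / 2 -> h (y0 + (b + b) + z) = w / 2 -> h (x + z) <= rho * cos s.
  move=> z0 z1.
  have := hc (y0 + z) (x + z) (y0 + (b + b) + z).
  rewrite (_ : y0 + (b + b) + z - (x + z) = b - s); last by rewrite -e1; ring.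
  rewrite (_ : x + z - (y0 + z) = b + s); last by rewrite -e2; ring.
  rewrite (_ : y0 + (b + b) + z - (y0 + z) = b + b); last by ring.
  move=> /(_ h1 h2 h3); rewrite z0 z1.
  rewrite (_ : w / 2 * sin (b - s) + w / 2 * sin (b + s) = w * cos s * sin b);
    last by rewrite sinB sinD; field.
  rewrite (_ : sin (b + b) = 2 * cos b * sin b); last by rewrite sinD; ring.
  rewrite mulrA.
  rewrite ler_pM2r// -ler_pdivlMr ?mulr_gt0// => /le_trans; apply.
  by rewrite /circumradius mulrAC.
have n1 := hnode m; have n2 := hnode m.+1; rewrite yE -/y0 in n1 n2.
have := ub 0; rewrite !addr0 => /(_ n1 n2) u1.
have := ub pi; rewrite !hw n1 n2 (_ : w - w / 2 = w / 2); last by lra.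
move=> /(_ erefl erefl) u2.
by rewrite ler_norml; apply/andP; split; lra.
Qed.

Section Levels.
Variables (h hT : R -> R).
Hypotheses (h_conv : sine_convex h) (h_width : forall u, h (u + pi) = w - h u)
  (h_node : forall m : nat, h (t - b + m%:R * (pi / n%:R)) = w / 2)
  (T_width : forall u, hT (u + pi) = w - hT u)
  (T_supp : reuleaux_support n w t hT).

(** Each sector is cut into [2 ^ k] steps, so its end nodes are normals at every level. *)
Definition level (n k : nat) : nat := (n * 2 ^ k)%N.
Local Notation p k := (level n k).
Local Notation th k := (polygon_node (level n k) (t - b)).
Local Notation gap u := (`|hT u - w / 2| - `|h u - w / 2|).

Lemma level_ge2 k : (2 <= p k)%N.
Proof.
apply: (@leq_trans n); first exact: leq_trans n_ge3.
by rewrite leq_pmulr// expn_gt0.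
Qed.

Lemma level_step k : 2 ^+ k * regular_step R (p k) = 2 * b.
Proof.
rewrite -half_angleE /regular_step /level natrM natrX.
by field; rewrite gt_eqF//= expf_neq0.
Qed.

Lemma level_node k (m r : nat) : th k (m * 2 ^ k + r)%N =
  t + m%:R * (pi / n%:R) + (r%:R * regular_step R (p k) - b).
Proof.
rewrite /polygon_node natrD natrM natrX mulrDl -mulrA level_step half_angleE.
by ring.
Qed.

Lemma level_offset k r : (r <= 2 ^ k)%N -> `|r%:R * regular_step R (p k) - b| <= b.
Proof.
move=> rk; have d0 := regular_step_gt0 R (level_ge2 k).
have : r%:R * regular_step R (p k) <= 2 * b.
  by rewrite -(level_step k) ler_pM2r// -natrX ler_nat.
have : 0 <= r%:R * regular_step R (p k) by rewrite mulr_ge0// ltW.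
by rewrite ler_norml => *; apply/andP; split; lra.
Qed.

Lemma gap_ge0 k j : 0 <= gap (th k j).
Proof.
rewrite (divn_eq j (2 ^ k)) level_node subr_ge0.
have rk : (j %% 2 ^ k <= 2 ^ k)%N by rewrite ltnW// ltn_mod expn_gt0.
have sb := level_offset rk.
apply: (le_trans (support_le_circumradius h_conv h_width h_node _ sb)).
rewrite T_supp//; have := circumradius_cos_ge sb; case: ifP => _ hs.
  by rewrite -normrN (le_trans _ (ler_norm _))//; lra.
by rewrite (le_trans _ (ler_norm _))//; lra.
Qed.

(** Inside a sector [hT] is a cosine, with side length zero, or [w] minus a cosine, with the maximal
    side length [2 * w * step_tan]. *)
Let T_term k j : (hT (th k j) - w / 2) * (side_length (p k) hT (th k j) - w * step_tan (p k))
  = - (w * step_tan (p k) * `|hT (th k j) - w / 2|).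
Proof.
have sd := sin_regular_step R (level_ge2 k).
have d0 := regular_step_gt0 R (level_ge2 k).
rewrite (divn_eq j (2 ^ k)); set m := (j %/ 2 ^ k)%N; set r := (j %% 2 ^ k)%N.
have rk : (r < 2 ^ k)%N by rewrite ltn_mod expn_gt0.
have sb := level_offset (ltnW rk).
have := circumradius_cos_ge sb; rewrite level_node.
(* At the common end of two sectors the side has an intermediate length, but its factor [hT - w / 2]
   vanishes. *)
have [r0|r0] := posnP r.
  rewrite r0 mul0r sub0r cosN circumradius_cos => _.
  have nb : `|- b| <= b by rewrite normrN gtr0_norm// half_angle_gt0.
  rewrite T_supp// cosN circumradius_cos.
  have -> : (if odd m then w - w / 2 else w / 2) - w / 2 = 0 by case: ifP => _; lra.
  by rewrite mul0r normr0 mulr0 oppr0.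
set d := regular_step R _ in sd d0 sb *; set s := r%:R * d - b in sb * => ws.
have sp : `|s + d| <= b.
  by rewrite (_ : s + d = r.+1%:R * d - b) ?level_offset// -natr1 /s; ring.
have sm : `|s - d| <= b.
  rewrite (_ : s - d = r.-1%:R * d - b) ?level_offset//.
    by rewrite (leq_trans (leq_pred _))// ltnW.
  by rewrite /s -{1}(prednK r0) -natr1; ring.
rewrite /side_length -/d -[_ + s + d]addrA -[_ + s - d]addrA.
rewrite !T_supp// /step_tan -/d (cosB s d) (cosD s d).
have := gt_eqF sd => sn.
case: ifP => _.
  rewrite ler0_norm; last by lra.
  by field; rewrite sn.
rewrite ger0_norm; last by lra.
by field; rewrite sn.
Qed.

Lemma step_tan_gt0 q : (2 <= q)%N -> 0 < step_tan q.
Proof.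
move=> q2; apply: lt_le_trans (step_tan_ge q2).
have := regular_step_gt0 R q2; have := regular_step_le R q2; have := pi_gt0 R => *.
by rewrite sin_gt0_pi//; lra.
Qed.

Hypothesis h_gt0 : forall u, 0 < h u.

(** Nonnegativity of a side and of its opposite confines [l - w * c] to absolute value at most
    [w * c], so each term is at least [- w * c * |g|]; by [T_term] the Reuleaux polygon attains this
    with its own, larger [|g|]. *)
Lemma polygon_sum_gap k :
  w * step_tan (p k) * (\sum_(j < p k) gap (th k j)) <=
  polygon_sum (p k) h (t - b) - polygon_sum (p k) hT (t - b).
Proof.
have p2 := level_ge2 k.
rewrite (polygon_sum_half _ p2 h_width) (polygon_sum_half _ p2 T_width).
rewrite -sumrB mulr_sumr; apply: ler_sum => j _.
set c := step_tan _; have c0 : 0 < c by exact: step_tan_gt0.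
rewrite T_term -/c; set u := th k j.
have l0 v : 0 <= side_length (p k) h v.
  exact: (side_length_ge0 p2 h_conv).
have := l0 (u + pi); rewrite (side_lengthDpi _ p2 h_width) -/c => l1.
have {}l0 := l0 u; set l := side_length _ _ _ in l0 l1 *.
set g := h u - w / 2.
have : `|g * (l - w * c)| <= w * c * `|g|.
  by rewrite normrM mulrC ler_wpM2r// ler_norml; apply/andP; split; lra.
by rewrite ler_norml => /andP[h1 _]; lra.
Qed.

Lemma polygon_sum_ge k : polygon_sum (p k) hT (t - b) <= polygon_sum (p k) h (t - b).
Proof.
rewrite -subr_ge0; apply: le_trans (polygon_sum_gap k).
apply: mulr_ge0; first by rewrite mulr_ge0 ?ltW// step_tan_gt0// level_ge2.
by apply: sumr_ge0 => j _; exact: gap_ge0.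
Qed.

(* If the gap is positive at a midpoint, it is at least some [e > 0] on an
   interval, which contains [2 ^ i] consecutive nodes of level [k0 + i]. *)
Lemma polygon_sum_strict (m : nat) : (m < n)%N -> continuous h ->
  `|h (t + m%:R * (pi / n%:R)) - w / 2| < rho - w / 2 ->
  exists2 e, 0 < e & exists k0, forall k, (k0 <= k)%N ->
    polygon_sum (p k) hT (t - b) + e <= polygon_sum (p k) h (t - b).
Proof.
move=> mn ch hm.
set y := t + m%:R * (pi / n%:R) in hm *.
pose f s := rho * cos s - w / 2 - `|h (y + s) - w / 2|.
have cf : f s @[s --> 0] --> f 0.
  apply: cvgB; first apply: cvgB; try exact: cvg_cst.
    apply: cvgM; [exact: cvg_cst|exact: continuous_cos].
  apply: cvg_norm; apply: cvgB; last exact: cvg_cst.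
  apply: (@continuous_comp _ _ _ (fun s => y + s) h); last exact: ch.
  by apply: cvgD; [exact: cvg_cst|exact: cvg_id].
have f0 : 0 < f 0 by rewrite /f cos0 mulr1 addr0; lra.
set e := f 0 / 2; have e0 : 0 < e by rewrite divr_gt0.
have /cvgrPdist_lt /(_ _ e0) := cf.
rewrite nearE /= => /nbhs_ballP[eta /= eta0 etaP].
have {}etaP s : 0 <= s -> s < eta -> e <= f s.
  move=> s0 s1; have := etaP s; rewrite /ball /= sub0r normrN ger0_norm// => /(_ s1).
  by rewrite /e; move=> /ltr_normlP[]; lra.
have b0 := half_angle_gt0; have b1 := half_angle_le; have p0 := pi_gt0 R.
have [k1 k1P] : exists k1 : nat, b / 2 ^+ k1 < eta.
  exists (Num.trunc (b / eta)).+1.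
  rewrite ltr_pdivrMr ?exprn_gt0// mulrC -ltr_pdivrMr//.
  apply: (@lt_le_trans _ _ (Num.trunc (b / eta)).+1%:R).
    by have /andP[] := Num.Theory.truncn_itv (ltW (divr_gt0 b0 eta0)).
  by rewrite -natrX ler_nat ltnW// ltn_expl.
(* The factor [sin (b / 2 ^+ k1 / 2)] is a lower bound for [2 ^+ i * step_tan] that does not depend
   on the level. *)
pose e' := w * sin (b / 2 ^+ k1 / 2) * e.
have q0 : 0 < b / 2 ^+ k1 by rewrite divr_gt0// exprn_gt0.
have q1 : b / 2 ^+ k1 <= b.
  by rewrite ler_pdivrMr ?exprn_gt0// ler_peMr ?exprn_ege1 ?ler1n// ltW.
exists e'.
  rewrite /e' !mulr_gt0// sin_gt0_pi//; lra.
exists k1.+1 => k kk.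
rewrite addrC -lerBrDr; apply: le_trans (polygon_sum_gap k).
(* With this choice [2 ^ i] steps of level [k] span the fixed length [b / 2 ^ k1]. *)
pose i := (k - k1.+1)%N; have kE : k = (i + k1).+1 by rewrite /i -addnS subnK.
set d := regular_step R (p k).
have d0 : 0 < d by exact: regular_step_gt0 (level_ge2 k).
have idE : 2 ^+ i * d = b / 2 ^+ k1.
  apply: (@mulfI _ (2 ^+ k1.+1)); first by rewrite expf_neq0.
  rewrite mulrA -exprD addSn addnC -kE level_step exprS.
  by field; rewrite expf_neq0.
have tan_ge : sin (b / 2 ^+ k1 / 2) <= 2 ^+ i * step_tan (p k).
  rewrite -idE -mulrA; apply: (le_trans (sin_expn2 _ _)).
  - by rewrite divr_ge0// ltW.
  - by rewrite mulrA idE; lra.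
  - by rewrite ler_pM2l ?exprn_gt0// step_tan_ge// level_ge2.
have half : (2 ^ k)%N = (2 ^ k.-1 + 2 ^ k.-1)%N by rewrite kE expnS mul2n -addnn.
have offb q : (2 ^ k.-1 + q)%:R * d - b = q%:R * d.
  have := level_step k; rewrite -/d -natrX half !natrD; lra.
have i_le : (2 ^ i <= 2 ^ k.-1)%N by rewrite kE leq_exp2l// leq_addr.
have sum_ge : 2 ^+ i * e <= \sum_(j < p k) gap (th k j).
  pose F j := gap (th k j); rewrite -/(F _).
  have F0 j : 0 <= F j by exact: gap_ge0.
  (* The index of the midpoint of sector [m], half of the [2 ^ k] steps past its first node. *)
  set j0 := (m * 2 ^ k + 2 ^ k.-1)%N.
  have jB : (j0 + 2 ^ i <= p k)%N.
    apply: (@leq_trans (m.+1 * 2 ^ k)%N); last by rewrite leq_mul2r mn orbT.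
    by rewrite mulSn /j0 [leqRHS]addnC -addnA leq_add2l [leqRHS]half leq_add2l.
  rewrite -(big_mkord xpredT F).
  rewrite (@big_cat_nat _ _ _ j0) /=; [|by []|by rewrite (leq_trans _ jB)// leq_addr].
  rewrite (@big_cat_nat _ _ _ (j0 + 2 ^ i)%N j0) /=; [|by rewrite leq_addr|by []].
  rewrite addrCA ler_wpDr//; first by rewrite addr_ge0// sumr_ge0.
  rewrite -{1}[j0]add0n big_addn addKn big_mkord.
  have -> : 2 ^+ i * e = \sum_(q < 2 ^ i) e.
    by rewrite sumr_const card_ord -[RHS]mulr_natl natrX.
  apply: ler_sum => q _; rewrite /F addnC /j0 -addnA.
  have qi : (q <= 2 ^ k.-1)%N by rewrite (leq_trans _ i_le)// ltnW.
  have qk : (2 ^ k.-1 + q <= 2 ^ k)%N by rewrite half leq_add2l.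
  have := level_offset qk; rewrite level_node -/d -/y offb => qb.
  have qf : e <= f (q%:R * d).
    apply: etaP; first by rewrite mulr_ge0// ltW.
    apply: le_lt_trans k1P; rewrite -idE ler_pM2r// -natrX ler_nat ltnW//.
  apply: (le_trans qf); rewrite /f lerD2r /y T_supp//.
  have := circumradius_cos_ge qb; case: ifP => _ hs.
    by rewrite -normrN (le_trans _ (ler_norm _))//; lra.
  by rewrite (le_trans _ (ler_norm _))//; lra.
have st0 : 0 < w * step_tan (p k) by rewrite mulr_gt0// step_tan_gt0// level_ge2.
apply: (@le_trans _ _ (w * step_tan (p k) * (2 ^+ i * e))); last by rewrite ler_pM2l.
rewrite /e' (_ : w * step_tan (p k) * (2 ^+ i * e) = w * (2 ^+ i * step_tan (p k)) * e); last by ring.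
by rewrite ler_pM2r// ler_pM2l.
Qed.

End Levels.
End Comparison.

(** * Areas of bodies as limits of polygon areas *)

Section AreaLimit.
Variable R : realType.
Local Notation leb := (@lebesgue_measure R).
Local Notation plane := (measurableTypeR R * measurableTypeR R)%type.
Implicit Types (K : set (R * R)) (w t : R).

Definition supp K t : R := support_function K (polar t).

Lemma supp_width w K : constant_width w K -> forall t, supp K (t + pi) = w - supp K t.
Proof.
move=> cw t; have := cw (polar t) (unit_vector_polar t).
by rewrite /supp polarDpi => <-; ring.
Qed.

Lemma supp_conv K : compact K -> K !=set0 -> sine_convex (supp K).
Proof. by move=> cK K0 a b c h1 h2 h3; exact: supp_sine_convex. Qed.

Variables (n : nat) (w t : R).
Hypotheses (n_ge3 : (3 <= n)%N) (w_gt0 : 0 < w).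
Local Notation b := (half_angle R n).
Local Notation rho := (circumradius n w).

(** Sectors are numbered by naturals, so full turns are added until the angle lies past the first
    node [t - b], before dividing by the sector length. *)
Lemma angle_decomp (y : R) : exists (m j : nat) s, `|s| <= b /\
  y + j%:R * (2 * pi) = t + m%:R * (pi / n%:R) + s.
Proof.
have b0 := half_angle_gt0 R n_ge3; have p0 := pi_gt0 R.
pose j := (Num.trunc (`|y - t + b| / (2 * pi))).+1.
pose z := y + j%:R * (2 * pi) - t + b.
have z0 : 0 <= z.
  have : `|y - t + b| / (2 * pi) < j%:R.
    by have /andP[] := Num.Theory.truncn_itv (divr_ge0 (normr_ge0 (y - t + b)) (ltW (mulr_gt0 (ltr0n R 2) p0))).
  rewrite ltr_pdivrMr ?mulr_gt0// => h1.
  have := ler_norm (- (y - t + b)); rewrite normrN /z; lra.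
pose m := Num.trunc (z / (2 * b)).
exists m, j, (z - m%:R * (2 * b) - b); split; last first.
  by rewrite (half_angleE _ n_ge3) /z; ring.
have := Num.Theory.truncn_itv (divr_ge0 z0 (mulr_ge0 (ler0n R 2) (ltW b0))).
have bb : 0 < 2 * b by lra.
rewrite -/m => /andP[]; rewrite ler_pdivlMr// => h1.
rewrite ltr_pdivrMr// -natr1 => h2.
by rewrite ler_norml; apply/andP; split; lra.
Qed.

Lemma supp_perM w' K (j : nat) u : constant_width w' K -> supp K (u + j%:R * (2 * pi)) = supp K u.
Proof.
move=> /supp_width /constant_width_per hp.
elim: j => [|j IH]; first by rewrite mul0r addr0.
by rewrite -IH -[RHS]hp -natr1; congr supp; ring.
Qed.

(** Says that [K] has a circumscribed regular [2 n]-gon centered at the origin. *)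
Definition nodes_at K := forall m : nat, supp K (t - b + m%:R * (pi / n%:R)) = w / 2.

Lemma supp_gt0 K : compact K -> K !=set0 -> constant_width w K -> nodes_at K ->
  forall u, 0 < supp K u.
Proof.
move=> cK K0 cw nd u; have [m [j [s [sb E]]]] := angle_decomp u.
rewrite -(supp_perM j u cw) E.
have := support_le_circumradius n_ge3 (supp_conv cK K0) (supp_width cw) nd m sb.
have : rho * cos s <= rho.
  by rewrite ler_piMr ?cos_le1// ltW// circumradius_gt0.
have := circumradius_lt n_ge3 w_gt0.
by rewrite ler_norml => ? ? /andP[]; lra.
Qed.

Let P K k := circumscribed_polygon (level n k) (supp K) (t - b).

(** The normals are dense: a supporting inequality violated at some direction is, by continuity,
    violated at a nearby node of a fine level. *)
Lemma body_bigcap_polygons K : compact K -> convex_set (K : set (convex_lmodType (R * R)%type)) ->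
  K !=set0 -> constant_width w K -> \bigcap_k P K k = K.
Proof.
move=> cK vK K0 cw; apply/seteqP; split => x; last first.
  by move=> Kx k _ j; exact: supp_le.
move=> xP; apply: supp_separation => // y.
rewrite leNgt; apply/negP => xy.
pose f s := dotp x (polar s) - supp K s.
have cf : continuous f.
  move=> s; apply: cvgB; last exact: supp_continuous.
  by apply: cvgD; apply: cvgM; try exact: cvg_cst;
    [exact: continuous_cos|exact: continuous_sin].
have b0 := half_angle_gt0 R n_ge3; have p0 := pi_gt0 R.
have [m [j [s [sb E]]]] := angle_decomp y.
set y' := y + j%:R * (2 * pi) in E.
have fy : 0 < f y'.
  have pE : polar y' = polar y :> R * R.
    rewrite /y'; elim: (j) => [|i IH]; first by rewrite mul0r addr0.
    by rewrite -IH -[RHS]polarD2pi -natr1; congr polar; ring.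
  by rewrite /f /supp pE subr_gt0.
have /cvgrPdist_lt /(_ _ fy) := cf y'.
rewrite nearE /= => /nbhs_ballP[eta /= eta0 etaP].
have [k kP] : exists k : nat, 2 * b / 2 ^+ k < eta.
  exists (Num.trunc (2 * b / eta)).+1.
  rewrite ltr_pdivrMr ?exprn_gt0// [eta * _]mulrC -ltr_pdivrMr//.
  apply: (@lt_le_trans _ _ (Num.trunc (2 * b / eta)).+1%:R).
    by have /andP[] := Num.Theory.truncn_itv (divr_ge0 (mulr_ge0 (ler0n R 2) (ltW b0)) (ltW eta0)).
  by rewrite -natrX ler_nat ltnW// ltn_expl.
set d := regular_step R (level n k).
have d0 : 0 < d by exact: regular_step_gt0 (level_ge2 n_ge3 k).
have dE : d = 2 * b / 2 ^+ k.
  apply: (@mulfI _ (2 ^+ k)); first by rewrite expf_neq0.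
  by rewrite (level_step _ n_ge3) [RHS]mulrC divfK// expf_neq0.
have z0 : 0 <= y' - (t - b).
  have : 0 <= m%:R * (pi / n%:R) :> R by rewrite mulr_ge0// divr_ge0// ltW.
  by move: sb; rewrite E ler_norml => /andP[h1 _]; lra.
(* The last node not after [y'], less than one step away from it. *)
pose i := Num.trunc ((y' - (t - b)) / d).
have := Num.Theory.truncn_itv (divr_ge0 z0 (ltW d0)).
rewrite -/i => /andP[]; rewrite ler_pdivlMr// => h1; rewrite ltr_pdivrMr// -natr1 => h2.
pose v := polygon_node (level n k) (t - b) i.
have vE : v = t - b + i%:R * d by [].
have := etaP v; rewrite /ball /= ger0_norm; last by rewrite vE; lra.
have vy : y' - v < eta by apply: le_lt_trans kP; rewrite -dE vE; lra.
move=> /(_ vy) /ltr_normlP[_]; rewrite ltrBlDr ltrDl => fv.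
have := xP k I i; rewrite -/v /=; move: fv; rewrite /f /supp; lra.
Qed.

Lemma polygons_decreasing K : nonincreasing_seq (P K).
Proof.
apply/nonincreasing_seqP => k; apply/subsetPset => x xP j.
suff -> : polygon_node (level n k) (t - b) j = polygon_node (level n k.+1) (t - b) j.*2.
  exact: xP.
rewrite /polygon_node; congr (_ + _).
apply: (@mulfI _ (2 ^+ k.+1)); first by rewrite expf_neq0.
rewrite [in RHS]mulrCA (level_step _ n_ge3) exprS [in LHS]mulrACA (level_step _ n_ge3).
by rewrite -mul2n natrM.
Qed.

(** Continuity from above of the area along the nested polygons, the first of which has finite
    area. *)
Lemma area_limit K : compact K -> convex_set (K : set (convex_lmodType (R * R)%type)) ->
  K !=set0 -> constant_width w K -> nodes_at K ->
  [/\ measurable (K : set plane), (area K < +oo)%E &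
  (polygon_sum (level n k) (supp K) (t - b))%:E @[k --> \oo] --> area K].
Proof.
move=> cK vK K0 cw nd.
have h0 := supp_gt0 cK K0 cw nd.
have per := constant_width_per (supp_width cw).
have mP k : measurable (P K k : set plane) by exact: measurable_circumscribed_polygon.
have aP k : area (P K k) = (polygon_sum (level n k) (supp K) (t - b))%:E.
  by apply: area_circumscribed_polygon => //; [exact: level_ge2|exact: supp_conv].
have mK : measurable (\bigcap_k P K k : set plane) by exact: bigcapT_measurable.
have KE := body_bigcap_polygons cK vK K0 cw.
have P0oo : (area (P K 0) < +oo)%E by rewrite aP ltry.
pose mu : {measure set plane -> \bar R} := [the measure plane R of (leb \x leb)%E].
split; first by rewrite -KE.
  apply: (@le_lt_trans _ _ (mu (P K 0))) => //.
  apply: le_measure; rewrite ?inE// -?[X in measurable X]KE//.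
  by rewrite -[X in X `<=` _]KE => x; apply.
rewrite -[X in area X]KE; under eq_fun do rewrite -aP.
have := @nonincreasing_cvg_mu _ _ _ mu (P K); apply => //.
exact: polygons_decreasing.
Qed.

Section Compare.
Variables (K T : set (R * R)).
Hypotheses (cK : compact K) (vK : convex_set (K : set (convex_lmodType (R * R)%type)))
  (K0 : K !=set0) (wK : constant_width w K) (nK : nodes_at K).
Hypotheses (cT : compact T) (vT : convex_set (T : set (convex_lmodType (R * R)%type)))
  (T0 : T !=set0) (wT : constant_width w T) (sT : reuleaux_support n w t (supp T)).

Lemma reuleaux_nodes : nodes_at T.
Proof.
move=> m; have b0 := half_angle_gt0 R n_ge3.
have -> : t - b + m%:R * (pi / n%:R) = t + m%:R * (pi / n%:R) + - b by ring.
rewrite sT ?normrN ?gtr0_norm// cosN (circumradius_cos _ n_ge3).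
by case: ifP => _; lra.
Qed.

Lemma reuleaux_area_le : (area T <= area K)%E.
Proof.
have [_ _ lK] := area_limit cK vK K0 wK nK.
have [_ aT lT] := area_limit cT vT T0 wT reuleaux_nodes.
apply: (lee_cvg_to lT lK) => //; apply: nearW => k; rewrite lee_fin.
exact: (polygon_sum_ge n_ge3 w_gt0 (supp_conv cK K0) (supp_width wK) nK (supp_width wT) sT).
Qed.

Lemma reuleaux_area_lt (m : nat) : (m < n)%N ->
  `|supp K (t + m%:R * (pi / n%:R)) - w / 2| < rho - w / 2 -> (area T < area K)%E.
Proof.
move=> mn hm.
have [_ _ lK] := area_limit cK vK K0 wK nK.
have [_ aT lT] := area_limit cT vT T0 wT reuleaux_nodes.
have := polygon_sum_strict n_ge3 w_gt0 (supp_conv cK K0) (supp_width wK) nK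
  (supp_width wT) sT mn (supp_continuous cK K0) hm.
move=> [e e0 [k0 ek]].
have lTe : (polygon_sum (level n k) (supp T) (t - b) + e)%:E @[k --> \oo] --> (area T + e%:E)%E.
  under eq_fun do rewrite EFinD.
  by apply: cvgeD => //; [rewrite fin_num_adde_defl|exact: cvg_cst].
have le1 : (area T + e%:E <= area K)%E.
  apply: (lee_cvg_to lTe lK); exists k0; first by [].
  move=> k kk; rewrite lee_fin; exact: ek.
apply: lt_le_trans le1.
rewrite lteDl ?lte_fin// ge0_fin_numE//; exact: measure_ge0.
Qed.

End Compare.
End AreaLimit.

(** * Reuleaux polygons as intersections of disks *)

Section BallIntersection.
Variable R : realType.
Implicit Types (x y : R * R) (r : R).

Lemma enormD x y : enorm (x + y) <= enorm x + enorm y.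
Proof.
apply: enorm_leP; first by rewrite addr_ge0 ?enorm_ge0.
by move=> s; rewrite dotpDl lerD// dotp_le_enorm.
Qed.

Lemma dotp_le_enormr x y r t : enorm (x - y) <= r -> dotp x (polar t) <= dotp y (polar t) + r.
Proof.
move=> h; rewrite -lerBlDl -dotpBl; exact: le_trans (dotp_le_enorm _ _) h.
Qed.

(** With an arbitrary index type this covers the disk, indexed by [unit], and Reuleaux polygons,
    whose vertices are indexed periodically by [nat]. *)
Definition ball_intersection (I : Type) (V : I -> R * R) r : set (R * R) :=
  [set x | forall i, enorm (x - V i) <= r].

Variables (I : Type) (i0 : I) (V : I -> R * R) (r : R).
Hypothesis r_ge0 : 0 <= r.
Local Notation B := (ball_intersection V r).

(** A disk is the intersection of its supporting half-planes; convexity and closedness become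
    linear. *)
Lemma ball_intersectionP x :
  B x <-> forall i t, dotp x (polar t) <= dotp (V i) (polar t) + r.
Proof.
split=> [Bx i t|h i]; first exact/dotp_le_enormr/Bx.
by apply: enorm_leP => // t; rewrite dotpBl lerBlDl.
Qed.

Lemma ball_intersection_convex : convex_set (B : set (convex_lmodType (R * R)%type)).
Proof.
apply/convex_setP => x y l l0 l1 /ball_intersectionP hx /ball_intersectionP hy.
apply/ball_intersectionP => i t; rewrite dotpDl !dotpZl.
have := ler_wpM2l l0 (hx i t).
have l2 : 0 <= 1 - l by rewrite subr_ge0.
by have := ler_wpM2l l2 (hy i t); lra.
Qed.

Lemma ball_intersection_closed : closed B.
Proof.
have -> : B = \bigcap_(p in [set: I * R])
    [set x | dotp x (polar p.2) <= dotp (V p.1) (polar p.2) + r].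
  apply/seteqP; split => x.
    by move/ball_intersectionP => h [i t] _ /=; exact: h.
  by move=> h; apply/ball_intersectionP => i t; exact: (h (i, t) Logic.I).
apply: closed_bigI => p _.
apply: (@closed_comp _ _ (fun x => dotp x (polar p.2)) [set y | y <= _]); last exact: closed_le.
by move=> x _; exact: continuous_dotp.
Qed.

Lemma abs_le_enorm x : `|x.1| <= enorm x /\ `|x.2| <= enorm x.
Proof.
split; rewrite -(@ler_pXn2r _ 2)// ?nnegrE ?enorm_ge0// enorm_sqr real_normK ?num_real//;
  by rewrite /dotp -!expr2 ?lerDl ?lerDr sqr_ge0.
Qed.

Lemma ball_intersection_compact : compact B.
Proof.
have cc : compact (`[(V i0).1 - r, (V i0).1 + r]%classic `*` `[(V i0).2 - r, (V i0).2 + r]%classic).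
  by apply: compact_setX; exact: segment_compact.
apply: (subclosed_compact ball_intersection_closed cc) => x /(_ i0) h.
have [h1 h2] := abs_le_enorm (x - V i0).
move: (le_trans h1 h) (le_trans h2 h); rewrite !coordE !ler_norml => /andP[? ?] /andP[? ?].
by split; rewrite /= in_itv /=; apply/andP; split; lra.
Qed.

Lemma ball_intersection_interior y e : 0 < e -> (forall i, enorm (y - V i) + e <= r) ->
  B° !=set0.
Proof.
move=> e0 h; exists y; apply/nbhs_ballP; exists (e / 2) => /=; first by rewrite divr_gt0.
move=> x [/= h1 h2] i.
have -> : x - V i = (x - y) + (y - V i) by rewrite addrA subrK.
apply: (le_trans (enormD _ _)); apply: le_trans (h i); rewrite addrC lerD2l.
apply: (le_trans (enorm_le_abs _)); rewrite !coordE.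
rewrite /ball /= in h1 h2; rewrite (distrC x.1) (distrC x.2); lra.
Qed.

End BallIntersection.

Section Disk.
Variables (R : realType) (w : R).
Hypothesis w_gt0 : 0 < w.

Lemma diskE : disk w = ball_intersection (fun _ : unit => 0) (w / 2).
Proof.
by apply/seteqP; split => x h; [move=> i; rewrite subr0|have := h tt; rewrite subr0].
Qed.

Lemma disk_body : convex_body (disk w).
Proof.
have w2 : 0 <= w / 2 by rewrite divr_ge0// ltW.
rewrite diskE; split.
- exact: ball_intersection_compact.
- exact: ball_intersection_convex.
- apply: (@ball_intersection_interior _ _ _ _ 0 (w / 2)); first by rewrite divr_gt0.
  by move=> i; rewrite subr0 enorm0 add0r.
Qed.

Lemma supp_disk t : supp (disk w) t = w / 2.
Proof.
have w2 : 0 <= w / 2 by rewrite divr_ge0// ltW.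
have [cK _ _] := disk_body.
have h : disk w ((w / 2) *: polar t) by rewrite /disk /= enormZ_polar.
rewrite /supp (supp_eq cK h) dotpZl polar_sqr mulr1// => y.
exact: le_trans (dotp_le_enorm _ _).
Qed.

Lemma disk_width : constant_width w (disk w).
Proof.
move=> u /unit_polar[t ->]; rewrite -polarDpi -/(supp _ t) -/(supp _ (t + pi)) !supp_disk.
by lra.
Qed.

End Disk.

(** * Vertices and arcs of a Reuleaux polygon *)

Section Reuleaux.
Variable R : realType.
Variables (n : nat) (w : R) (c : R * R) (t : R).
Hypotheses (n_ge3 : (3 <= n)%N) (n_odd : odd n) (w_gt0 : 0 < w).
Local Notation b := (half_angle R n).
Local Notation rho := (circumradius n w).
Local Notation V := (vertex n w c t).
Local Notation a j := (t + 2 * pi * j%:R / n%:R : R).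

Definition reuleaux (n : nat) (w : R) (c : R * R) (t : R) : set (R * R) :=
  ball_intersection (vertex n w c t) w.
Local Notation T := (reuleaux n w c t).

Let n0 : 0 < n%:R :> R. Proof. by rewrite ltr0n (leq_trans _ n_ge3). Qed.
Let nn : n%:R != 0 :> R. Proof. by rewrite gt_eqF. Qed.
Let bn : b * n%:R = pi / 2.
Proof. by rewrite /half_angle; field. Qed.
Let b0 : 0 < b := half_angle_gt0 R n_ge3.
Let b1 : b <= pi / 6 := half_angle_le R n_ge3.
Let cb : 0 < cos b := cos_half_angle R n_ge3.

Lemma vertexE j : V j = c + rho *: polar (a j).
Proof. by []. Qed.

Lemma vertex_angle j : a j = t + j%:R * (4 * b).
Proof. by rewrite /half_angle; field. Qed.

Lemma vertex_mod j : V j = V (j %% n).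
Proof.
rewrite !vertexE; congr (_ + _ *: _); rewrite {1}(divn_eq j n) natrD natrM.
elim: (j %/ n)%N => [|k IH]; first by rewrite mul0r add0r.
rewrite -IH -[RHS]polarD2pi -natr1; congr polar.
by field.
Qed.

Lemma widthE : w = 2 * rho * cos b.
Proof. by have := circumradius_cos w n_ge3; lra. Qed.

(** At [s = b] and [s = - b] this reduces to [0 <= sin (phi - 2 b)] and [0 <= sin (phi + 2 b)]. In
    between, [sin (phi - s)] is the sine interpolation of its end values, and [cos b <= cos s]. *)
Let chord_ineq (phi s : R) : 2 * b <= phi <= pi - 2 * b -> `|s| <= b ->
  sin phi <= 2 * cos b * sin (phi - s).
Proof.
move=> /andP[p1 p2] sB; have := sB; rewrite ler_norml => /andP[s1 s2].
have pi0 := pi_gt0 R; have B0 := b0; have B1 := b1; have CB := cb.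
have sphi : 0 <= sin phi by rewrite sin_ge0_pi//; lra.
have sb : 0 < sin b by rewrite sin_gt0_pi//; lra.
have e1 : sin phi <= 2 * cos b * sin (phi - b).
  have : 0 <= sin (phi - b - b) by rewrite sin_ge0_pi//; lra.
  have := sinD (phi - b) b; rewrite subrK (sinB (phi - b) b); lra.
have e2 : sin phi <= 2 * cos b * sin (phi + b).
  have : 0 <= sin (phi + b + b) by rewrite sin_ge0_pi//; lra.
  have := sinB (phi + b) b; rewrite addrK (sinD (phi + b) b); lra.
have h1 : 0 <= sin (b + s) by rewrite sin_ge0_pi//; lra.
have h2 : 0 <= sin (b - s) by rewrite sin_ge0_pi//; lra.
have e3 : sin (phi - s) * (2 * sin b * cos b) =
    sin (phi - b) * sin (b + s) + sin (phi + b) * sin (b - s).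
  rewrite !sinB !sinD.
  have hc := sin2cos2 b; rewrite expr2 in hc.
  transitivity ((sin phi * cos s - cos phi * sin s) * (2 * sin b * cos b)) => //.
  by ring.
have s2b : 0 < 2 * sin b * cos b by rewrite !mulr_gt0.
rewrite -(ler_pM2r s2b) -[leRHS]mulrA e3.
have e4 := ler_wpM2r h1 e1; have e5 := ler_wpM2r h2 e2.
have e6 : sin phi * (2 * sin b * cos b) <= sin phi * (sin (b + s) + sin (b - s)).
  apply: ler_wpM2l => //; rewrite sinD sinB.
  have : cos b <= cos s.
    rewrite -(ler_pM2l (circumradius_gt0 n_ge3 w_gt0)) (circumradius_cos _ n_ge3).
    exact: circumradius_cos_ge.
  move=> cc; have := ler_wpM2l (ltW sb) cc; lra.
lra.
Qed.

(** With [phi] half the angle between the two vertices, the squared distance to [V i] is [w ^ 2 + 4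
    rho ^ 2 sin phi ^ 2 - 4 rho w sin phi sin (phi - s)]. Since [w = 2 rho cos b], [chord_ineq]
    bounds it by [w ^ 2]. *)
Lemma arc_in_reuleaux j s : `|s| <= b -> T (V j - w *: polar (a j + s)).
Proof.
move=> sb i.
rewrite vertex_mod [V i]vertex_mod.
have jn : (j %% n < n)%N by rewrite ltn_mod (leq_trans _ n_ge3).
have in_ : (i %% n < n)%N by rewrite ltn_mod (leq_trans _ n_ge3).
have -> : polar (a j + s) = polar (a (j %% n)%N + s).
  rewrite {1}(divn_eq j n) natrD natrM.
  elim: (j %/ n)%N => [|k IH]; first by rewrite mul0r add0r.
  rewrite -IH -[RHS]polarD2pi -natr1; congr polar.
  by field.
move: (j %% n)%N (i %% n)%N jn in_ => {}j {}i jn iN.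
rewrite (enorm_le _ (ltW w_gt0)).
have pi0 := pi_gt0 R; have B0 := b0; have B1 := b1; have CB := cb.
have BB : 0 < 2 * b by lra.
pose phi := (i%:R - j%:R) * (2 * b).
have -> : V j - w *: polar (a j + s) - V i =
   (rho *: polar (a j) - rho *: polar (a i)) - w *: polar (a j + s).
  by rewrite !vertexE; apply: coord_eq; rewrite !coordE; ring.
rewrite !(dotpBl, dotpBr, dotpZl, dotpZr, dotp_polar) !subrr cos0.
have e1 : a j - a i = - (phi + phi) by rewrite !vertex_angle /phi; ring.
have e2 : a i - a j = phi + phi by rewrite !vertex_angle /phi; ring.
have e3 : a j - (a j + s) = - s by ring.
have e4 : a i - (a j + s) = phi + phi - s by rewrite !vertex_angle /phi; ring.
have e5 : a j + s - a j = s by ring.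
have e6 : a j + s - a i = - (phi + phi - s) by rewrite !vertex_angle /phi; ring.
rewrite e1 e2 e3 e4 e5 e6 !cosN.
have main : sin phi * sin phi <= 2 * cos b * (sin phi * sin (phi - s)).
  have pn : pi - 2 * b = (n%:R - 1) * (2 * b) by have := bn; lra.
  have [lij|lji|ij] := ltngtP i j; last by rewrite /phi ij subrr mul0r sin0 !mul0r mulr0.
    (* Here [phi] is negative; adding [pi] reverses the signs of both sines and leaves their product
       unchanged. *)
    have hb : 2 * b <= phi + pi <= pi - 2 * b.
      have -> : phi + pi = (n%:R + i%:R - j%:R) * (2 * b) by rewrite /phi; have := bn; lra.
      rewrite pn -[X in X <= _ <= _]mul1r !ler_pM2r//.
      have : (i.+1%:R <= j%:R :> R) by rewrite ler_nat.
      have : (j.+1%:R <= n%:R :> R) by rewrite ler_nat.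
      have : 0 <= i%:R :> R by rewrite ler0n.
      rewrite -!natr1 => *; apply/andP; split; lra.
    have := chord_ineq hb sb; rewrite sinDpi addrAC sinDpi.
    have : 0 <= sin (phi + pi) by rewrite sin_ge0_pi//; case/andP: hb => *; apply/andP; split; lra.
    rewrite sinDpi => s0 h; have := ler_wpM2l s0 h; lra.
  have hb : 2 * b <= phi <= pi - 2 * b.
    rewrite pn /phi -[X in X <= _ <= _]mul1r !ler_pM2r//.
    have : (j.+1%:R <= i%:R :> R) by rewrite ler_nat.
    have : (i.+1%:R <= n%:R :> R) by rewrite ler_nat.
    have : 0 <= j%:R :> R by rewrite ler0n.
    rewrite -!natr1 => *; apply/andP; split; lra.
  have : 0 <= sin phi by rewrite sin_ge0_pi//; case/andP: hb => *; apply/andP; split; lra.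
  by move=> s0; have := ler_wpM2l s0 (chord_ineq hb sb); lra.
have d1 : cos (phi + phi) = 1 - 2 * (sin phi * sin phi).
  by rewrite cosD; have := cos2sin2 phi; rewrite !expr2; lra.
have d2 : cos (phi + phi - s) = cos s - 2 * (sin phi * sin (phi - s)).
  rewrite cosB cosD !sinB sinD.
  have e : cos phi * cos phi = 1 - sin phi * sin phi by have := cos2sin2 phi; rewrite !expr2.
  by rewrite e; ring.
rewrite d1 d2; have r0 := circumradius_gt0 n_ge3 w_gt0.
have := ler_wpM2l (mulr_ge0 (ltW r0) (ltW r0)) main.
have e : rho * w * (sin phi * sin (phi - s)) =
    rho * rho * (2 * cos b * (sin phi * sin (phi - s))).
  by rewrite {2}widthE; ring.
rewrite expr2; lra.
Qed.

(** The circumradius is chosen for this: since [w = 2 rho cos b], [polar_sum] shows that a segment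
    of length [w] from [V j], at angle [b] to the diameter, ends on the circle again, and for odd
    [n] it ends at a vertex. *)
Lemma vertex_opposite j :
  V j + w *: polar (a j + pi + b) = V (j + n.+1./2)%N /\
  V j + w *: polar (a j + pi - b) = V (j + n./2)%N.
Proof.
have e1 : n.+1./2%:R * 2 = n%:R + 1 :> R.
  have : (n.+1./2 * 2 = n.+1)%N by rewrite muln2 -[RHS](odd_double_half n.+1) /= n_odd.
  by move=> E; rewrite -natrM E natr1.
have e2 : n./2%:R * 2 = n%:R - 1 :> R.
  have : (n = n./2 * 2 + 1)%N by rewrite muln2 -[LHS](odd_double_half n) n_odd addnC.
  by move=> E; rewrite [in RHS]E natrD natrM addrK.
have bnE := bn.
have f1 : a (j + n.+1./2)%N = a j + b + b + pi.
  rewrite !vertex_angle natrD.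
  have -> : (j%:R + n.+1./2%:R) * (4 * b) = j%:R * (4 * b) + (n.+1./2%:R * 2) * (2 * b) by ring.
  by rewrite e1; lra.
have f2 : a (j + n./2)%N = a j - b - b + pi.
  rewrite !vertex_angle natrD.
  have -> : (j%:R + n./2%:R) * (4 * b) = j%:R * (4 * b) + (n./2%:R * 2) * (2 * b) by ring.
  by rewrite e2; lra.
have p1 : polar (a j) = (2 * cos b) *: polar (a j + b) - polar (a j + b + b).
  by have := polar_sum (a j + b) b; rewrite addrK => <-; rewrite addrK.
have p2 : polar (a j) = (2 * cos b) *: polar (a j - b) - polar (a j - b - b).
  by have := polar_sum (a j - b) b; rewrite subrK => <-; rewrite addrAC subrr add0r.
rewrite !vertexE f1 f2 !polarDpi [a j + pi + b]addrAC [a j + pi - b]addrAC !polarDpi.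
split.
  by rewrite p1; apply: coord_eq; rewrite !coordE {2}widthE; ring.
by rewrite p2; apply: coord_eq; rewrite !coordE {2}widthE; ring.
Qed.

End Reuleaux.

Lemma half_succ_odd n : odd n -> n.+1./2 = n./2.+1.
Proof. by move=> no; rewrite -[LHS]/(uphalf n) uphalf_half no. Qed.

Lemma half_add_odd n : odd n -> (n./2 + n./2.+1)%N = n.
Proof. by move=> no; rewrite addnS addnn -[RHS]odd_double_half no. Qed.

(** * Support function of a Reuleaux polygon and its characterization by the vertices *)

Section ReuleauxSupport.
Variable R : realType.
Variables (n : nat) (w : R) (c : R * R) (t : R).
Hypotheses (n_ge3 : (3 <= n)%N) (n_odd : odd n) (w_gt0 : 0 < w).
Local Notation b := (half_angle R n).
Local Notation rho := (circumradius n w).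
Local Notation V := (vertex n w c t).
Local Notation a j := (t + 2 * pi * j%:R / n%:R : R).
Local Notation T := (reuleaux n w c t).

Lemma opposite_vertex j : V j = V (j + n.+1./2)%N + w *: polar (a j + b) /\
  V j = V (j + n./2)%N + w *: polar (a j - b).
Proof.
have [<- <-] := vertex_opposite w c t n_ge3 n_odd j.
rewrite !polarpiD.
by split; rewrite -addrA -scalerDr addNr scaler0 addr0.
Qed.

Lemma vertex_in_reuleaux j : T (V j).
Proof.
have b0 := half_angle_gt0 R n_ge3.
rewrite (vertex_mod _ _ _ n_ge3) -(modnDr j n) -(vertex_mod _ _ _ n_ge3).
have -> : (j + n = (j + n./2) + n.+1./2)%N.
  by rewrite -addnA half_succ_odd// half_add_odd.
have [<- _] := vertex_opposite w c t n_ge3 n_odd (j + n./2).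
rewrite polarpiD scalerN.
by apply: arc_in_reuleaux => //; rewrite gtr0_norm.
Qed.

Lemma reuleaux_compact : compact T.
Proof. by apply: (ball_intersection_compact 0%N); exact: ltW. Qed.

Lemma reuleaux_convex : convex_set (T : set (convex_lmodType (R * R)%type)).
Proof. exact: ball_intersection_convex (ltW w_gt0). Qed.

Lemma reuleaux_neq0 : T !=set0.
Proof. by exists (V 0%N); exact: vertex_in_reuleaux. Qed.

(** At the two ends of the sector, the disks about the two opposite vertices bound [T] by lines
    through [V j]; [dotp_polar3] spreads this over the sector. *)
Lemma supp_reuleaux_vertex j s : `|s| <= b ->
  supp T (a j + s) = dotp (V j) (polar (a j + s)).
Proof.
move=> sb; apply: supp_eq; first exact: reuleaux_compact.
  exact: vertex_in_reuleaux.
move=> x Tx; rewrite -subr_le0 -dotpBl.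
have pi0 := pi_gt0 R; have b0 := half_angle_gt0 R n_ge3; have b1 := half_angle_le R n_ge3.
have sbb : 0 < sin (b + b) by rewrite sin_gt0_pi//; lra.
have := sb; rewrite ler_norml => /andP[s1 s2].
have [v1 v2] := opposite_vertex j.
have h1 : dotp (x - V j) (polar (a j + b)) <= 0.
  rewrite dotpBl v1 dotpDl dotpZl polar_sqr mulr1 subr_le0.
  exact/dotp_le_enormr/Tx.
have h2 : dotp (x - V j) (polar (a j - b)) <= 0.
  rewrite dotpBl v2 dotpDl dotpZl polar_sqr mulr1 subr_le0.
  exact/dotp_le_enormr/Tx.
have := dotp_polar3 (x - V j) (a j - b) (a j + s) (a j + b).
rewrite (_ : a j + b - (a j - b) = b + b); last by ring.
rewrite (_ : a j + b - (a j + s) = b - s); last by ring.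
rewrite (_ : a j + s - (a j - b) = b + s); last by ring.
have g1 : 0 <= sin (b - s) by rewrite sin_ge0_pi//; lra.
have g2 : 0 <= sin (b + s) by rewrite sin_ge0_pi//; lra.
move=> e; rewrite -(ler_pM2r sbb) mul0r e.
by have := mulr_ge0 g1 (_ : 0 <= - dotp (x - V j) (polar (a j - b)));
  have := mulr_ge0 g2 (_ : 0 <= - dotp (x - V j) (polar (a j + b)));
  rewrite !oppr_ge0 => /(_ h1) k1 /(_ h2) k2; lra.
Qed.

Lemma supp_reuleaux_arc j s : `|s| <= b ->
  supp T (a j + pi + s) = dotp (V j) (polar (a j + pi + s)) + w.
Proof.
move=> sb; have h := arc_in_reuleaux c t n_ge3 w_gt0 j sb.
rewrite /supp polarpiD (supp_eq reuleaux_compact h).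
  by rewrite dotpNr dotpBl dotpZl polar_sqr dotpNr; ring.
move=> x Tx; have := dotp_le_enormr (a j + pi + s) (Tx j).
by rewrite polarpiD !dotpNr dotpBl dotpZl polar_sqr; lra.
Qed.

Let nn : n%:R != 0 :> R.
Proof. by rewrite pnatr_eq0 -lt0n (leq_trans _ n_ge3). Qed.

Lemma even_direction m s : ~~ odd m -> t + m%:R * (pi / n%:R) + s = a m./2 + s.
Proof.
move=> em; have mn : m./2%:R * 2 = m%:R :> R.
  by rewrite -natrM muln2; congr (_%:R); rewrite -[RHS]odd_double_half (negbTE em).
rewrite (_ : 2 * pi * _ / n%:R = (m./2%:R * 2) * pi / n%:R); last by ring.
by rewrite mn; field.
Qed.

(** Both [m] and [n] are odd, so [m + n] can be halved; the extra full turn keeps the index a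
    natural number. *)
Lemma odd_direction m s : odd m ->
  t + m%:R * (pi / n%:R) + s + 2 * pi = a (m + n)./2 + pi + s.
Proof.
move=> om; have mn : (m + n)./2%:R * 2 = m%:R + n%:R :> R.
  rewrite -natrM muln2 -natrD; congr (_%:R).
  by rewrite -[RHS]odd_double_half oddD om n_odd.
rewrite (_ : 2 * pi * _ / n%:R = ((m + n)./2%:R * 2) * pi / n%:R); last by ring.
by rewrite mn; field.
Qed.

Lemma direction_cases y : exists j s, `|s| <= b /\
  (polar y = polar (a j + s) \/ polar y = polar (a j + pi + s)).
Proof.
have [m [k [s [sb E]]]] := angle_decomp t n_ge3 y.
have pE : polar (t + m%:R * (pi / n%:R) + s) = polar y :> R * R.
  rewrite -E; elim: (k) => [|i IH]; first by rewrite mul0r addr0.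
  by rewrite -IH -[RHS]polarD2pi -natr1; congr polar; ring.
have [om|em] := boolP (odd m).
  exists (m + n)./2, s; split=> //; right.
  by rewrite -pE -odd_direction// polarD2pi.
by exists m./2, s; split=> //; left; rewrite -pE even_direction.
Qed.

Lemma reuleaux_width : constant_width w T.
Proof.
move=> u /unit_polar[y ->]; have [j [s [sb [->|->]]]] := direction_cases y.
  rewrite -polarpiD -!/(supp _ _) supp_reuleaux_arc// supp_reuleaux_vertex//.
  by rewrite polarpiD dotpNr; ring.
rewrite {2}polarpiD opprK -!/(supp _ _) supp_reuleaux_arc// supp_reuleaux_vertex//.
by rewrite polarpiD dotpNr; ring.
Qed.

Lemma enorm_sub_vertex_center j : enorm (c - V j) = rho.
Proof.
rewrite (vertexE n w c t j) opprD addrA subrr add0r enormN enormZ_polar//.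
exact/ltW/circumradius_gt0.
Qed.

Lemma reuleaux_convex_body : convex_body T.
Proof.
split; [exact: reuleaux_compact|exact: reuleaux_convex|].
apply: (@ball_intersection_interior _ _ _ _ c (w - rho)).
  by rewrite subr_gt0 circumradius_lt.
by move=> j; rewrite enorm_sub_vertex_center; lra.
Qed.

Lemma width_diameter K x y : compact K -> constant_width w K -> K x -> K y ->
  enorm (x - y) <= w.
Proof.
move=> cK cw Kx Ky; apply: enorm_leP; first exact: ltW.
move=> u; have := cw (polar u) (unit_vector_polar u) => <-.
by rewrite dotpBl -dotpNr lerD// supp_le.
Qed.

(** The support values of [K] at [u] and [- u] are at most those of [L], with the same sum, so both
    agree. *)
Lemma constant_width_subset K L : compact K -> convex_set (K : set (convex_lmodType (R * R)%type)) ->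
  K !=set0 -> constant_width w K -> compact L -> convex_set (L : set (convex_lmodType (R * R)%type)) ->
  constant_width w L -> K `<=` L -> K = L.
Proof.
move=> cK vK K0 wK cL vL wL KL.
have L0 : L !=set0 by case: K0 => x /KL; exists x.
apply: supp_inj => // u.
have h1 := supp_mono (polar u) cK cL K0 KL.
have h2 := supp_mono (- polar u) cK cL K0 KL.
have := wK _ (unit_vector_polar u); have := wL _ (unit_vector_polar u); lra.
Qed.

(** A body of width [w] has diameter at most [w], so one that contains the vertices lies in the
    intersection of the disks about them. *)
Lemma reuleaux_eq K : compact K -> convex_set (K : set (convex_lmodType (R * R)%type)) ->
  constant_width w K -> (forall j, K (V j)) -> K = T.
Proof.
move=> cK vK wK KV; apply: constant_width_subset => //.
- by exists (V 0%N).
- exact: reuleaux_compact.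
- exact: reuleaux_convex.
- exact: reuleaux_width.
- by move=> x Kx j; apply: (width_diameter cK).
Qed.

(** The equality case of the Cauchy-Schwarz inequality. *)
Lemma extreme_point x y : enorm x <= w -> w <= dotp x (polar y) -> x = w *: polar y.
Proof.
move=> h1 h2; apply/eqP; rewrite -subr_eq0; apply/eqP; apply: dotp_eq0.
apply/eqP; rewrite eq_le dotp_ge0 andbT.
rewrite dotpBl !dotpBr !dotpZl !dotpZr polar_sqr (dotpC (polar y)).
move: h1; rewrite (enorm_le _ (ltW w_gt0)) => h1.
have := ler_wpM2l (ltW w_gt0) h2; rewrite expr2 in h1; lra.
Qed.

(** Replaces the two sector coefficients by one angle measured from the axis of the arc;
    nonnegativity of both coefficients amounts to [|s| <= b]. *)
Lemma short_arcE j : short_arc w (V (j + n.+1./2)%N) (V j) (V j.+1) =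
  [set x | exists2 s, `|s| <= b & x = V (j + n.+1./2)%N - w *: polar (a (j + n.+1./2)%N + s)].
Proof.
set i := (j + n.+1./2)%N; set B := a i.
have b0 := half_angle_gt0 R n_ge3; have b1 := half_angle_le R n_ge3; have pi0 := pi_gt0 R.
have cb := cos_half_angle R n_ge3.
have sb0 : 0 < sin b by rewrite sin_gt0_pi//; lra.
have [v1 v2] := vertex_opposite w c t n_ge3 n_odd i.
have i1 : (i + n.+1./2 = j.+1 + n)%N.
  by rewrite /i half_succ_odd// -addnA addSn half_add_odd// addnS addSn.
have i2 : (i + n./2 = j + n)%N.
  by rewrite /i half_succ_odd// -addnA [(_.+1 + _)%N]addnC half_add_odd.
have per k : V (k + n)%N = V k.
  by rewrite (vertex_mod _ _ _ n_ge3) modnDr -(vertex_mod _ _ _ n_ge3).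
rewrite i1 per -/B in v1; rewrite i2 per -/B in v2.
have q : V j.+1 - V i = - (w *: polar (B + b)).
  by rewrite -v1 addrAC subrr add0r polarpiD scalerN.
have p : V j - V i = - (w *: polar (B - b)).
  by rewrite -v2 addrAC subrr add0r polarpiD scalerN.
rewrite /short_arc p q; apply/seteqP; split => x /=.
  move=> [xn [A [D [A0 D0 xE]]]].
  (* The coordinates of [- (x - V i) / w] along ([C]) and across ([S]) the axis, hence the cosine
     and sine of the angle sought. *)
  pose S := (D - A) * sin b; pose C := (A + D) * cos b.
  have x1 : x - V i = - (w *: (C *: polar B + S *: polar (B + pi / 2))).
    rewrite xE (polarD B b) (polarD B (- b)) cosN sinN /C /S.
    by apply: coord_eq; rewrite !coordE; ring.
  have CS : C ^+ 2 + S ^+ 2 = 1.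
    have := enorm_sqr (x - V i); rewrite xn x1 dotpNl dotpNr opprK dotpZl dotpZr.
    rewrite !(dotpDl, dotpDr, dotpZl, dotpZr) !polar_sqr !dotp_polar.
    rewrite (_ : B - (B + pi / 2) = - (pi / 2)); last by ring.
    rewrite (_ : B + pi / 2 - B = pi / 2); last by ring.
    rewrite cosN cos_pihalf => h.
    have : w ^+ 2 * (C ^+ 2 + S ^+ 2 - 1) = 0 by rewrite mulrBr mulr1 [X in _ - X]h; ring.
    by move/eqP; rewrite mulf_eq0 expf_eq0 /= (gt_eqF w_gt0) /= subr_eq0 => /eqP.
  have C0 : 0 <= C by rewrite mulr_ge0 ?addr_ge0// ltW.
  have SB : -1 <= S <= 1.
    rewrite -ler_norml -(@ler_pXn2r _ 2)// ?nnegrE// expr1n real_normK ?num_real//.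
    by rewrite -CS lerDr sqr_ge0.
  pose s := asin S.
  have sE : sin s = S by rewrite asinK// in_itv.
  have cE : cos s = C.
    by rewrite cos_asin// -CS addrK sqrtr_sqr ger0_norm.
  have s1 := asin_geNpi2 SB; have s2 := asin_lepi2 SB.
  exists s; last first.
    by rewrite (polarD B s) cE sE; move/eqP: x1; rewrite subr_eq addrC => /eqP.
  have g1 : 0 <= sin (b - s).
    rewrite sinB cE sE /C /S.
    rewrite (_ : _ - _ = 2 * A * sin b * cos b); last by ring.
    by rewrite !mulr_ge0// ltW.
  have g2 : 0 <= sin (b + s).
    rewrite sinD cE sE /C /S.
    rewrite (_ : _ + _ = 2 * D * sin b * cos b); last by ring.
    by rewrite !mulr_ge0// ltW.
  have neg (z : R) : 0 <= sin z -> - pi < z -> 0 <= z.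
    move=> z0 z1; rewrite leNgt; apply/negP => z2.
    have : 0 < sin (- z) by rewrite sin_gt0_pi//; lra.
    by rewrite sinN; lra.
  rewrite -/s in s1 s2.
  have k1 : 0 <= b - s by apply: neg => //; lra.
  have k2 : 0 <= b + s by apply: neg => //; lra.
  by rewrite ler_norml; apply/andP; split; lra.
move=> [s sb ->].
rewrite addrAC subrr add0r; split; first by rewrite enormN enormZ_polar// ltW.
have := sb; rewrite ler_norml => /andP[s1 s2].
have sbb : 0 < sin (b + b) by rewrite sin_gt0_pi//; lra.
(* Cramer's rule in the basis of the two bounding rays, whose angle is [b + b]. *)
exists (sin (b - s) / sin (b + b)), (sin (b + s) / sin (b + b)); split.
- by rewrite (divr_ge0 _ (ltW sbb))// sin_ge0_pi//; lra.
- by rewrite (divr_ge0 _ (ltW sbb))// sin_ge0_pi//; lra.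
- have e : polar (B + s) = (sin (b - s) / sin (b + b)) *: polar (B - b) +
      (sin (b + s) / sin (b + b)) *: polar (B + b).
    rewrite (polarD B s) (polarD B b) (polarD B (- b)) cosN sinN sinB !sinD.
    have h : sin b * cos b + cos b * sin b = 2 * sin b * cos b by ring.
    by rewrite h; apply: coord_eq; rewrite !coordE; field; rewrite !gt_eqF.
  by rewrite e scalerDr !scalerN !scalerA opprD ![w * _]mulrC.
Qed.

End ReuleauxSupport.

(** * The region enclosed by the Reuleaux arcs *)

Section EnclosedRegion.
Variable R : realType.
Variables (n : nat) (w : R) (c : R * R) (t : R).
Hypotheses (n_ge3 : (3 <= n)%N) (n_odd : odd n) (w_gt0 : 0 < w).
Local Notation b := (half_angle R n).
Local Notation rho := (circumradius n w).
Local Notation V := (vertex n w c t).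
Local Notation a j := (t + 2 * pi * j%:R / n%:R : R).
Local Notation T := (reuleaux n w c t).
Local Notation C := (reuleaux_boundary n w c t).
Local Notation U := [set x : R * R | forall i, enorm (x - V i) < w].

Let nn : (0 < n)%N. Proof. exact: leq_trans n_ge3. Qed.

Lemma boundary_arc i s : `|s| <= b -> C (V i - w *: polar (a i + s)).
Proof.
move=> sb.
have [j jn ji] : exists2 j, (j < n)%N & ((j + n.+1./2) %% n = i %% n)%N.
  (* The side opposite to [V i]: [(n - 1) / 2 + (n + 1) / 2 = n]. *)
  exists ((i + n./2) %% n)%N; first by rewrite ltn_mod.
  rewrite modnDml -addnA half_succ_odd// half_add_odd//.
  by rewrite modnDr.
exists j => //; rewrite short_arcE//; exists s => //.
rewrite (vertex_mod w c t n_ge3 i) -ji -(vertex_mod w c t n_ge3); congr (_ - _ *: _).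
have pm k : polar (a k + s) = polar (a (k %% n)%N + s) :> R * R.
  rewrite {1}(divn_eq k n) natrD natrM.
  elim: (k %/ n)%N => [|m IH]; first by rewrite mul0r add0r.
  rewrite -IH -[RHS]polarD2pi -natr1; congr polar.
  by field; rewrite pnatr_eq0 -lt0n.
by rewrite pm -ji -pm.
Qed.

Lemma boundary_dist x : C x -> T x /\ exists i, enorm (x - V i) = w.
Proof.
move=> [j _]; rewrite short_arcE// => -[s sb ->]; split.
  exact: arc_in_reuleaux.
exists (j + n.+1./2)%N; rewrite addrAC subrr add0r enormN enormZ_polar//.
exact: ltW.
Qed.

Lemma boundary_vertex j : C (V j).
Proof.
have b0 := half_angle_gt0 R n_ge3.
have [-> _] := opposite_vertex w c t n_ge3 n_odd j.
have := @boundary_arc (j + n.+1./2) (- b).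
rewrite normrN gtr0_norm// => /(_ (lexx _)).
have [_ v2] := vertex_opposite w c t n_ge3 n_odd (j + n.+1./2).
have [v1 _] := opposite_vertex w c t n_ge3 n_odd j.
rewrite polarpiD scalerN in v2; rewrite v2.
rewrite -addnA [(n.+1./2 + _)%N]addnC half_succ_odd// half_add_odd//.
by rewrite (vertex_mod w c t n_ge3) modnDr -(vertex_mod w c t n_ge3) -half_succ_odd// -v1.
Qed.

(** Such a point is a support point, and its normal lies in a vertex sector or an arc sector. In the
    first case it is the vertex, in the second the point of the arc with this normal. *)
Lemma reuleaux_extreme x i : T x -> enorm (x - V i) = w -> C x.
Proof.
move=> Tx xi; have [y xy] := polar_dir (x - V i).
rewrite xi in xy.
have cT : compact T by exact: reuleaux_compact.
have xE : dotp x (polar y) = dotp (V i) (polar y) + w.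
  have : dotp (x - V i) (polar y) = w by rewrite xy dotpZl polar_sqr mulr1.
  by rewrite dotpBl; lra.
have wT : constant_width w T by exact: reuleaux_width.
have hx : supp T y = dotp x (polar y).
  by apply: supp_eq => // z Tz; rewrite xE; exact/dotp_le_enormr/Tz.
have [j [s [sb [yE|yE]]]] := direction_cases t n_ge3 n_odd y.
  have Tp := arc_in_reuleaux c t n_ge3 w_gt0 j sb.
  have := supp_reuleaux_vertex c t n_ge3 n_odd w_gt0 j sb.
  rewrite /supp -yE -/(supp T y) hx => h.
  (* The point of the opposite arc also lies in [T], and [x] is [w] beyond it in the direction of
     the normal, which leaves only [V j]. *)
  have := @extreme_point _ _ w_gt0 (x - (V j - w *: polar (a j + s))) y.
  rewrite (width_diameter w_gt0 cT wT Tx Tp) => /(_ isT).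
  rewrite -yE dotpBl dotpBl dotpZl polar_sqr h => /(_ _) e.
  suff -> : x = V j by exact: boundary_vertex.
  have E : x - (V j - w *: polar y) = w *: polar y by apply: e; lra.
  by rewrite -[LHS](subrK (V j - w *: polar y)) E addrC subrK.
have := supp_reuleaux_arc c t n_ge3 w_gt0 j sb.
rewrite /supp -yE -/(supp T y) hx => h.
have e := @extreme_point _ _ w_gt0 (x - V j) y (Tx j).
have {}e : x - V j = w *: polar y by apply: e; rewrite dotpBl h; lra.
have -> : x = V j - w *: polar (a j + s).
  by move/eqP: e; rewrite yE polarpiD scalerN subr_eq addrC => /eqP.
exact: boundary_arc.
Qed.

Lemma reuleaux_minus_boundary : T `\` C = U.
Proof.
apply/seteqP; split => x.
  move=> [Tx nC] i; rewrite lt_neqAle (Tx i) andbT; apply/eqP => h.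
  exact/nC/(reuleaux_extreme Tx h).
move=> Ux; split; first by move=> i; exact: ltW.
by move=> /boundary_dist[_ [i h]]; have := Ux i; rewrite h ltxx.
Qed.

Lemma open_interior_points : open U.
Proof.
have oi (i : nat) : open [set x : R * R | dotp (x - V i) (x - V i) < w ^+ 2].
  pose f (x : R * R) := dotp (x - V i) (x - V i).
  have cf : continuous f.
    move=> x; apply: cvgD; apply: cvgM;
      (apply: cvgB; [first [exact: cvg_fst | exact: cvg_snd] | exact: cvg_cst]).
  apply: (@open_comp _ _ f [set y : R | y < w ^+ 2]); last exact: open_lt.
  by move=> x _; exact: cf.
rewrite (_ : U = \bigcap_(i in `I_n) [set x | dotp (x - V i) (x - V i) < w ^+ 2]).
  by rewrite bigcap_mkord; apply: (big_ind (fun A => open A)); [exact: openT|exact: openI|].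
have E x i : (enorm (x - V i) < w) = (dotp (x - V i) (x - V i) < w ^+ 2).
  by rewrite -enorm_sqr ltr_pXn2r ?nnegrE ?enorm_ge0// ltW.
apply/seteqP; split => x Ux.
  by move=> i _ /=; rewrite -E.
by move=> i; rewrite (vertex_mod w c t n_ge3) E; apply: Ux; rewrite /= ltn_mod.
Qed.

(** From a point outside [T], the ray in a direction where a disk is violated never meets [T], so
    the component is unbounded. For a point of [T] off the curve, the component cannot leave [T]:
    its part in [T] is relatively closed, and relatively open because [T] minus the curve is the
    open set [U]. *)
Theorem enclosed_reuleaux : enclosed_region C = T.
Proof.
have cT : compact T by exact: reuleaux_compact.
have clT : closed T by apply: compact_closed => //; exact: norm_hausdorff.
apply/seteqP; split => x.
  case=> [/boundary_dist[]//|[nCx bx]]; apply: contrapT => nTx.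
  have [i [y]] : exists i y, dotp (V i) (polar y) + w < dotp x (polar y).
    apply: contrapT => H; apply: nTx; apply/ball_intersectionP; first exact: ltW.
    by move=> i y; rewrite leNgt; apply/negP => h; apply: H; exists i, y.
  move=> hxy.
  pose ray := (fun r => x + r *: polar y) @` `[0, +oo[%classic.
  have ray_out z : ray z -> ~ T z.
    move=> [r /=]; rewrite in_itv /= andbT => r0 <- /(_ i) /(dotp_le_enormr y).
    by rewrite dotpDl dotpZl polar_sqr; lra.
  have ray_sub : ray `<=` connected_component (~` C) x.
    apply: connected_component_max.
    - by exists 0; rewrite /= ?in_itv /= ?lexx// scale0r addr0.
    - by move=> z /ray_out nTz Cz; apply: nTz; have [] := boundary_dist Cz.
    - apply: connected_continuous_connected.
        exact/connected_intervalP/interval_is_interval.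
      apply: continuous_subspaceT => r; apply: cvgD; first exact: cvg_cst.
      by apply: cvgZ; [exact: cvg_id|exact: cvg_cst].
  have /ex_strict_bound_gt0[M M0 /= hM] := bx.
  (* A sup norm below [M] means a Euclidean norm below [2 * M], which the triangle inequality
     contradicts at this parameter. *)
  pose r := 2 * M + enorm x.
  have r0 : 0 <= r by rewrite addr_ge0 ?enorm_ge0// mulr_ge0// ltW.
  have : connected_component (~` C) x (x + r *: polar y).
    by apply: ray_sub; exists r => //=; rewrite in_itv /= r0.
  move=> /hM; rewrite prod_normE /= gt_max => /andP[h1 h2].
  have h3 := enorm_le_abs (x + r *: polar y).
  have h4 := enormD (x + r *: polar y) (- x).
  rewrite addrAC subrr add0r enormN enormZ_polar// in h4.
  rewrite /r in h1 h2 h3 h4; lra.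
move=> Tx; have [Cx|nCx] := pselect (C x); [by left|right; split=> //].
have sub : connected_component (~` C) x `<=` T.
  set D := connected_component _ _.
  have Dx : D x by exact: connected_component_refl.
  have DC : D `<=` ~` C by exact: connected_component_sub.
  have DT : D `&` T = D `&` U.
    rewrite -reuleaux_minus_boundary; apply/seteqP; split => z [Dz].
      by move=> Tz; split=> //; split=> //; exact: DC.
    by move=> [].
  have : D `&` T = D.
    apply: (component_connected (A := ~` C) (x := x)).
    - by exists x.
    - by exists U => //; exact: open_interior_points.
    - by exists T.
  by move=> DE z; rewrite -DE => -[].
apply: (@sub_boundedr _ _ _ _ (globally T)); last exact: compact_bounded.
by move=> P /= PT z /sub; exact: PT.
Qed.

End EnclosedRegion.

Section CenteredReuleaux.
Variable R : realType.
Variables (n : nat) (w : R).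
Hypotheses (n_ge3 : (3 <= n)%N) (n_odd : odd n) (w_gt0 : 0 < w).
Local Notation b := (half_angle R n).
Local Notation rho := (circumradius n w).

Let n0 : n%:R != 0 :> R. Proof. by rewrite pnatr_eq0 -lt0n (leq_trans _ n_ge3). Qed.

Lemma supp_centered_reuleaux t : reuleaux_support n w t (supp (reuleaux n w 0 t)).
Proof.
move=> m s sb.
have vE j : vertex n w 0 t j = rho *: polar (t + 2 * pi * j%:R / n%:R).
  by rewrite (vertexE n w 0 t j) add0r.
case: ifP => om.
  have := supp_reuleaux_arc 0 t n_ge3 w_gt0 (m + n)./2 sb.
  rewrite -odd_direction// /supp polarD2pi => ->.
  rewrite -polarD2pi odd_direction// vE polarpiD dotpNr dotpZl dotp_polar.
  by rewrite opprD addNKr cosN addrC.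
have := supp_reuleaux_vertex 0 t n_ge3 n_odd w_gt0 m./2 sb.
rewrite -even_direction ?om// => ->.
rewrite even_direction ?om// vE dotpZl dotp_polar.
by rewrite opprD addNKr cosN.
Qed.

End CenteredReuleaux.

(** * Minimality and the equality case *)

Section Minimality.
Variable R : realType.
Implicit Types (K : set (R * R)) (t : R).
Local Notation plane := (measurableTypeR R * measurableTypeR R)%type.

Lemma antiperiodic_zero (g : R -> R) (p : R) : 0 <= p -> continuous g ->
  (forall x, g (x + p) = - g x) -> exists x, g x = 0.
Proof.
move=> p0 cg gp; have := gp 0; rewrite add0r => g0.
have [|x _ gx] := @IVT _ g 0 p 0 p0 (continuous_subspaceT cg); last by exists x.
rewrite g0; have [h|h] := leP (g 0) 0.
  by rewrite minEle maxEle (_ : (g 0 <= - g 0) = true); [apply/andP; split; lra|lra].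
by rewrite minEle maxEle (_ : (g 0 <= - g 0) = false); [apply/andP; split; lra|apply/negbTE; rewrite -ltNge; lra].
Qed.

Variables (n : nat) (w : R).
Hypotheses (n_ge3 : (3 <= n)%N) (n_odd : odd n) (w_gt0 : 0 < w).
Local Notation b := (half_angle R n).
Local Notation rho := (circumradius n w).
Local Notation T t := (reuleaux n w 0 t).

Let nn : n%:R != 0 :> R.
Proof. by rewrite pnatr_eq0 -lt0n (leq_trans _ n_ge3). Qed.

Lemma nodes_shift t K : nodes_at n w t K -> nodes_at n w (t + pi / n%:R) K.
Proof. by move=> h m; rewrite -(h m.+1) -natr1; congr supp; ring. Qed.

Lemma supp_shift_pi K (t : R) (m : nat) : constant_width w K ->
  supp K (t + (m + n)%:R * (pi / n%:R)) = w - supp K (t + m%:R * (pi / n%:R)).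
Proof.
move=> wK; rewrite -(supp_width wK); congr supp.
by rewrite natrD mulrDl [n%:R * _]mulrC divfK// addrA.
Qed.

Lemma reuleaux_nodes_at t : nodes_at n w t (T t).
Proof. exact/(reuleaux_nodes n_ge3)/supp_centered_reuleaux. Qed.

Lemma reuleaux_measurable t : measurable (T t : set plane).
Proof.
have cT : compact (T t) by exact: reuleaux_compact.
have vT : convex_set (T t : set (convex_lmodType (R * R)%type)) by exact: reuleaux_convex.
have T0 : T t !=set0 by exact: reuleaux_neq0.
have wT : constant_width w (T t) by exact: reuleaux_width.
by have [] := area_limit n_ge3 w_gt0 cT vT T0 wT (reuleaux_nodes_at t).
Qed.

(** Let [y] be a support point at [a]. Its values at [a - b] and [a + b] are at most [w / 2], while
    their sum [2 rho cos b] is [w]; so both are equalities and [y] has no component orthogonal to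
    [polar a]. *)
Lemma vertex_of_supp K t j : compact K -> K !=set0 -> nodes_at n w t K ->
  supp K (t + (j.*2)%:R * (pi / n%:R)) = rho -> K (vertex n w 0 t j).
Proof.
move=> cK K0 nd; rewrite (_ : t + _ = t + 2 * pi * j%:R / n%:R); last first.
  by rewrite -mul2n natrM; field.
set a := t + _ => ha.
have b0 := half_angle_gt0 R n_ge3; have b1 := half_angle_le R n_ge3; have p0 := pi_gt0 R.
have sb : 0 < sin b by rewrite sin_gt0_pi//; lra.
have [y Ky [hy _]] := supp_attained (polar a) cK K0.
rewrite -/(supp K a) ha in hy.
have nb : pi / n%:R = 2 * b := half_angleE R n_ge3.
have h1 : dotp y (polar (a - b)) <= w / 2.
  rewrite -(nd j.*2) (_ : t - b + _ = a - b); first exact: supp_le.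
  have -> : j.*2%:R = 2 * j%:R :> R by rewrite -natrM mul2n.
  by rewrite nb /a /half_angle; field.
have h2 : dotp y (polar (a + b)) <= w / 2.
  rewrite -(nd j.*2.+1) (_ : t - b + _ = a + b); first exact: supp_le.
  have -> : (j.*2.+1)%:R = 2 * j%:R + 1 :> R by rewrite -natrM mul2n natr1.
  by rewrite nb /a /half_angle; field.
have e := polar_sum a b.
have : dotp y (polar (a - b) + polar (a + b)) = w.
  by rewrite e dotpZr hy; have := circumradius_cos w n_ge3; lra.
rewrite dotpDr => h3.
have h4 : dotp y (polar (a + b)) = w / 2 by lra.
have h5 : dotp y (polar (a + pi / 2)) = 0.
  have : dotp y (polar (a + b)) = rho * cos b + sin b * dotp y (polar (a + pi / 2)).
    by rewrite (polarD a b) dotpDr !dotpZr hy; ring.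
  rewrite h4 (circumradius_cos _ n_ge3) => h6.
  have : sin b * dotp y (polar (a + pi / 2)) = 0 by lra.
  by move/eqP; rewrite mulf_eq0 (gt_eqF sb) /= => /eqP.
have := polar_basis y a; rewrite hy h5 scale0r addr0 => yE.
by rewrite (vertexE n w 0 t j) add0r -/a -yE.
Qed.

Section Body.
Variables (K : set (R * R)) (t : R).
Hypotheses (bK : convex_body K) (wK : constant_width w K) (nK : nodes_at n w t K).

Let cK : compact K. Proof. by case: bK. Qed.
Let vK : convex_set (K : set (convex_lmodType (R * R)%type)). Proof. by case: bK. Qed.
Let K0 : K !=set0.
Proof. by case: bK => _ _ [x /interior_subset]; exists x. Qed.

Lemma area_reuleaux_le : (area (T t) <= area K)%E.
Proof.
apply: (reuleaux_area_le n_ge3 w_gt0 cK vK K0 wK nK).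
- exact: reuleaux_compact.
- exact: reuleaux_convex.
- exact: reuleaux_neq0.
- exact: reuleaux_width.
- exact: supp_centered_reuleaux.
Qed.

Hypothesis aK : (area K <= area (T t))%E.
Local Notation x m := (supp K (t + m%:R * (pi / n%:R))).

(** A smaller deviation at a midpoint would make the area strictly larger by [reuleaux_area_lt].
    Indices below [n] suffice, since half a turn replaces each value by its complement to [w]. *)
Let mid_abs m : `|x m - w / 2| = rho - w / 2.
Proof.
have small k : (k < n)%N -> `|x k - w / 2| = rho - w / 2.
  move=> kn; apply/eqP; rewrite eq_le; apply/andP; split.
    have := support_le_circumradius n_ge3 (supp_conv cK K0) (supp_width wK) nK k (s := 0).
    rewrite normr0 addr0 cos0 mulr1; apply.
    exact/ltW/half_angle_gt0.
  rewrite leNgt; apply/negP => lt.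
  have := @reuleaux_area_lt _ n w t n_ge3 w_gt0 K (T t) cK vK K0 wK nK _ _ _ _ _ k kn lt.
  rewrite ltNge aK; move=> H; suff : false by [].
  apply: H.
  - exact: reuleaux_compact.
  - exact: reuleaux_convex.
  - exact: reuleaux_neq0.
  - exact: reuleaux_width.
  - exact: supp_centered_reuleaux.
rewrite (divn_eq m n) addnC.
elim: (m %/ n)%N => [|q IH].
  by rewrite mul0n addn0 small// ltn_mod (leq_trans _ n_ge3).
rewrite mulSn addnCA addnC supp_shift_pi// -IH -normrN; congr (`|_|).
by lra.
Qed.

Let mid_cases m : x m = rho \/ x m = w - rho.
Proof.
have := mid_abs m; have [h|h] := leP 0 (x m - w / 2).
  by rewrite ger0_norm// => ?; left; lra.
by rewrite ltr0_norm// => ?; right; lra.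
Qed.

(* Two adjacent low midpoints would contradict the convexity of [K] at the node
   between them: it would give [w cos b <= 2 w - w / cos b]. *)
Let mid_low m : x m = w - rho -> x m.+1 = w - rho -> False.
Proof.
have b0 := half_angle_gt0 R n_ge3; have b1 := half_angle_le R n_ge3; have p0 := pi_gt0 R.
have cb := cos_half_angle R n_ge3.
have sb : 0 < sin b by rewrite sin_gt0_pi//; lra.
have sb2 : 0 <= sin (b + b) by rewrite sin_ge0_pi//; lra.
set u := t + m%:R * (pi / n%:R).
have nb := half_angleE R n_ge3.
have -> : t + m.+1%:R * (pi / n%:R) = u + (b + b) by rewrite /u -natr1 nb; ring.
move=> h1 h2.
have nu : supp K (u + b) = w / 2.
  by rewrite -(nK m.+1) -natr1 /u nb; congr supp; ring.
have := @supp_conv _ K cK K0 u (u + b) (u + (b + b)).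
rewrite (_ : u + (b + b) - (u + b) = b); last by ring.
rewrite (_ : u + b - u = b); last by ring.
rewrite (_ : u + (b + b) - u = b + b); last by ring.
rewrite h1 h2 nu => /(_ (ltW sb) (ltW sb) sb2).
rewrite sinD (_ : w / 2 * _ = w * cos b * sin b); last by field.
rewrite -mulrDl ler_pM2r// => h3.
have h4 := circumradius_cos w n_ge3.
have cb1 : cos b < 1.
  by rewrite -cos0 ltr_cos ?in_itv/= ?lexx ?ltW//; lra.
have : w * cos b * cos b <= (w - rho + (w - rho)) * cos b by rewrite ler_pM2r.
have : 0 < w * ((1 - cos b) * (1 - cos b)) by rewrite !mulr_gt0//; lra.
lra.
Qed.

Let mid_alt m : x m.+1 = w - x m.
Proof.
have [h1|h1] := mid_cases m; have [h2|h2] := mid_cases m.+1; rewrite h1 h2.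
(* Two adjacent high midpoints are two adjacent low ones [n] sectors, that is half a turn, later. *)
- exfalso; apply: (@mid_low (m + n)); first by rewrite supp_shift_pi// h1.
  by rewrite -addSn supp_shift_pi// h2.
- by [].
- by lra.
- by exfalso; apply: (@mid_low m).
Qed.

Let mid_double m k : x (k + m.*2) = x k.
Proof.
elim: m => [|m IH]; first by rewrite addn0.
by rewrite doubleS !addnS !mid_alt IH; lra.
Qed.

Lemma area_reuleaux_eq : K = T t \/ K = T (t + pi / n%:R).
Proof.
have [h|h] := mid_cases 0%N; [left|right].
  apply: reuleaux_eq => // j; apply: vertex_of_supp => //.
  by rewrite -h -[in RHS](mid_double j).
apply: reuleaux_eq => // j; apply: vertex_of_supp => //; first exact: nodes_shift.
have e : x 1 = rho by rewrite mid_alt h; lra.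
rewrite -e -[in RHS](mid_double j); congr supp.
by rewrite natrD; ring.
Qed.

End Body.

End Minimality.

(** * Finite groups of plane isometries *)

Section PlaneIsometries.
Variable R : realType.
Implicit Types (x y : R * R) (r s t a : R) (f g : R * R -> R * R) (G H : set (R * R -> R * R)).

Lemma rotationZ s r x : rotation s (r *: x) = r *: rotation s x.
Proof.
by apply: coord_eq; rewrite [RHS]coordE /rotation; cbn [fst snd]; rewrite !coordE; ring.
Qed.

Lemma rotation_polar s t : rotation s (polar t) = polar (t + s) :> R * R.
Proof. by rewrite /rotation /polar cosD sinD /=; congr pair; ring. Qed.

Lemma rotationD s t x : rotation s (rotation t x) = rotation (s + t) x.
Proof. by rewrite /rotation cosD sinD /=; congr pair; ring. Qed.

Lemma rotation0 x : rotation 0 x = x.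
Proof. by rewrite /rotation cos0 sin0 !mul1r !mul0r subr0 add0r -surjective_pairing. Qed.

Lemma rotationK s : cancel (rotation s) (rotation (- s) : R * R -> R * R).
Proof. by move=> x; rewrite rotationD addNr rotation0. Qed.

Lemma rotationNK s : cancel (rotation (- s)) (rotation s : R * R -> R * R).
Proof. by move=> x; rewrite rotationD subrr rotation0. Qed.

Lemma rotation_isometry s : Defs.isometry (rotation s : R * R -> R * R).
Proof.
move=> x y; rewrite /enorm; congr Num.sqrt.
rewrite /dotp /rotation !coordE; cbn [fst snd].
have e : cos s ^+ 2 + sin s ^+ 2 = 1 by exact: cos2Dsin2.
transitivity ((cos s ^+ 2 + sin s ^+ 2) * ((x.1 - y.1) * (x.1 - y.1) + (x.2 - y.2) * (x.2 - y.2))).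
  by ring.
by rewrite e mul1r.
Qed.

Lemma reflectionE a x : reflection (polar a) x =
  (cos (a + a) * x.1 + sin (a + a) * x.2, sin (a + a) * x.1 - cos (a + a) * x.2).
Proof.
rewrite cosD sinD /reflection /dotp.
have e : cos a * cos a + sin a * sin a = 1 by rewrite -!expr2 cos2Dsin2.
have e1 : x.1 = (cos a * cos a + sin a * sin a) * x.1 by rewrite e mul1r.
have e2 : x.2 = (cos a * cos a + sin a * sin a) * x.2 by rewrite e mul1r.
by apply: coord_eq; rewrite !coordE /polar; cbn [fst snd]; lra.
Qed.

Lemma reflection_polar a t : reflection (polar a) (polar t) = polar (a + a - t) :> R * R.
Proof. by rewrite reflectionE /polar /= cosB sinB; congr pair; ring. Qed.

Lemma reflectionZ a r x : reflection (polar a) (r *: x) = r *: reflection (polar a) x.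
Proof.
by apply: coord_eq; rewrite [RHS]coordE !reflectionE; cbn [fst snd]; rewrite !coordE; ring.
Qed.

Lemma rotation_reflection s a x :
  rotation s (reflection (polar a) x) = reflection (polar (a + s / 2)) x.
Proof.
rewrite !reflectionE (_ : a + s / 2 + (a + s / 2) = s + (a + a)); last by field.
by rewrite (cosD s) (sinD s) /rotation /=; congr pair; ring.
Qed.

Lemma reflection_reflection a s x :
  reflection (polar a) (reflection (polar s) x) = rotation (a + a - (s + s)) x.
Proof.
rewrite !reflectionE /rotation (cosB (a + a)) (sinB (a + a)) /=.
by congr pair; ring.
Qed.

Lemma reflectionK a : involutive (reflection (polar a) : R * R -> R * R).
Proof. by move=> x; rewrite reflection_reflection subrr rotation0. Qed.

Lemma reflection_isometry a : Defs.isometry (reflection (polar a) : R * R -> R * R).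
Proof.
move=> x y; rewrite /enorm; congr Num.sqrt.
rewrite /dotp !reflectionE !coordE; cbn [fst snd]; set s := a + a.
have e : cos s ^+ 2 + sin s ^+ 2 = 1 by exact: cos2Dsin2.
transitivity ((cos s ^+ 2 + sin s ^+ 2) * ((x.1 - y.1) * (x.1 - y.1) + (x.2 - y.2) * (x.2 - y.2))).
  by ring.
by rewrite e mul1r.
Qed.

Lemma isometry_enorm f x : Defs.isometry f -> f 0 = 0 -> enorm (f x) = enorm x.
Proof. by move=> fi f0; have := fi x 0; rewrite f0 !subr0. Qed.

Lemma isometry_dotp f x y : Defs.isometry f -> f 0 = 0 -> dotp (f x) (f y) = dotp x y.
Proof.
move=> fi f0; have := congr1 (fun r => r ^+ 2) (fi x y).
have := congr1 (fun r => r ^+ 2) (isometry_enorm x fi f0).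
have := congr1 (fun r => r ^+ 2) (isometry_enorm y fi f0).
rewrite /= !enorm_sqr !dotpBl !dotpBr (dotpC (f y) (f x)) (dotpC y x); lra.
Qed.

(** Inner products are preserved, so the orthonormal frame goes to [P] and plus or minus [Q], and
    [f] is linear in it; the sign separates rotations from reflections. *)
Lemma isometry_classification f : Defs.isometry f -> f 0 = 0 ->
  (exists a, f = rotation a) \/ (exists a, f = reflection (polar a)).
Proof.
move=> fi f0.
pose e1 : R * R := polar 0; pose e2 : R * R := polar (0 + pi / 2).
have d1 x : dotp x e1 = x.1 by rewrite /dotp /e1 /polar /= cos0 sin0; ring.
have d2 x : dotp x e2 = x.2.
  by rewrite /dotp /e2 /polar /= add0r cos_pihalf sin_pihalf; ring.
have [a fe1] : exists a, f e1 = polar a.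
  by apply: unit_polar; rewrite /unit_vector isometry_enorm// enorm_polar.
pose P : R * R := polar a; pose Q : R * R := polar (a + pi / 2).
have PQ : dotp P Q = 0.
  by rewrite dotp_polar opprD addrA subrr add0r cosN cos_pihalf.
have fe2 : f e2 = dotp (f e2) Q *: Q.
  have := polar_basis (f e2) a; rewrite -/P -/Q.
  by rewrite -[X in dotp _ X *: X]fe1 isometry_dotp// d1 /e2 /polar /= add0r cos_pihalf scale0r add0r.
have eps2 : dotp (f e2) Q ^+ 2 = 1.
  have : dotp (f e2) (f e2) = 1 by rewrite isometry_dotp// /e2 polar_sqr.
  by rewrite {1 2}fe2 dotpZl dotpZr polar_sqr mulr1 expr2.
have fE x : f x = x.1 *: P + (dotp (f e2) Q * x.2) *: Q.
  rewrite [LHS](polar_basis (f x) a) -/P -/Q; congr (_ *: _ + _ *: _).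
    by rewrite /P -fe1 isometry_dotp// d1.
  have : dotp (f x) (f e2) = x.2 by rewrite isometry_dotp// d2.
  rewrite {1}fe2 dotpZr => <-.
  by rewrite mulrA -expr2 eps2 mul1r.
have : (dotp (f e2) Q == 1) || (dotp (f e2) Q == -1) by rewrite -sqrf_eq1 eps2.
case/orP => /eqP eps; [left; exists a|right; exists (a / 2)]; apply/funext => x.
  rewrite fE eps; apply: coord_eq; rewrite !coordE /rotation /P /Q /polar /= ?cosDpihalf ?sinDpihalf;
  by ring.
rewrite fE eps reflectionE (_ : a / 2 + a / 2 = a); last by field.
by apply: coord_eq; rewrite !coordE /P /Q /polar /= ?cosDpihalf ?sinDpihalf; ring.
Qed.

Lemma rotation_eq a s : (rotation a : R * R -> R * R) = rotation s -> cos (a - s) = 1.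
Proof.
move=> /(congr1 (fun f => f (polar 0))); rewrite !rotation_polar !add0r => e.
by rewrite -dotp_polar e polar_sqr.
Qed.

Lemma cos_eq1 a : `|a| < 2 * pi -> cos a = 1 -> a = 0.
Proof.
move=> ab ca; apply/eqP; apply: contraT => a0.
have p0 := pi_gt0 R.
have : 0 < sin (`|a| / 2) by rewrite sin_gt0_pi// divr_gt0 ?normr_gt0//=; lra.
have : cos `|a| = 1 by rewrite cos_norm.
rewrite {1}(_ : `|a| = `|a| / 2 + `|a| / 2); last by lra.
rewrite cosD -!expr2 cos2sin2 => h s0.
have : 0 < sin (`|a| / 2) ^+ 2 by rewrite exprn_gt0.
lra.
Qed.

Section Group.
Variable G : set (R * R -> R * R).
Hypotheses (Ggroup : isometry_group G).

Lemma group_rotationN a : G (rotation a) -> G (rotation (- a)).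
Proof.
move=> Ga; case: Ggroup => _ _ _ /(_ _ Ga)[g Gg [h1 h2]].
suff <- : g = rotation (- a) by [].
apply/funext => x; rewrite -[in LHS](rotationNK a x).
by have := congr1 (fun f => f (rotation (- a) x)) h2.
Qed.

Lemma group_rotationD a s : G (rotation a) -> G (rotation s) -> G (rotation (a + s)).
Proof.
move=> Ga Gs; case: Ggroup => _ _ /(_ _ _ Ga Gs) + _; congr G.
by apply/funext => x /=; rewrite rotationD.
Qed.

Lemma group_rotation0 : G (rotation 0).
Proof.
by case: Ggroup => _ + _ _; congr G; apply/funext => x; rewrite rotation0.
Qed.

Lemma group_rotation_nat a (k : nat) : G (rotation a) -> G (rotation (k%:R * a)).
Proof.
move=> Ga; elim: k => [|k IH]; first by rewrite mul0r; exact: group_rotation0.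
by rewrite -natr1 mulrDl mul1r; exact: group_rotationD.
Qed.

Lemma group_rotation_int a (z : int) : G (rotation a) -> G (rotation (z%:~R * a)).
Proof.
move=> Ga; case: z => k; first exact: group_rotation_nat.
rewrite NegzE mulrNz mulNr; apply: group_rotationN; exact: (group_rotation_nat k.+1).
Qed.

End Group.

Lemma seq_min (s : seq R) : s != [::] -> exists2 m, m \in s & forall y : R, y \in s -> m <= y.
Proof.
elim: s => // x s IH _; have [->|/IH[m ms mP]] := eqVneq s [::].
  by exists x; rewrite ?inE// => y; rewrite inE => /eqP->.
have [xm|mx] := leP x m.
  exists x; first by rewrite inE eqxx.
  by move=> y; rewrite inE => /orP[/eqP->//|/mP]; exact: le_trans.
exists m; first by rewrite inE ms orbT.
by move=> y; rewrite inE => /orP[/eqP->|/mP//]; exact: ltW.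
Qed.

Lemma sub_generated (A : set (R * R -> R * R)) f : A f -> generated_group A f.
Proof. by move=> Af H [_ AH]; exact: AH. Qed.

Lemma generated_min (A : set (R * R -> R * R)) G : isometry_group G -> A `<=` G ->
  generated_group A `<=` G.
Proof. by move=> gG AG f; apply. Qed.

(** The least angle [d] in []0, 2 pi]] of a rotation in [G] generates all its rotations, and it
    divides [2 pi], which gives [n]. The value [n = 1] stands for a group without nontrivial
    rotations. *)
Lemma group_classification G : isometry_group G -> fixes_origin G -> finite_set G ->
  exists n : nat, [/\ (0 < n)%N, G (rotation (2 * pi / n%:R)),
    forall a, G (rotation a) -> exists z : int, a = z%:~R * (2 * pi / n%:R) &
    ((forall f, G f -> exists a, f = rotation a) /\ G = cyclic_group n) \/
    exists a, G = dihedral_group n (polar a)].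
Proof.
move=> Gg Gfix Gfin.
have p0 := pi_gt0 R.
pose S := [set a : R | [/\ 0 < a, a <= 2 * pi & G (rotation a)]].
have Suniq a s : S a -> S s -> (rotation a : R * R -> R * R) = rotation s -> a = s.
  move=> [a1 a2 _] [s1 s2 _] /rotation_eq /(cos_eq1 _) h.
  by apply/eqP; rewrite -subr_eq0; apply/eqP; apply: h; rewrite ltr_norml; apply/andP; split; lra.
have Sfin : finite_set S.
  (* Recovers the angle in [S] of a rotation, unique by [Suniq], so that [S] is covered by an image
     of the finite [G]; where there is no such angle the value is the default [0]. *)
  pose F (f : R * R -> R * R) : R := xget 0 [set a | S a /\ f = rotation a].
  apply: (@sub_finite_set _ _ (F @` G)); last exact: finite_image.
  move=> a Sa; exists (rotation a); first by case: Sa.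
  rewrite /F; case: xgetP => [s _ [Ss e]|/(_ a)[]//].
  by apply: Suniq => //; rewrite e.
have S2pi : S (2 * pi).
  split; [lra|by []|].
  have := group_rotation0 Gg; congr G; apply/funext => x.
  by rewrite /rotation -[2 * pi]add0r mulr_natl cosD2pi sinD2pi.
have /finite_seqP[q Sq] := Sfin.
have q0 : q != [::].
  by apply/eqP => qe; move: S2pi; rewrite Sq qe.
have [d dq dmin] := seq_min q0.
have {dq} [d0 d2 Gd] : S d by rewrite Sq.
have {dmin} dmin a : S a -> d <= a by rewrite Sq; exact: dmin.
have mult a : G (rotation a) -> exists z : int, a = z%:~R * d.
  (* Division with remainder: a nonzero remainder would be an element of [S] below [d]. *)
  move=> Ga; pose z := Num.floor (a / d); exists z.
  have /andP[h1 h2] : z%:~R <= a / d < (z + 1)%:~R by exact: Num.Theory.floor_itv.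
  rewrite ler_pdivlMr// in h1; rewrite ltr_pdivrMr// intrD mulrDl mul1r in h2.
  apply/eqP; rewrite -subr_eq0; apply: contraT => e0.
  have Gr : G (rotation (a - z%:~R * d)).
    apply: group_rotationD => //; rewrite -mulNr -mulrNz.
    exact: group_rotation_int.
  have : d <= a - z%:~R * d.
    apply: dmin; split=> //; last by lra.
    by rewrite lt_neqAle eq_sym e0 subr_ge0.
  lra.
have [z zE] : exists z : int, 2 * pi = z%:~R * d by apply: mult; case: S2pi.
have [n nE] : exists n : nat, 2 * pi = n%:R * d.
  case: z zE => k kE; first by exists k.
  exfalso; have : 0 < 2 * pi :> R by lra.
  by rewrite kE NegzE mulrNz mulNr oppr_gt0 ltNge mulr_ge0 ?ler0z ?(ltW d0).
have n0 : (0 < n)%N.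
  rewrite lt0n; apply/eqP => n0; move: nE; rewrite n0 mul0r; lra.
have dE : d = 2 * pi / n%:R.
  by rewrite nE mulrAC divff ?mul1r// pnatr_eq0 -lt0n.
exists n; rewrite -dE; split=> //.
have [[a Ga]|noref] := pselect (exists a, G (reflection (polar a))).
  right; exists a; rewrite /dihedral_group -dE; apply/seteqP; split; last first.
    by apply: generated_min => // f [->|->].
  move=> f Gf H [Hg AH].
  have Hd : H (rotation d) by apply: AH; left.
  have Ha : H (reflection (polar a)) by apply: AH; right.
  have Hrot s : G (rotation s) -> H (rotation s).
    by move=> /mult[k ->]; exact: group_rotation_int.
  have [fi _ _ _] := Gg.
  have [[s fE]|[s fE]] := isometry_classification (fi _ Gf) (Gfix _ Gf).
    by rewrite fE; apply: Hrot; rewrite -fE.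
  (* A reflection in [G] followed or preceded by the fixed one is a rotation in [G], already known
     to lie in [H]. *)
  have Gs : G (rotation (s + s - (a + a))).
    have [_ _ Gc _] := Gg; have := Gc _ _ Gf Ga; congr G; rewrite fE.
    by apply/funext => x /=; rewrite reflection_reflection.
  have [_ _ Hc _] := Hg; have := Hc _ _ (Hrot _ Gs) Ha; congr H; rewrite fE.
  apply/funext => x /=; rewrite rotation_reflection; congr (reflection (polar _) x).
  by field.
left.
have rots f : G f -> exists a, f = rotation a.
  have [fi _ _ _] := Gg => Gf.
  have [//|[s fE]] := isometry_classification (fi _ Gf) (Gfix _ Gf).
  by exfalso; apply: noref; exists s; rewrite -fE.
split=> //; rewrite /cyclic_group -dE; apply/seteqP; split; last first.
  by apply: generated_min => // f ->.
move=> f Gf H [Hg AH].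
have Hd : H (rotation d) by exact: AH.
have [s fE] := rots _ Gf.
have [k ke] : exists z : int, s = z%:~R * d by apply: mult; rewrite -fE.
by rewrite fE ke; exact: group_rotation_int.
Qed.

Definition invertible_isometry f :=
  Defs.isometry f /\ exists g, [/\ Defs.isometry g, f \o g = id & g \o f = id].

Lemma rotation_invertible a : invertible_isometry (rotation a).
Proof.
split; first exact: rotation_isometry.
exists (rotation (- a)); split; first exact: rotation_isometry.
  by apply/funext => x /=; rewrite rotationNK.
by apply/funext => x /=; rewrite rotationK.
Qed.

Lemma reflection_invertible a : invertible_isometry (reflection (polar a)).
Proof.
split; first exact: reflection_isometry.
exists (reflection (polar a)); split; first exact: reflection_isometry.
  by apply/funext => x /=; rewrite reflectionK.
by apply/funext => x /=; rewrite reflectionK.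
Qed.

(** The stabilizer of [K] among the invertible isometries is an isometry group containing [A]. *)
Lemma invariant_generated (A : set (R * R -> R * R)) (K : set (R * R)) :
  A `<=` invertible_isometry -> (forall f, A f -> f @` K = K) ->
  invariant_under (generated_group A) K.
Proof.
move=> Ai AK f Gf.
pose H := [set f | [/\ Defs.isometry f, f @` K = K & exists g,
  [/\ Defs.isometry g, g @` K = K, f \o g = id & g \o f = id]]].
suff : H f by case.
apply: Gf; split; last first.
  move=> g Ag; have [gi [g' [gi' e1 e2]]] := Ai _ Ag.
  split=> //; first exact: AK.
  exists g'; split=> //; rewrite -{1}(AK _ Ag) image_comp e2.
  by rewrite image_id.
split.
- by move=> g [].
- split=> //; first by rewrite image_id.
  by exists id; split=> //; rewrite image_id.
- move=> g h [gi gK [g' [gi' gK' e1 e2]]] [hi hK [h' [hi' hK' e3 e4]]]; split.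
  + by move=> x y /=; rewrite gi hi.
  + by rewrite -image_comp hK.
  + exists (h' \o g'); split.
    * by move=> x y /=; rewrite hi' gi'.
    * by rewrite -image_comp gK'.
    * apply/funext => x /=.
      have := congr1 (fun F => F (g' x)) e3; rewrite /= => ->.
      by have := congr1 (fun F => F x) e1.
    * apply/funext => x /=.
      have := congr1 (fun F => F (h x)) e2; rewrite /= => ->.
      by have := congr1 (fun F => F x) e4.
- move=> g [gi gK [g' [gi' gK' e1 e2]]]; exists g' => //.
  by split=> //; exists g.
Qed.

End PlaneIsometries.

(** * Symmetric bodies *)

Section Symmetry.
Variable R : realType.
Implicit Types (K L : set (R * R)) (t s a : R) (c : R * R).
Local Notation plane := (measurableTypeR R * measurableTypeR R)%type.

Lemma image_ball_intersection (I : Type) (V : I -> R * R) (r : R) f :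
  invertible_isometry f ->
  f @` ball_intersection V r = ball_intersection (f \o V) r.
Proof.
move=> [fi [g [gi fg gf]]]; apply/seteqP; split => y.
  by move=> [x Bx <-] i /=; rewrite fi.
have fgy : f (g y) = y := congr1 (fun h => h y) fg.
by move=> By; exists (g y) => // i; rewrite -fi fgy; exact: By.
Qed.

Lemma ball_intersection_sub (I J : Type) (V : I -> R * R) (V' : J -> R * R) (r : R) :
  (forall j, exists i, V' j = V i) -> ball_intersection V r `<=` ball_intersection V' r.
Proof. by move=> VV x Bx j; have [i ->] := VV j; exact: Bx. Qed.

Lemma convex_body_neq0 K : convex_body K -> K !=set0.
Proof. by case=> _ _ [x /interior_subset]; exists x. Qed.

Lemma supp_rotation K s t : compact K -> K !=set0 -> rotation s @` K = K ->
  supp K (t + s) = supp K t.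
Proof.
move=> cK K0 KE; rewrite /supp; apply/eqP; rewrite eq_le addrC; apply/andP; split.
  have [x Kx [<- _]] := supp_attained (polar (s + t)) cK K0.
  by move: Kx; rewrite -{1}KE => -[y Ky <-]; rewrite dotp_rotation; exact: supp_le.
have [x Kx [<- _]] := supp_attained (polar t) cK K0.
by rewrite -(dotp_rotation x s); apply: supp_le => //; rewrite -KE; exists x.
Qed.

Definition translate c K : set (R * R) := [set x | K (x + c)].

Section Translate.
Variables (c : R * R) (K : set (R * R)).

Lemma translate_image : translate c K = (fun x => x - c) @` K.
Proof.
apply/seteqP; split => x; first by move=> Kx; exists (x + c) => //; rewrite addrK.
by move=> [y Ky <-]; rewrite /translate /= subrK.
Qed.

Lemma translate_convex_body : convex_body K -> convex_body (translate c K).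
Proof.
move=> [cK vK [x0 Kx0]]; split.
- rewrite translate_image; apply: continuous_compact => //.
  by apply: continuous_subspaceT => x; apply: cvgB; [exact: cvg_id|exact: cvg_cst].
- apply/convex_setP => x y l l0 l1 Kx Ky; rewrite /translate /=.
  have -> : l *: x + (1 - l) *: y + c = l *: (x + c) + (1 - l) *: (y + c).
    by apply: coord_eq; rewrite !coordE; ring.
  by move/convex_setP: vK; apply.
- exists (x0 - c).
  have cf : {for x0 - c, continuous (fun x : R * R => x + c)}.
    by apply: cvgD; [exact: cvg_id|exact: cvg_cst].
  by apply: cf; rewrite subrK.
Qed.

Lemma supp_translate t : convex_body K ->
  supp (translate c K) t = supp K t - dotp c (polar t).
Proof.
move=> bK; have [cK' _ _] := translate_convex_body bK.
have [cK _ _] := bK.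
have [x Kx [hx xmax]] := supp_attained (polar t) cK (convex_body_neq0 bK).
rewrite /supp -hx -dotpBl; apply: supp_eq => //.
  by rewrite /translate /= subrK.
by move=> y Ky; rewrite dotpBl lerBrDr -dotpDl; exact: xmax.
Qed.

Lemma translate_width w : convex_body K -> constant_width w K ->
  constant_width w (translate c K).
Proof.
move=> bK wK u /unit_polar[t ->]; rewrite -polarDpi -!/(supp _ _) !supp_translate//.
by rewrite (supp_width wK) polarDpi dotpNr; ring.
Qed.

End Translate.

Lemma translateNK c K : translate (- c) (translate c K) = K.
Proof. by apply/seteqP; split => x; rewrite /translate /= subrK. Qed.

Lemma translate_reuleaux n (w : R) c t :
  translate (- c) (reuleaux n w 0 t) = reuleaux n w c t.
Proof.
apply/seteqP; split => x Tx j; have := Tx j;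
  by rewrite !(vertexE n w) add0r opprD addrA.
Qed.

(** * Symmetries of centered Reuleaux polygons and minimality under rotations of odd order *)

Section OddSymmetry.
Variables (n : nat) (w : R).
Hypotheses (n_ge3 : (3 <= n)%N) (n_odd : odd n) (w_gt0 : 0 < w).
Local Notation b := (half_angle R n).
Local Notation rho := (circumradius n w).
Local Notation T t := (reuleaux n w 0 t).

Let nn : n%:R != 0 :> R.
Proof. by rewrite pnatr_eq0 -lt0n (leq_trans _ n_ge3). Qed.

Let vE t j : vertex n w 0 t j = rho *: polar (t + 2 * pi * j%:R / n%:R).
Proof. by rewrite (vertexE n w 0 t j) add0r. Qed.

Lemma reuleaux_centeredP K : centered_regular_reuleaux n w K <-> exists t, K = T t.
Proof.
by split => -[t ->]; exists t; rewrite (enclosed_reuleaux 0 t n_ge3 n_odd w_gt0).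
Qed.

Lemma reuleaux_shift t (k : nat) : T (t + k%:R * (2 * pi / n%:R)) = T t.
Proof.
have vk j : vertex n w 0 (t + k%:R * (2 * pi / n%:R)) j = vertex n w 0 t (j + k)%N.
  by rewrite !vE natrD; congr (_ *: polar _); field.
have per j : vertex n w 0 t (j + k * n)%N = vertex n w 0 t j.
  by rewrite (vertex_mod _ _ _ n_ge3) addnC modnMDl -(vertex_mod _ _ _ n_ge3).
apply/seteqP; split; apply: ball_intersection_sub => j.
  (* The index [j - k], raised by a multiple of [n] so that the truncated subtraction is exact. *)
  exists (j + k * n - k)%N; rewrite vk subnK ?per//.
  by rewrite (leq_trans _ (leq_addl _ _))// leq_pmulr// (leq_trans _ n_ge3).
by exists (j + k)%N; rewrite vk.
Qed.

Lemma rotation_reuleaux t s : rotation s @` T t = T (t + s).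
Proof.
rewrite /reuleaux image_ball_intersection; last exact: rotation_invertible.
congr ball_intersection; apply/funext => j /=; rewrite !vE rotationZ rotation_polar.
by congr (_ *: polar _); ring.
Qed.

Lemma reflection_reuleaux t a : reflection (polar a) @` T t = T (a + a - t).
Proof.
rewrite /reuleaux image_ball_intersection; last exact: reflection_invertible.
have per (s : R) (m : nat) : polar (s + m%:R * (2 * pi)) = polar s :> R * R.
  elim: m => [|m IH]; first by rewrite mul0r addr0.
  by rewrite -IH -[RHS]polarD2pi -natr1; congr polar; ring.
(* The reflection sends index [j] to [- j] modulo [n]; the hypothesis says that [n] divides
   [j + k]. *)
have key j k : (k + j = (j + k) %/ n * n)%N ->
    (reflection (polar a) \o vertex n w 0 t) j = vertex n w 0 (a + a - t) k.
  move=> jk /=; rewrite !vE reflectionZ reflection_polar; congr (_ *: _).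
  have e : k%:R + j%:R = ((j + k) %/ n)%:R * n%:R :> R by rewrite -natrD jk natrM.
  rewrite -(per _ ((j + k) %/ n)%N); congr polar.
  have {}e : k%:R = ((j + k) %/ n)%:R * n%:R - j%:R :> R by rewrite -e; ring.
  by rewrite e; field.
have ex j : exists k, (k + j = (j + k) %/ n * n)%N.
  exists (j * n - j)%N; rewrite subnK ?leq_pmulr ?(leq_trans _ n_ge3)//.
  by rewrite subnKC ?leq_pmulr ?(leq_trans _ n_ge3)// mulnK// (leq_trans _ n_ge3).
apply/seteqP; split; apply: ball_intersection_sub => j.
  have [k jk] := ex j; exists k; apply/esym/key.
  by rewrite addnC {1}jk addnC.
by have [k jk] := ex j; exists k; exact: key.
Qed.

(** The support function reaches the value [rho] only in vertex directions: it is [rho * cos s] in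
    even sectors and at most [w / 2] in odd ones. *)
Lemma reuleaux_eq_angle t t' : T t = T t' ->
  exists j q : nat, t' + j%:R * (2 * pi) = t + q%:R * (2 * pi / n%:R).
Proof.
move=> TE; have b0 := half_angle_gt0 R n_ge3; have b1 := half_angle_le R n_ge3.
have p0 := pi_gt0 R; have r0 := circumradius_gt0 n_ge3 w_gt0.
have cb := cos_half_angle R n_ge3.
have [m [j [s [sb E]]]] := angle_decomp t n_ge3 t'.
have wT u : constant_width w (T u) by exact: reuleaux_width.
have h1 : supp (T t') t' = rho.
  have := @supp_centered_reuleaux R n w n_ge3 n_odd w_gt0 t' 0%N 0.
  by rewrite mul0r !addr0 cos0 mulr1; apply; rewrite normr0 ltW.
have := supp_perM j t' (wT t); rewrite E TE -TE => h2.
have := @supp_centered_reuleaux R n w n_ge3 n_odd w_gt0 t m s sb.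
rewrite h2 TE h1; clear TE h2; have cs := circumradius_cos_ge n_ge3 w_gt0 sb.
have cb1 : rho * cos b < rho.
  rewrite -[ltRHS]mulr1 ltr_pM2l// -cos0 ltr_cos ?in_itv/= ?lexx ?ltW//; lra.
rewrite (circumradius_cos _ n_ge3) in cb1.
case: ifP => om h3; first by exfalso; lra.
have cs1 : cos s = 1.
  by apply: (mulfI (lt0r_neq0 r0)); rewrite -h3 mulr1.
have s0 : s = 0.
  by apply: cos_eq1 => //; apply: (le_lt_trans sb); lra.
exists j, m./2; rewrite E s0 addr0; congr (_ + _).
have -> : m%:R = m./2%:R * 2 :> R.
  by rewrite -natrM muln2; congr (_%:R); rewrite -[LHS]odd_double_half om.
by ring.
Qed.

Lemma area_reuleaux_const t t' : area (T t) = area (T t').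
Proof.
have mT := reuleaux_measurable n_ge3 n_odd w_gt0 t'.
rewrite -(area_rotation (t' - t) mT); congr area.
have TE : T t' = rotation (t' - t) @` T t by rewrite rotation_reuleaux; congr reuleaux; ring.
rewrite TE; apply/seteqP; split => x /=; first by move=> Tx; exists x.
by move=> [y Ty /(congr1 (rotation (- (t' - t))))]; rewrite !rotationK => <-.
Qed.

Lemma reuleaux_body t : convex_body (T t).
Proof. exact: reuleaux_convex_body. Qed.

(** For odd [n], [pi / n] plus [(n - 1) / 2] rotations by [2 pi / n] is a half turn, so
    [supp K - w / 2] changes sign over each step [pi / n], and one zero gives all nodes. *)
Lemma cyclic_nodes K : convex_body K -> constant_width w K ->
  rotation (2 * pi / n%:R) @` K = K -> exists t, nodes_at n w t K.
Proof.
move=> bK wK rK; have [cK _ _] := bK; have K0 := convex_body_neq0 bK.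
have p0 := pi_gt0 R.
have rot u (k : nat) : supp K (u + k%:R * (2 * pi / n%:R)) = supp K u.
  elim: k => [|k IH]; first by rewrite mul0r addr0.
  by rewrite -IH -[RHS](supp_rotation _ cK K0 rK) -natr1; congr supp; ring.
have anti u : supp K (u + pi / n%:R) = w - supp K u.
  rewrite -(supp_width wK) -[LHS](rot _ n./2); congr supp.
  have : n%:R = n./2%:R * 2 + 1 :> R.
    by rewrite -natrM muln2 natr1 -add1n -{1}[n]odd_double_half n_odd.
  move=> e; have -> : n./2%:R = (n%:R - 1) / 2 :> R by rewrite e; field.
  by field.
have [y y0] := @antiperiodic_zero R (fun u => supp K u - w / 2) (pi / n%:R)
  ltac:(by rewrite divr_ge0// ltW) ltac:(by move=> u; apply: cvgB; [exact: supp_continuous|exact: cvg_cst])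
  ltac:(by move=> u; rewrite /= anti; lra).
exists (y + b); elim=> [|m IH]; first by rewrite mul0r addr0 addrK; lra.
rewrite -natr1 mulrDl mul1r addrA anti IH; lra.
Qed.

(** All centered Reuleaux [n]-gons have the same area, so a single [G]-invariant one, [T t0], caps
    the area of every minimizer and brings it into the equality case. *)
Lemma symmetric_minimizer G t0 : G (rotation (2 * pi / n%:R)) ->
  invariant_under G (T t0) ->
  forall K, minimizer G w K <-> (exists t, K = T t) /\ invariant_under G K.
Proof.
move=> Grot iT0 K.
have wT u : constant_width w (T u) by exact: reuleaux_width.
split.
  move=> [[bK wK iK] Kmin]; split=> //.
  have [t nt] := cyclic_nodes bK wK (iK _ Grot).
  have aK : (area K <= area (T t))%E.
    by rewrite (area_reuleaux_const t t0); apply: Kmin; split=> //; exact: reuleaux_body.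
  have [->|->] := area_reuleaux_eq n_ge3 n_odd w_gt0 bK wK nt aK; first by exists t.
  by exists (t + pi / n%:R).
move=> [[t ->] iT]; split; first by split=> //; exact: reuleaux_body.
move=> L [bL wL iL]; have [s ns] := cyclic_nodes bL wL (iL _ Grot).
by rewrite (area_reuleaux_const t s); exact: area_reuleaux_le.
Qed.

End OddSymmetry.

(** * The Blaschke-Lebesgue theorem with its equality case *)

Section Triangle.
Variable w : R.
Hypothesis w_gt0 : 0 < w.

(* The alternating sum [f] of [g] over the three directions is invariant under
   translations and antiperiodic with antiperiod [pi / 3]; at a zero of [f], a
   translation that kills [g] at two of the directions kills it at the third. *)
Lemma hexagon_translate K : convex_body K -> constant_width w K ->
  exists c t, nodes_at 3 w t (translate c K).
Proof.
move=> bK wK; have [cK _ _] := bK; have K0 := convex_body_neq0 bK.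
have p0 := pi_gt0 R; have c3 := cos_pi3 R.
have s3 : 0 < sin (pi / 3) :> R by rewrite sin_gt0_pi//; lra.
pose g u := supp K u - w / 2.
have gpi u : g (u + pi) = - g u by rewrite /g (supp_width wK); lra.
have cg : continuous g.
  by move=> u; apply: cvgB; [exact: supp_continuous|exact: cvg_cst].
pose f u := g u - g (u + pi / 3) + g (u + (pi / 3 + pi / 3)).
have [y fy] : exists y, f y = 0.
  apply: (@antiperiodic_zero R f (pi / 3)); first by rewrite divr_ge0// ltW.
    have cs (v : R) : continuous (fun u => g (u + v)).
      move=> u; apply: (@continuous_comp _ _ _ (fun u => u + v) g); last exact: cg.
      by apply: cvgD; [exact: cvg_id|exact: cvg_cst].
    move=> u; apply: cvgD; last exact: cs.
    by apply: cvgB; [exact: cg|exact: cs].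
  move=> u; rewrite /f.
  have -> : u + pi / 3 + pi / 3 = u + (pi / 3 + pi / 3) by ring.
  have -> : u + pi / 3 + (pi / 3 + pi / 3) = u + pi by field.
  by rewrite gpi; ring.
(* The solution of two linear equations: the inner products of [c] with the directions [y] and
   [y + pi / 3] are the values of [g] there. *)
pose c := g y *: polar y + ((g (y + pi / 3) - g y * cos (pi / 3)) / sin (pi / 3)) *: polar (y + pi / 2).
have yy : dotp (polar (y + pi / 2)) (polar y) = 0.
  by rewrite dotp_polar addrAC subrr add0r cos_pihalf.
have c0 : dotp c (polar y) = g y.
  by rewrite /c dotpDl !dotpZl polar_sqr yy; ring.
have c1 : dotp c (polar (y + pi / 3)) = g (y + pi / 3).
  rewrite (polarD y (pi / 3)) dotpDr !dotpZr c0.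
  rewrite {1}/c dotpDl !dotpZl polar_sqr (dotpC (polar y)) yy.
  by field; rewrite gt_eqF.
(* As [2 cos (pi / 3) = 1], the third direction is the second minus the first, and [f y = 0] is the
   same relation for [g]. *)
have c2 : dotp c (polar (y + (pi / 3 + pi / 3))) = g (y + (pi / 3 + pi / 3)).
  have := polar_sum (y + pi / 3) (pi / 3); rewrite addrK c3.
  have -> : y + pi / 3 + pi / 3 = y + (pi / 3 + pi / 3) by ring.
  move=> e.
  have -> : polar (y + (pi / 3 + pi / 3)) = polar (y + pi / 3) - polar y :> R * R.
    rewrite (_ : polar (y + pi / 3) = (2 * (1 / 2)) *: polar (y + pi / 3)); last first.
      by rewrite (_ : 2 * (1 / 2) = 1 :> R) ?scale1r//; field.
    by rewrite -e addrAC subrr add0r.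
  by rewrite dotpBr c0 c1; move: fy; rewrite /f; lra.
have wK' : constant_width w (translate c K) by exact: translate_width.
(* The half angle cancels the offset in [nodes_at], so the first node is [y]. *)
exists c, (y + half_angle R 3); move=> m; rewrite addrK.
have h u : dotp c (polar u) = g u -> supp (translate c K) u = w / 2.
  by move=> e; rewrite supp_translate// e /g; lra.
have step u : supp (translate c K) u = w / 2 -> supp (translate c K) (u + pi) = w / 2.
  by move=> e; rewrite (supp_width wK') e; lra.
rewrite (divn_eq m 3); elim: (m %/ 3)%N => [|q IH].
  rewrite mul0n add0n; have : (m %% 3 < 3)%N by rewrite ltn_mod.
  case: (m %% 3)%N => [|[|[|//]]] _; apply: h.
  - by rewrite mul0r addr0.
  - by rewrite mul1r.
  - by rewrite (_ : 2 * (pi / 3) = pi / 3 + pi / 3) //; ring.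
have <- := step _ IH; congr supp.
by rewrite mulSn -addnA [in LHS]natrD; field.
Qed.

Lemma area_reuleaux_translate K : convex_body K -> constant_width w K ->
  (area (reuleaux 3 w 0%R 0%R) <= area K)%E /\
  ((area K <= area (reuleaux 3 w 0%R 0%R))%E -> exists c t, K = reuleaux 3 w c t).
Proof.
move=> bK wK; have [c [t nt]] := hexagon_translate bK wK.
have bK' := translate_convex_body c bK; have wK' := translate_width c bK wK.
have [cK' vK' _] := bK'; have K0' := convex_body_neq0 bK'.
have [mK' _ _] := area_limit (n := 3) isT w_gt0 cK' vK' K0' wK' nt.
have aE : area K = area (translate c K).
  by rewrite -[in LHS](translateNK c K); exact: area_translate.
have rE := @area_reuleaux_const 3 w isT isT w_gt0.
split; first by rewrite aE (rE 0 t); exact: area_reuleaux_le.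
rewrite aE (rE 0 t) => aK.
have [e|e] := area_reuleaux_eq (n := 3) isT isT w_gt0 bK' wK' nt aK; exists c.
  by exists t; rewrite -translate_reuleaux -e translateNK.
by exists (t + pi / 3); rewrite -translate_reuleaux -e translateNK.
Qed.

Lemma area_reuleaux_center c t : area (reuleaux 3 w c t) = area (reuleaux 3 w 0 0).
Proof.
rewrite -(@area_reuleaux_const 3 w isT isT w_gt0 t) -translate_reuleaux.
by apply: area_translate; exact: reuleaux_measurable.
Qed.

End Triangle.

End Symmetry.

(** * The four cases of the classification *)

Section Cases.
Variable R : realType.
Implicit Types (K L : set (R * R)) (G : set (R * R -> R * R)).

Lemma rotation_2pi : rotation (2 * pi / 1%:R) = id :> (R * R -> R * R).
Proof.
apply/funext => x; rewrite divr1 -[RHS]rotation0.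
by rewrite /rotation -[2 * pi]add0r mulr_natl cosD2pi sinD2pi.
Qed.

Lemma dihedral_invariant n (a : R) K : rotation (2 * pi / n%:R) @` K = K ->
  reflection (polar a) @` K = K -> invariant_under (dihedral_group n (polar a)) K.
Proof.
move=> rK sK; apply: invariant_generated.
  move=> f [->|->]; first exact: rotation_invertible.
  exact: reflection_invertible.
by move=> f [->|->].
Qed.

Lemma cyclic_invariant n K : rotation (2 * pi / n%:R) @` K = K ->
  invariant_under (@cyclic_group R n) K.
Proof.
by move=> rK; apply: invariant_generated => f ->//; exact: rotation_invertible.
Qed.

Lemma half_turn_iff G : isometry_group G -> fixes_origin G -> finite_set G ->
  G (rotation pi) <-> exists n, [/\ (2 <= n)%N, ~~ odd n &
    G = cyclic_group n \/ exists2 u, unit_vector u & G = dihedral_group n u].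
Proof.
move=> Gg Gfix Gfin; have p0 := pi_gt0 R; split.
  move=> Gpi; have [n [n0 Gn mult cases]] := group_classification Gg Gfix Gfin.
  have [z zE] := mult _ Gpi.
  (* Read off from [pi = z * (2 * pi / n)]. *)
  have nz : n%:Z = z * 2.
    apply/eqP; rewrite -(eqr_int R) intrM; apply/eqP.
    have n0' : n%:R != 0 :> R by rewrite pnatr_eq0 -lt0n.
    apply: (mulfI (lt0r_neq0 p0)).
    by rewrite [in LHS]zE; field.
  have ev : ~~ odd n.
    have -> : n = (`|z| * 2)%N by rewrite -[LHS]/(`|n%:Z|%N) nz abszM.
    by rewrite muln2 odd_double.
  exists n; split=> //; first by case: (n) n0 ev => [|[|]].
  case: cases => [[_ ->]|[a ->]]; [by left|right].
  by exists (polar a) => //; exact: unit_vector_polar.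
move=> [n [n2 ev GE]].
have nn : n%:R != 0 :> R by rewrite pnatr_eq0 -lt0n (leq_trans _ n2).
have Gn : G (rotation (2 * pi / n%:R)).
  by case: GE => [->|[u _ ->]]; apply: sub_generated; [|left].
have := group_rotation_nat Gg n./2 Gn.
rewrite (_ : n./2%:R * _ = pi)//.
have -> : n%:R = n./2%:R * 2 :> R.
  by rewrite -natrM muln2 -{1}[n]odd_double_half (negbTE ev).
have h0 : n./2%:R != 0 :> R.
  by rewrite pnatr_eq0; case: (n) n2 => [|[|]].
by field.
Qed.

Lemma image_disk G w g : isometry_group G -> fixes_origin G -> G g ->
  g @` disk w = disk w.
Proof.
move=> [Gi _ _ Ginv] Gfix Gg; apply/seteqP; split => y.
  by move=> [x xw <-]; rewrite /disk /= isometry_enorm//; [exact: Gi|exact: Gfix].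
move=> yw; have [h Gh [gh _]] := Ginv _ Gg.
exists (h y); last exact: (congr1 (fun F => F y) gh).
by rewrite /disk /= isometry_enorm//; [exact: Gi|exact: Gfix].
Qed.

(** Invariance under the half turn makes opposite support values equal, hence all equal to [w / 2]:
    the disk is the only admissible body. *)
Lemma half_turn_minimizer G w : isometry_group G -> fixes_origin G -> 0 < w ->
  G (rotation pi) -> forall K, minimizer G w K <-> K = disk w.
Proof.
move=> Gg Gfix w0 Gpi.
have bD := disk_body w0.
have uniq K : admissible G w K -> K = disk w.
  move=> [bK wK iK]; have [cK vK _] := bK; have K0 := convex_body_neq0 bK.
  have [cD vD _] := bD; apply: supp_inj => //; first exact: convex_body_neq0.
  move=> t; rewrite -!/(supp _ t) supp_disk//.
  have := supp_width wK t; rewrite (supp_rotation t cK K0 (iK _ Gpi)); lra.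
have aD : admissible G w (disk w).
  by split=> //; [exact: disk_width|move=> g Gg'; exact: (image_disk _ Gg Gfix)].
move=> K; split=> [[aK _]|->]; first exact: uniq.
by split=> // L /uniq ->.
Qed.

Lemma reflection_minimizer (w : R) (a : R) : 0 < w ->
  forall K, minimizer (dihedral_group 1 (polar a)) w K <->
    regular_reuleaux 3 w K /\ reflection (polar a) @` K = K.
Proof.
move=> w0 K.
have inv L : reflection (polar a) @` L = L -> invariant_under (dihedral_group 1 (polar a)) L.
  by apply: dihedral_invariant; rewrite rotation_2pi image_id.
have wT c t : constant_width w (reuleaux 3 w c t) by exact: reuleaux_width.
have bT c t : convex_body (reuleaux 3 w c t) by exact: reuleaux_convex_body.
have encl c t : enclosed_region (reuleaux_boundary 3 w c t) = reuleaux 3 w c t.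
  exact: enclosed_reuleaux.
split.
  move=> [[bK wK iK] Kmin]; split; last first.
    by apply: iK; apply: sub_generated; right.
  have [_ eqc] := area_reuleaux_translate w0 bK wK.
  have [|c [t ->]] := eqc; last by exists c, t; rewrite encl.
  (* The centered triangle with a vertex on the axis is fixed by the reflection, so it competes with
     [K]. *)
  rewrite -(area_reuleaux_center w0 0 a); apply: Kmin; split=> //; apply: inv.
  by rewrite reflection_reuleaux//; congr reuleaux; ring.
move=> [[c [t ->]] sT]; rewrite encl in sT *; split; first by split=> //; exact: inv.
move=> L [bL wL _]; rewrite (area_reuleaux_center w0).
by have [] := area_reuleaux_translate w0 bL wL.
Qed.

Lemma cyclic_minimizer n (w : R) : 0 < w -> (3 <= n)%N -> odd n ->
  (forall K, minimizer (cyclic_group n) w K <-> centered_regular_reuleaux n w K) /\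
  (exists K0, forall K, minimizer (cyclic_group n) w K <-> exists a, K = rotation a @` K0).
Proof.
move=> w0 n3 no.
have rT t : rotation (2 * pi / n%:R) @` reuleaux n w 0 t = reuleaux n w 0 t.
  by rewrite rotation_reuleaux -[2 * pi / _]mul1r (reuleaux_shift _ _ _ 1%N).
have iT t : invariant_under (cyclic_group n) (reuleaux n w 0 t).
  exact/cyclic_invariant/rT.
have minE K : minimizer (cyclic_group n) w K <-> exists t, K = reuleaux n w 0 t.
  rewrite (symmetric_minimizer n3 no w0 _ (iT 0)); last exact: sub_generated.
  by split=> [[]//|[t ->]]; split; [exists t|exact: iT].
split=> [K|]; first by rewrite minE (reuleaux_centeredP n3 no w0).
exists (reuleaux n w 0 0) => K; rewrite minE.
by split=> -[t ->]; exists t; rewrite rotation_reuleaux add0r.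
Qed.

(** The reflection takes [T t] to [T (2 a - t)], which is [T t] exactly when [t - a] is a multiple
    of [pi / n], up to full turns. As [T] has period [2 pi / n] in [t], two orientations remain. *)
Lemma dihedral_minimizer n (w : R) (a : R) : 0 < w -> (3 <= n)%N -> odd n ->
  let G := dihedral_group n (polar a) in
  [/\ forall K, minimizer G w K <-> centered_regular_reuleaux n w K /\ invariant_under G K,
      forall K, minimizer G w K <->
        centered_regular_reuleaux n w K /\ reflection (polar a) @` K = K &
      exists K1 K2, K1 <> K2 /\ forall K, minimizer G w K <-> K = K1 \/ K = K2].
Proof.
move=> w0 n3 no G.
have p0 := pi_gt0 R.
have nn : n%:R != 0 :> R by rewrite pnatr_eq0 -lt0n (leq_trans _ n3).
pose T t := reuleaux n w 0 t.
have shift t k : T (t + k%:R * (2 * pi / n%:R)) = T t by exact: reuleaux_shift.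
have rT t : rotation (2 * pi / n%:R) @` T t = T t.
  by rewrite /T rotation_reuleaux -[2 * pi / _]mul1r (reuleaux_shift _ _ _ 1%N).
have sT t : reflection (polar a) @` T t = T (a + a - t) by exact: reflection_reuleaux.
have sTa : reflection (polar a) @` T a = T a by rewrite sT; congr reuleaux; ring.
have iT t : reflection (polar a) @` T t = T t -> invariant_under G (T t).
  by move=> h; apply: dihedral_invariant => //; exact: rT.
have min1 K : minimizer G w K <-> (exists t, K = T t) /\ invariant_under G K.
  apply: (symmetric_minimizer n3 no w0 _ (iT _ sTa)).
  by apply: sub_generated; left.
have min2 K : minimizer G w K <-> (exists t, K = T t) /\ reflection (polar a) @` K = K.
  rewrite min1; split=> -[[t ->] h]; split; try by exists t.
    by apply: h; apply: sub_generated; right.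
  exact: iT.
split=> [K|K|]; rewrite ?(reuleaux_centeredP n3 no w0)//.
exists (T a), (T (a + pi / n%:R)); split.
  (* Equality of the two polygons would give [1 + 2 j n = 2 q], against parity. *)
  move=> /(reuleaux_eq_angle n3 no w0)[j [q e]].
  have : 1 + (j * n).*2%:R = q.*2%:R :> R.
    apply: (@mulIf _ (pi / n%:R)); first by rewrite gt_eqF// divr_gt0// ltr0n (leq_trans _ n3).
    rewrite -!mul2n !natrM.
    have -> : (1 + 2 * (j%:R * n%:R)) * (pi / n%:R) = pi / n%:R + j%:R * (2 * pi) :> R by field.
    by apply: (addrI a); rewrite addrA e; field.
  rewrite -[1]/(1%:R) -natrD => /eqP; rewrite eqr_nat => /eqP /(congr1 odd).
  by rewrite oddD !odd_double.
move=> K; rewrite min2; split; last first.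
  move=> [->|->]; split=> //; [by exists a|by exists (a + pi / n%:R)|].
  rewrite sT -(shift _ 1%N); congr reuleaux; field.
  by [].
move=> [[t ->]]; rewrite sT => /esym /(reuleaux_eq_angle n3 no w0)[j [q e]].
have tE : t + q%:R * (2 * pi / n%:R) = a + (j * n + q)%:R * (pi / n%:R).
  rewrite natrD natrM.
  have e2 : a + a - t + j%:R * (2 * pi) = t + q%:R * (2 * pi / n%:R) by [].
  have e3 : t = a + j%:R * pi - q%:R * (pi / n%:R).
    have e4 : q%:R * (2 * pi / n%:R) = 2 * (q%:R * (pi / n%:R)) :> R by field.
    move: e2; rewrite e4; lra.
  by rewrite {1}e3; field.
(* Even multiples of [pi / n] are periods, so only the parity of [N] matters. *)
have := shift t q; rewrite tE => <-; set N := (j * n + q)%N.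
have NE : N%:R = (odd N)%:R + N./2%:R * 2 :> R.
  by rewrite -natrM muln2 -natrD odd_double_half.
rewrite NE; case: (odd N) => /=; [right|left].
  by rewrite -[RHS](shift _ N./2); congr reuleaux; field.
by rewrite -[RHS](shift _ N./2); congr reuleaux; field.
Qed.

End Cases.

Theorem theorem1p1 (R : realType) (G : set (R * R -> R * R)) (w : R)
  (Ggroup : isometry_group G) (Gfix : fixes_origin G)
  (Gfinite : finite_set G) (Gnontrivial : G <> [set id]) (w_gt0 : 0 < w) :
  ((exists2 n, (2 <= n)%N & G = cyclic_group n) \/
   (exists n u, [/\ (1 <= n)%N, unit_vector u & G = dihedral_group n u]))
  /\
  (forall u : R * R, unit_vector u -> G = dihedral_group 1 u ->
    forall K, minimizer G w K <->
      regular_reuleaux 3 w K /\ reflection u @` K = K)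
  /\
  ((G (rotation pi) <->
      exists n, [/\ (2 <= n)%N, ~~ odd n &
        G = cyclic_group n \/
        exists2 u, unit_vector u & G = dihedral_group n u]) /\
   (G (rotation pi) -> forall K, minimizer G w K <-> K = disk w))
  /\
  (forall n : nat, (3 <= n)%N -> odd n -> G = cyclic_group n ->
    (forall K, minimizer G w K <-> centered_regular_reuleaux n w K) /\
    (exists K0, forall K, minimizer G w K <-> exists a, K = rotation a @` K0))
  /\
  (forall (n : nat) (u : R * R), (3 <= n)%N -> odd n -> unit_vector u ->
    G = dihedral_group n u ->
    [/\ forall K, minimizer G w K <->
          centered_regular_reuleaux n w K /\ invariant_under G K,
        forall K, minimizer G w K <->
          centered_regular_reuleaux n w K /\ reflection u @` K = K &
        exists K1 K2, K1 <> K2 /\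
          forall K, minimizer G w K <-> K = K1 \/ K = K2]).
Proof.
split.
  have [n [n0 Gn mult [[rots GE]|[a GE]]]] := group_classification Ggroup Gfix Gfinite.
    (* For [n = 1] every rotation in [G] would be by a multiple of a full turn and [G] would be
       trivial. *)
    left; exists n => //; rewrite ltn_neqAle n0 andbT; apply/eqP => n1.
    apply: Gnontrivial; apply/seteqP; split => f; last by move=> ->; case: Ggroup.
    move=> Gf; have [s fE] := rots _ Gf.
    have [z sE] : exists z : int, s = z%:~R * (2 * pi / n%:R) by apply: mult; rewrite -fE.
    have g0 : isometry_group [set id : R * R -> R * R].
      split.
      - by move=> g -> x y.
      - by [].
      - by move=> g h -> ->.
      - by move=> g ->; exists id.
    rewrite fE sE; apply: (group_rotation_int g0).
    by rewrite -n1 rotation_2pi.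
  by right; exists n, (polar a); split=> //; exact: unit_vector_polar.
split.
  by move=> u /unit_polar[a ->] ->; exact: reflection_minimizer.
split.
  split; first exact: half_turn_iff.
  exact: half_turn_minimizer.
split.
  by move=> n n3 no ->; exact: cyclic_minimizer.
by move=> n u n3 no /unit_polar[a ->] ->; exact: dihedral_minimizer.
Qed.
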